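(* Let $n\ge1$, $T>0$, and let $L:\mathbb{R}^n\to\mathbb{R}$, $L=L(u)$, be smooth and uniformly convex. Then there exists a $\mathcal{G}_\delta$ subset $\mathcal{M}\subseteq\mathcal{C}^4(\mathbb{R}^n)$ (an intersection of countably many open dense subsets of $\mathcal{C}^4(\mathbb{R}^n)$) such that, for every $\psi\in\mathcal{M}$, the set $$\Omega_\psi=\Big\{(z,\mathbf{v})\in\mathbb{R}^n\times S^{n-1}\;:\;x_z(0,z)\mathbf{v}=0,\quad \bigl(D^2\psi(z)\mathbf{v}\bigr)\cdot x_{zz}(0,z)(\mathbf{v}\otimes\mathbf{v})=0\Big\}$$ is an embedded ($C^1$) submanifold of $\mathbb{R}^n\times S^{n-1}$ of dimension $n-2$.
   Context: $\mathcal{C}^k(\mathbb{R}^n)$ is the Banach space of bounded functions $\mathbb{R}^n\to\mathbb{R}$ with bounded continuous partial derivatives up to order $k$, with the usual $\mathcal{C}^k$ norm. ''Smooth'' means $C^\infty$; ''uniformly convex'' means that for some $\delta_L>0$ the matrix $D^2L(u)-\delta_L\mathbb{I}_n$ is positive semidefinite for all $u\in\mathbb{R}^n$. $S^{n-1}$ is the set of unit vectors in $\mathbb{R}^n$. Define $H(p)=\min_{\omega\in\mathbb{R}^n}\{L(\omega)+p\cdot\omega\}$ for $p\in\mathbb{R}^n$. For $\psi\in\mathcal{C}^4(\mathbb{R}^n)$ and $z\in\mathbb{R}^n$ put $$x(0,z)=z-T\,DH(\nabla\psi(z)).$$ (This is the initial point of the Pontryagin extremal ending at $z$ at time $T$ for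 the problem of minimizing $\int_0^TL(\dot x(t))\,dt+\psi(x(T))$ with given initial point.) Here $x_z(0,z)$ is the $n\times n$ Jacobian matrix of $z\mapsto x(0,z)$, and $x_{zz}(0,z)$ its second differential, a symmetric bilinear map with values in $\mathbb{R}^n$; $x_{zz}(0,z)(\mathbf{v}\otimes\mathbf{v})$ is its value on $(\mathbf{v},\mathbf{v})$. Conventions: the empty set counts as a submanifold of any dimension; when $n=1$ (dimension $-1$) the conclusion means that $\Omega_\psi$ is empty. *)

(* Defs.v *)
From HB Require Import structures.
From mathcomp Require Import all_boot all_order all_algebra.
From mathcomp Require Import all_classical all_reals all_analysis borel_hierarchy.

Set Implicit Arguments.
Unset Strict Implicit.
Unset Printing Implicit Defensive.

Import Order.TTheory GRing.Theory Num.Theory.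
Import numFieldNormedType.Exports.

Local Open Scope classical_set_scope.
Local Open Scope ring_scope.

(* Vectors of R^n are row vectors.  The library norm on 'rV[R]_n is the sup
   norm; the Euclidean structure is given by [dotv]. *)

Section EuclideanCalculus.
Context {R : realType} {n : nat}.
Implicit Types (f : 'rV[R]_n -> R) (s : seq 'I_n) (k : nat).

Definition dotv (u v : 'rV[R]_n) : R := \sum_(i < n) u 0 i * v 0 i.

Definition sphere1 : set 'rV[R]_n := [set v | dotv v v = 1].

Definition pderiv s f : 'rV[R]_n -> R :=
  foldr (fun (i : 'I_n) (g : 'rV[R]_n -> R) => 'D_(delta_mx 0 i) g) f s.

Definition grad f (z : 'rV[R]_n) : 'rV[R]_n := \row_i pderiv [:: i] f z.

Definition hessian f (z : 'rV[R]_n) : 'M[R]_n :=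
  \matrix_(i, j) pderiv [:: i; j] f z.

(* 'D_v g x has a junk value when the limit does not exist, hence the
   explicit requirement that the lower order derivatives be derivable. *)
Definition Ck k f : Prop := forall s, (size s <= k)%N ->
  continuous (pderiv s f) /\
  ((size s < k)%N -> forall i x, derivable (pderiv s f) x (delta_mx 0 i)).

Definition smooth f : Prop := forall k, Ck k f.

Definition psd (A : 'M[R]_n) : Prop :=
  forall v : 'rV[R]_n, 0 <= dotv (v *m A) v.

Definition uniformly_convex f : Prop :=
  exists2 delta : R, 0 < delta & forall u, psd (hessian f u - delta%:M).

Definition Ckb k f : Prop :=
  Ck k f /\ forall s, (size s <= k)%N -> bounded_fun (pderiv s f : _ -> R^o).

Lemma pderivD k f g s : Ck k f -> Ck k g -> (size s <= k)%N ->
  pderiv s (f + g) = pderiv s f + pderiv s g.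
Proof.
move=> Hf Hg; elim: s => //= i s IH sk; rewrite (IH (ltnW sk)).
apply/funext => x; apply: deriveD.
- by have [_] := Hf s (ltnW sk); apply.
- by have [_] := Hg s (ltnW sk); apply.
Qed.

Lemma pderivZ k f (a : R) s : Ck k f -> (size s <= k)%N ->
  pderiv s (a *: f) = a *: pderiv s f.
Proof.
move=> Hf; elim: s => //= i s IH sk; rewrite (IH (ltnW sk)).
by apply/funext => x; apply: deriveZ; have [_] := Hf s (ltnW sk); apply.
Qed.

Lemma pderiv0 s : pderiv s 0 = 0.
Proof.
elim: s => //= i s ->; apply/funext => x.
by rewrite (_ : 0 = cst 0) // derive_cst.
Qed.

Lemma bounded_funP f :
  bounded_fun (f : _ -> R^o) <-> exists C, forall x, `|f x| <= C.
Proof.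
split=> [[M [_ HM]]|[C HC]].
- by exists (M + 1) => x; apply: (HM (M + 1)); rewrite ?ltrDl.
- by exists C; split=> [|M CM x _]; [exact: num_real | exact: le_trans (HC x) (ltW CM)].
Qed.

Lemma Ckb0 k : Ckb k 0.
Proof.
split=> s sk; rewrite pderiv0.
- split=> [|_ i x]; first exact: cst_continuous.
  exact: derivable_cst.
- by apply/bounded_funP; exists 0 => x; rewrite normr0.
Qed.

Lemma CkbD k f g : Ckb k f -> Ckb k g -> Ckb k (f + g).
Proof.
move=> [Cf Bf] [Cg Bg]; split=> s sk; rewrite (pderivD Cf Cg sk).
- have [cf df] := Cf s sk; have [cg dg] := Cg s sk.
  split=> [x|s_lt i x]; first by apply: (@continuousD R R^o); [exact: cf|exact: cg].
  by apply: derivableD; [exact: df|exact: dg].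
- have /bounded_funP[A HA] := Bf s sk; have /bounded_funP[B HB] := Bg s sk.
  apply/bounded_funP; exists (A + B) => x.
  by apply: le_trans (ler_normD _ _) _; exact: lerD.
Qed.

Lemma CkbZ k (a : R) f : Ckb k f -> Ckb k (a *: f).
Proof.
move=> [Cf Bf]; split=> s sk; rewrite (pderivZ a Cf sk).
- have [cf df] := Cf s sk; split=> [x|s_lt i x].
    by apply: continuousM; [exact: cst_continuous|exact: cf].
  by apply: derivableZ; exact: df.
- have /bounded_funP[A HA] := Bf s sk.
  apply/bounded_funP; exists (`|a| * A) => x.
  by rewrite normrM ler_wpM2l.
Qed.

Definition Ck_derivs k f : set R :=
  [set r | exists s x, (size s <= k)%N /\ r = `|pderiv s f x|].

Definition Ck_norm k f : R := sup (Ck_derivs k f).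

Lemma Ck_derivs_has_sup k f : Ckb k f -> has_sup (Ck_derivs k f).
Proof.
move=> [_ Bf]; split; first by exists `|f 0|, [::], 0.
pose b s : R := xget 0 [set C : R | forall x, `|pderiv s f x| <= C].
have Hb s : (size s <= k)%N -> forall x, `|pderiv s f x| <= b s.
  by move=> /Bf/bounded_funP [C HC]; rewrite /b; case: xgetP => // /(_ C).
pose B := \sum_(m < k.+1) \sum_(t : m.-tuple 'I_n) `|b t|.
exists B => _ [s [x [sk ->]]].
apply: (le_trans (Hb s sk x)); apply: le_trans (ler_norm _) _.
have sk1 : (size s < k.+1)%N by [].
rewrite /B (bigD1 (Ordinal sk1)) //= (bigD1 (in_tuple s)) //= -addrA lerDl.
by rewrite addr_ge0 // ?sumr_ge0 // => *; rewrite sumr_ge0.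
Qed.

Lemma Ck_norm_ub k f s x :
  Ckb k f -> (size s <= k)%N -> `|pderiv s f x| <= Ck_norm k f.
Proof.
move=> Hf sk; apply: ub_le_sup; first by case: (Ck_derivs_has_sup Hf).
by exists s, x.
Qed.

Lemma Ck_norm_le k f (C : R) :
  (forall s x, (size s <= k)%N -> `|pderiv s f x| <= C) -> Ck_norm k f <= C.
Proof.
move=> H; apply: ge_sup; first by exists `|f 0|, [::], 0.
by move=> _ [s [x [sk ->]]]; exact: H.
Qed.

Lemma Ck_normD k f g : Ckb k f -> Ckb k g ->
  Ck_norm k (f + g) <= Ck_norm k f + Ck_norm k g.
Proof.
move=> Hf Hg; apply: Ck_norm_le => s x sk.
rewrite (pderivD Hf.1 Hg.1 sk).
by apply: le_trans (ler_normD _ _) _; apply: lerD; exact: Ck_norm_ub.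
Qed.

Lemma Ck_normZ_le k (a : R) f : Ckb k f ->
  Ck_norm k (a *: f) <= `|a| * Ck_norm k f.
Proof.
move=> Hf; apply: Ck_norm_le => s x sk; rewrite (pderivZ a Hf.1 sk) normrM.
by rewrite ler_wpM2l // Ck_norm_ub.
Qed.

Lemma Ck_normZ k (a : R) f : Ckb k f ->
  Ck_norm k (a *: f) = `|a| * Ck_norm k f.
Proof.
move=> Hf; apply/eqP; rewrite eq_le Ck_normZ_le //=.
have [->|a0] := eqVneq a 0.
  rewrite normr0 mul0r scale0r.
  exact: le_trans (normr_ge0 _) (Ck_norm_ub 0 (Ckb0 k) (leq0n k : size [::] <= k)%N).
rewrite -ler_pdivlMl ?normr_gt0 // -normfV.
rewrite -[X in Ck_norm k X <= _](scalerK a0).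
exact/Ck_normZ_le/CkbZ.
Qed.

Lemma Ck_norm_eq0 k f : Ckb k f -> Ck_norm k f = 0 -> f = 0.
Proof.
move=> Hf H0; apply/funext => x; apply/eqP; rewrite -normr_le0 -H0.
exact: (@Ck_norm_ub k f [::] x).
Qed.

End EuclideanCalculus.

Definition Cb_pred (R : realType) (n k : nat) : {pred 'rV[R]_n -> R} :=
  fun f => `[< Ckb k f >].

Lemma Cb_submod (R : realType) (n k : nat) : submod_closed (@Cb_pred R n k).
Proof.
split=> [|a f g /asboolP Hf /asboolP Hg]; apply/asboolP; first exact: Ckb0.
exact: CkbD (CkbZ a Hf) Hg.
Qed.

HB.instance Definition _ (R : realType) (n k : nat) :=
  GRing.isSubmodClosed.Build R ('rV[R]_n -> R) (@Cb_pred R n k) (@Cb_submod R n k).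

(* The space of bounded C^k functions on R^n, with the norm
   max_{|s| <= k} sup_x |d^s f x|. *)
Record Cb (R : realType) (n k : nat) :=
  MkCb { Cb_fun :> 'rV[R]_n -> R; Cb_funP : Cb_fun \in @Cb_pred R n k }.

HB.instance Definition _ (R : realType) (n k : nat) :=
  [isSub for @Cb_fun R n k].
HB.instance Definition _ (R : realType) (n k : nat) :=
  [Choice of Cb R n k by <:].
HB.instance Definition _ (R : realType) (n k : nat) :=
  [SubChoice_isSubLmodule of Cb R n k by <:].

Section CbNorm.
Context (R : realType) (n k : nat).
Implicit Types f g : Cb R n k.

Lemma CbP f : Ckb k f. Proof. exact/asboolP/(Cb_funP f). Qed.

Definition Cb_norm f : R := Ck_norm k f.

Lemma Cb_normD f g : Cb_norm (f + g) <= Cb_norm f + Cb_norm g.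
Proof. exact: Ck_normD (CbP f) (CbP g). Qed.

Lemma Cb_normZ (a : R) f : Cb_norm (a *: f) = `|a| * Cb_norm f.
Proof. exact: Ck_normZ (CbP f). Qed.

Lemma Cb_norm_eq0 f : Cb_norm f = 0 -> f = 0.
Proof. by move=> H; apply/val_inj/(Ck_norm_eq0 (CbP f) H). Qed.

HB.instance Definition _ :=
  Lmodule_isNormed.Build R (Cb R n k) Cb_normD Cb_normZ Cb_norm_eq0.

End CbNorm.

Section SecondDifferential.
Context {R : realType} {V W : normedModType R}.

Definition second_diff (f : V -> W) (z u v : V) : W :=
  'd (fun y => 'd f y v : W) z u.

(* On finite-dimensional spaces, pointwise continuity of y |-> 'd f y is
   the same as continuity in operator norm. *)
Definition C1_on (U : set V) (f : V -> W) : Prop :=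
  forall x, U x -> differentiable f x /\
    forall v, {for x, continuous (fun y => 'd f y v : W)}.

End SecondDifferential.

(* S is an embedded C^1 submanifold, of dimension d, of the m-dimensional
   embedded submanifold M of the finite-dimensional space E: around every
   point of S there is a chart phi of M (defined on M `&` U, with image the
   open set W of R^m and inverse g) in which S is the slice where the last
   m - d coordinates vanish.  In negative dimension S is empty. *)
Definition embedded_C1_submanifold {R : realType} {E : normedModType R}
    (m : nat) (M : set E) (d : int) (S : set E) : Prop :=
  match d with
  | Posz d' =>
    S `<=` M /\
    forall p, S p ->
    exists (U : set E) (W : set 'rV[R]_m) (phi : E -> 'rV[R]_m)
           (g : 'rV[R]_m -> E),
      [/\ open U /\ U p, open W, C1_on U phi /\ C1_on W g,
          (forall q, U q -> M q -> W (phi q) /\ g (phi q) = q) /\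
          (forall w, W w -> [/\ U (g w), M (g w) & phi (g w) = w]) &
          forall q, U q -> M q ->
            (S q <-> forall i : 'I_m, (d' <= i)%N -> phi q 0 i = 0)]
  | Negz _ => S = set0
  end.

Section BolzaProblem.
Context {R : realType} {n : nat}.
Implicit Types (L psi : 'rV[R]_n -> R) (T : R).

(* The minimum of A is the element of A `&` lbound A. *)
Definition Hamiltonian L (p : 'rV[R]_n) : R :=
  let A := [set L w + dotv p w | w in [set: 'rV[R]_n]] in
  xget 0 (A `&` lbound A).

Definition initial_point L T psi (z : 'rV[R]_n) : 'rV[R]_n :=
  z - T *: grad (Hamiltonian L) (grad psi z).

(* With row vectors, v *m 'J f z is the value at v of the differential of f
   at z, i.e. the usual Jacobian matrix applied to v. *)
Definition Omega L T psi : set ('rV[R]_n * 'rV[R]_n) :=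
  [set zv | let: (z, v) := zv in
    [/\ sphere1 v,
        v *m 'J (initial_point L T psi) z = 0 &
        dotv (v *m hessian psi z) (second_diff (initial_point L T psi) z v v) = 0]].

End BolzaProblem.

(* Main.v *)
(* Write w(z) = DH(D psi(z)), so that DL(w(z)) = - D psi(z).  Differentiating this
   identity twice shows that (z, v) with |v| = 1 is in Omega_psi if and only if
     T D^2 psi(z) v + D^2 L(w) v = 0   and   D^3 psi(z) v^3 + T^-2 D^3 L(w) v^3 = 0.
   Together with |v|^2 = 1 these are n + 2 equations in R^(2n).  If their differentials
   are dependent at a point of Omega_psi, pairing with v (Euler's identity) shows that
   the multiplier of |v|^2 = 1 vanishes, and the other multipliers (a, b) <> 0 solve,
   together with (z, w, v), a system which involves psi only through its 4-jet at z and
   which has more equations than unknowns.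

   Such an overdetermined system has no solution for generic psi, although psi is only
   C^4 and the system is merely continuous.  Near a given parameter, perturb psi by
   m fixed functions with coefficients theta on a grid of q^m points.  If every theta
   admitted a near-solution, two of these solutions, for distinct theta, would lie in a
   common cell of a grid of about q^k points, as k < m; this contradicts the
   invertibility of the system in theta, provided that it is Lipschitz in its unknowns
   at the scale of the cells.  The latter is arranged by first averaging psi over a fine
   finite set of translates.  The perturbations are sine waves sin(kap . x + c), whose
   derivatives separate the equations by homogeneity in kap.

   For n >= 2 the inverse function theorem then provides the charts; for n = 1, three
   independent linear forms on R^2 do not exist, so that Omega_psi is empty. *)

Require Import Defs.
From HB Require Import structures.
From mathcomp Require Import all_boot all_order all_algebra.
From mathcomp Require Import all_classical all_reals all_analysis borel_hierarchy.
From mathcomp Require Import ring lra.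

Set Implicit Arguments.
Unset Strict Implicit.
Unset Printing Implicit Defensive.

Import Order.TTheory GRing.Theory Num.Theory.
Import numFieldNormedType.Exports.

Local Open Scope classical_set_scope.
Local Open Scope ring_scope.

(** * Differential calculus on R^n *)

(** The velocity w stays an unknown, tied to z by the costate equation: substituting w = DH(D psi)
    would make the system nonlinear in the jet of psi. The derivative of w in z is removed by an
    adjoint vector computed from L, a, b and v alone. What results is affine in the 4-jet of psi,
    with coefficients that are locally Lipschitz in the unknowns. The multiplier system has to be
    split, because the way psi enters its equations depends on (a, b). If b <> 0, the term b D^4
    psi(z) v^3 makes the equations independent. If b = 0, this role falls to D^3 psi(z)(a, v), and
    the directions of a along v and transverse to v must be treated apart, since the equations
    become partly dependent. In each case homogeneity in v and in (a, b) removes enough unknowns to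
    leave one equation too many. Affinity in the jet also settles the quantifiers: the
    perturbations, and the radius of the ball of unknowns on which they act almost as the identity,
    depend on the point only and not on psi. Countably many balls with rational centres therefore
    suffice, and a positive lower bound on each of them is an open condition. *)

Section FrechetEps.
Context {R : realType} {V W : normedModType R}.
Implicit Types (f : V -> W) (x h : V).

(** Differentiability is proved throughout by explicit error estimates; uniqueness of the
    differential then yields its value at the same time. *)
Lemma diff_epsP f (df : {linear V -> W}) x : continuous df ->
  (forall e : R, 0 < e -> exists2 d : R, 0 < d &
     forall h, `|h| < d -> `|f (x + h) - f x - df h| <= e * `|h|) ->
  differentiable f x /\ 'd f x = df :> (V -> W).
Proof.
move=> cdf H.
have E : f \o shift x = cst (f x) + df +o_ 0 id.
  apply/eqaddoP => e e0; have [d d0 Hd] := H e e0.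
  apply/nbhs_normP; exists d => //= h; rewrite /ball_/= sub0r normrN => /Hd.
  by rewrite !fctE /= opprD addrA [h + x]addrC.
have dE := diff_unique cdf E; split=> //.
by apply/diff_locallyP; rewrite dE.
Qed.

Lemma diff_eps f x (e : R) : differentiable f x -> 0 < e ->
  exists2 d : R, 0 < d &
     forall h, `|h| < d -> `|f (x + h) - f x - 'd f x h| <= e * `|h|.
Proof.
move=> /diff_locallyP[_ /eqaddoP/[apply]] /nbhs_normP[d /= d0 Hd]; exists d => // h hd.
have /= := Hd h; rewrite /ball_/= sub0r normrN => /(_ hd).
by rewrite !fctE /= opprD addrA [h + x]addrC.
Qed.

End FrechetEps.

Section Lines.
Context {R : realType} {V : normedModType R}.
Implicit Types (f : V -> R) (x v : V).

Lemma derive_lineE f x v t : derivable f (x + t *: v) v ->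
  is_derive t 1 (fun s : R => f (x + s *: v)) ('D_v f (x + t *: v)).
Proof.
move=> df.
have E : (fun h : R => h^-1 *: (((fun s : R => f (x + s *: v)) \o shift t) (h *: 1)
      - f (x + t *: v)))
   = (fun h : R => h^-1 *: ((f \o shift (x + t *: v)) (h *: v) - f (x + t *: v))).
  apply/funext => h /=; congr (_ *: (f _ - _)).
  by rewrite scalerDl [h *: 1]mulr1 addrCA addrA.
split; first by rewrite /derivable E.
by rewrite /derive E.
Qed.

Lemma MVT_line f x v : (forall y, derivable f y v) ->
  exists2 t : R, 0 < t < 1 & f (x + v) - f x = 'D_v f (x + t *: v).
Proof.
move=> df.
have D (t : R) : is_derive t 1 (fun s : R => f (x + s *: v)) ('D_v f (x + t *: v)).
  exact: derive_lineE.
have [|t] := MVT (@ltr01 R) (fun t _ => D t).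
  apply: derivable_within_continuous => t _; exact: ex_derive.
rewrite in_itv /= => t01 E; exists t => //.
by move: E; rewrite scale1r scale0r addr0 subr0 mulr1.
Qed.

End Lines.

Section RowNorm.
Context {R : realType} {n : nat}.
Implicit Types (u v : 'rV[R]_n).

Lemma norm_coord u i : `|u 0 i| <= `|u|.
Proof.
rewrite [leRHS]/Num.Def.normr/= mx_normrE; exact: (le_bigmax _ _ (0 : 'I_1, i)).
Qed.

Lemma norm_rV_le u (C : R) : 0 <= C -> (forall i, `|u 0 i| <= C) -> `|u| <= C.
Proof.
move=> C0 H; rewrite /Num.Def.normr/= mx_normrE bigmax_le // => -[i j] _ /=.
by rewrite ord1.
Qed.

Lemma norm_delta i : `|delta_mx 0 i : 'rV[R]_n| = 1.
Proof.
apply/eqP; rewrite eq_le; apply/andP; split.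
  apply: norm_rV_le => // j; rewrite mxE eqxx /=; case: eqP; rewrite ?normr1 ?normr0 //.
by have := norm_coord (delta_mx 0 i) i; rewrite mxE !eqxx normr1.
Qed.

Lemma row_sum_basis u : u = \sum_i u 0 i *: delta_mx 0 i.
Proof. exact: row_sum_delta. Qed.

End RowNorm.

Section ContEps.
Context {R : realType} {V W : normedModType R}.
Implicit Types (f : V -> W) (x h : V).

Lemma cont_epsP f x : {for x, continuous f} <->
  (forall e : R, 0 < e -> exists2 d : R, 0 < d &
     forall h, `|h| < d -> `|f (x + h) - f x| <= e).
Proof.
split=> [/cvgrPdist_le cf e /cf /nbhs_normP[d /= d0 Hd]|H].
  exists d => // h hd; rewrite distrC; apply: Hd.
  by rewrite /ball_/= opprD addrA subrr sub0r normrN.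
apply/cvgrPdist_le => e /H[d d0 Hd]; apply/nbhs_normP; exists d => //= y.
by rewrite /ball_/= distrC => /Hd; rewrite addrCA subrr addr0 distrC.
Qed.

Lemma cont_epsP' f x : {for x, continuous f} <->
  (forall e : R, 0 < e -> exists2 d : R, 0 < d &
     forall y, `|y - x| < d -> `|f y - f x| <= e).
Proof.
split=> [/cont_epsP H e /H[d d0 Hd]|H]; last apply/cont_epsP => e /H[d d0 Hd].
  by exists d => // y /Hd; rewrite addrCA subrr addr0.
by exists d => // h hd; apply: Hd; rewrite addrAC subrr add0r.
Qed.

End ContEps.

Lemma common_radius {R : realType} (I : finType) (P : I -> R -> Prop) :
  (forall i, exists2 d : R, 0 < d & P i d) ->
  (forall i d d', P i d -> 0 < d' -> d' <= d -> P i d') ->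
  exists2 d : R, 0 < d & forall i, P i d.
Proof.
move=> ex mono; have [d Hd] := choice (fun i => let: ex_intro2 d d0 Pd := ex i in
  ex_intro (fun d => 0 < d /\ P i d) d (conj d0 Pd)).
exists (\big[Order.min/1]_i d i).
  by apply/bigmin_gtP; split=> // i _; have [] := Hd i.
move=> i; have [d0 Pd] := Hd i; apply: mono Pd _ _; last exact: bigmin_le.
by apply/bigmin_gtP; split=> // j _; have [] := Hd j.
Qed.

Section Partials.
Context {R : realType}.

Lemma MVT_signed (V : normedModType R) (f : V -> R) x v (s : R) :
  (forall y, derivable f y v) ->
  exists2 t : R, `|t| <= `|s| & f (x + s *: v) - f x = s * 'D_v f (x + t *: v).
Proof.
move=> df.
have D (t : R) : is_derive t 1 (fun s : R => f (x + s *: v)) ('D_v f (x + t *: v)).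
  exact: derive_lineE.
have C (A : set R) : {within A, continuous (fun s : R => f (x + s *: v))}.
  apply: continuous_subspaceT => t.
  have /derivable1_diffP := @ex_derive _ _ _ _ _ _ _ (D t).
  exact: differentiable_continuous.
have [s0|s0] := leP 0 s.
  have [t tI] := MVT_segment s0 (fun t _ => D t) (C _).
  rewrite scale0r addr0 subr0 mulrC => E; exists t => //.
  by move: tI; rewrite in_itv /= => /andP[t0 ts]; rewrite !ger0_norm.
have [t tI] := MVT_segment (ltW s0) (fun t _ => D t) (C _).
rewrite scale0r addr0 sub0r mulrN => /eqP; rewrite -eqr_oppLR opprB => /eqP E.
exists t; last by rewrite E mulrC.
move: tI; rewrite in_itv /= => /andP[ts t0].
by rewrite !ler0_norm ?lerN2 // ltW.
Qed.

Context {n : nat}.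
Notation e_ i := (delta_mx 0 i : 'rV[R]_n).
Implicit Types (f : 'rV[R]_n -> R).

Definition lincomb (g : 'I_n -> R) (u : 'rV[R]_n) : R := \sum_i u 0 i * g i.

Lemma lincomb_is_linear g : linear (lincomb g).
Proof.
move=> a u v; rewrite /lincomb [a *: (\sum_i _)]mulr_sumr -big_split /=.
by apply: eq_bigr => i _; rewrite !mxE mulrDl mulrA.
Qed.
HB.instance Definition _ g :=
  GRing.isLinear.Build R 'rV[R]_n R _ (lincomb g) (lincomb_is_linear g).

Lemma rV_linear_continuous (W : normedModType R) (F : {linear 'rV[R]_n -> W}) :
  continuous F.
Proof.
have H u : `|F u| <= (\sum_i `|F (e_ i)|) * `|u|.
  rewrite [X in F X]row_sum_basis linear_sum mulr_suml.
  apply: le_trans (ler_norm_sum _ _ _) _; apply: ler_sum => i _.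
  by rewrite linearZ normrZ mulrC ler_wpM2l // norm_coord.
move=> x; apply/cont_epsP => e e0.
set M := \sum_i `|F (e_ i)| in H.
have M0 : 0 <= M by apply: sumr_ge0.
exists (e / (M + 1)); first by rewrite divr_gt0 // ltr_pwDr.
move=> y /= xy; rewrite linearD addrAC subrr add0r; apply: le_trans (H _) _.
have := ltW xy; rewrite ler_pdivlMr ?ltr_pwDr // mulrC => H1; apply: le_trans H1.
by rewrite ler_wpM2r // lerDl.
Qed.

(** The successive truncations of h join x to x + h by n axis-parallel segments. They serve for
    differentials from partial derivatives and, later, for the Lipschitz estimate of averages. *)
Definition trunc_row (h : 'rV[R]_n) (k : nat) : 'rV[R]_n :=
  \row_j (if (j < k)%N then h 0 j else 0).

Lemma trunc_row0 h : trunc_row h 0 = 0.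
Proof. by apply/rowP => j; rewrite !mxE. Qed.
Lemma trunc_rown h : trunc_row h n = h.
Proof. by apply/rowP => j; rewrite !mxE ltn_ord. Qed.
Lemma trunc_rowS h (k : 'I_n) : trunc_row h k.+1 = trunc_row h k + h 0 k *: e_ k.
Proof.
apply/rowP => j; rewrite !mxE eqxx /= ltnS leq_eqVlt.
have [->|/negbTE jk] := eqVneq j k; first by rewrite eqxx ltnn /= mulr1 add0r.
by rewrite (inj_eq val_inj) jk /= mulr0 addr0.
Qed.

Lemma diff_partials f x : (forall i y, derivable f y (e_ i)) ->
  (forall i, {for x, continuous ('D_(e_ i) f)}) ->
  differentiable f x /\ 'd f x = lincomb (fun i => 'D_(e_ i) f x) :> (_ -> R).
Proof.
move=> df cf; apply: diff_epsP; first exact: rV_linear_continuous.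
(* There are n coordinate steps to share the error; n + 1 also covers n = 0. *)
move=> e e0; set e' := e / n.+1%:R.
have e'0 : 0 < e' by rewrite divr_gt0.
have [d d0 Hd] : exists2 d : R, 0 < d & forall y, `|y| < d -> forall i,
    `|'D_(e_ i) f (x + y) - 'D_(e_ i) f x| <= e'.
  have [|i d d' Hd d'0 d'd y yd|d d0 Hd] := @common_radius R 'I_n (fun i d => forall y, `|y| < d ->
    `|'D_(e_ i) f (x + y) - 'D_(e_ i) f x| <= e').
  - by move=> i; have /cont_epsP/(_ _ e'0) := cf i.
  - by apply: Hd; exact: lt_le_trans d'd.
  - by exists d => // y yd i; exact: Hd.
exists d => // h hd.
have E : f (x + h) - f x =
    \sum_(k < n) (f (x + trunc_row h k.+1) - f (x + trunc_row h k)).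
  rewrite -(big_mkord xpredT (fun k => f (x + trunc_row h k.+1) - f (x + trunc_row h k))).
  by rewrite (telescope_sumr (fun k => f (x + trunc_row h k))) // trunc_row0 trunc_rown addr0.
rewrite E /= /lincomb -sumrB.
apply: le_trans (ler_norm_sum _ _ _) _.
apply: (@le_trans _ _ (\sum_(k < n) e' * `|h|)).
  apply: ler_sum => k _; rewrite trunc_rowS addrA.
  have [t tle ->] := MVT_signed (x + trunc_row h k) (h 0 k) (df k).
  rewrite -mulrBr normrM mulrC ler_pM //; last exact: norm_coord.
  rewrite -addrA; apply: Hd; apply: le_lt_trans hd.
  apply: norm_rV_le => // j; rewrite !mxE eqxx /=.
  have [->|jk] := eqVneq j k; rewrite ?ltnn ?add0r ?mulr1 ?mulr0 ?addr0.
    by apply: le_trans tle (norm_coord _ _).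
  by case: ifP; rewrite ?normr0 // norm_coord.
rewrite sumr_const card_ord -mulrnAl ler_wpM2r // /e' -mulrnAr -[leRHS]mulr1 ler_wpM2l ?(ltW e0) //.
by rewrite -[leLHS]mulr_natl ler_pdivrMr ?mul1r ?ltr0n // ler_nat.
Qed.

(** Prepares Schwarz's theorem, where the two mixed derivatives are only known to agree at two
    different points, both arbitrarily close to x. *)
Lemma eq_of_near (V : normedModType R) (F G : V -> R) x :
  {for x, continuous F} -> {for x, continuous G} ->
  (forall d : R, 0 < d -> exists y z, [/\ `|y| < d, `|z| < d & F (x + y) = G (x + z)]) ->
  F x = G x.
Proof.
move=> /cont_epsP cF /cont_epsP cG H.
apply/eqP; rewrite -subr_eq0 -normr_le0; apply/ler_addgt0Pl => e e0; rewrite addr0.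
have e20 : 0 < e / 2 by rewrite divr_gt0.
have [d1 d10 H1] := cF _ e20; have [d2 d20 H2] := cG _ e20.
have d0 : 0 < Num.min d1 d2 by rewrite lt_min d10.
have [y [z []]] := H _ d0; rewrite !lt_min => /andP[/H1 Fy _] /andP[_ /H2 Gz] E.
move: Fy Gz; rewrite E !ler_distl => /andP[Fy Fy'] /andP[Gz Gz'].
by apply/andP; split; lra.
Qed.

(** Two applications of the mean value theorem: in direction a to the difference y |-> f(y + s e_b)
    - f(y), then in direction b to the partial derivative obtained. The left side is symmetric in a
    and b, which is what Schwarz's theorem exploits. *)
Lemma mixed_difference f (a b : 'I_n) x (s : R) : (forall y, derivable f y (e_ a)) ->
    (forall y, derivable ('D_(e_ a) f) y (e_ b)) ->
  exists2 y, `|y| <= `|s| + `|s| &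
    f (x + s *: e_ a + s *: e_ b) - f (x + s *: e_ a) - f (x + s *: e_ b) + f x =
    s * s * 'D_(e_ b) ('D_(e_ a) f) (x + y).
Proof.
move=> fa fab.
pose g y := f (y + s *: e_ b) - f y.
have Dg y : is_derive y (e_ a) g ('D_(e_ a) f (y + s *: e_ b) - 'D_(e_ a) f y).
  apply: is_deriveB; last exact: derivableP.
  have E : (fun h : R => h^-1 *: (((fun y => f (y + s *: e_ b)) \o shift y) (h *: e_ a)
      - f (y + s *: e_ b))) = (fun h : R => h^-1 *: ((f \o shift (y + s *: e_ b)) (h *: e_ a)
      - f (y + s *: e_ b))).
    by apply/funext => h /=; rewrite addrA.
  by split; rewrite /derivable /derive E //; exact: fa.
have [t tle E1] := MVT_signed x s (fun y => @ex_derive _ _ _ _ _ _ _ (Dg y)).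
rewrite (@derive_val _ _ _ _ _ _ _ (Dg _)) /g in E1.
have [t' t'le E2] := MVT_signed (x + t *: e_ a) s fab.
exists (t *: e_ a + t' *: e_ b).
  apply: le_trans (ler_normD _ _) _; rewrite !normrZ !norm_delta !mulr1; exact: lerD.
rewrite addrA -mulrA -E2 -E1.
by rewrite opprD opprK addrA.
Qed.

Lemma Schwarz f (i j : 'I_n) x :
  (forall y, derivable f y (e_ i)) -> (forall y, derivable f y (e_ j)) ->
  (forall y, derivable ('D_(e_ i) f) y (e_ j)) ->
  (forall y, derivable ('D_(e_ j) f) y (e_ i)) ->
  {for x, continuous ('D_(e_ j) ('D_(e_ i) f))} ->
  {for x, continuous ('D_(e_ i) ('D_(e_ j) f))} ->
  'D_(e_ j) ('D_(e_ i) f) x = 'D_(e_ i) ('D_(e_ j) f) x.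
Proof.
move=> fi fj fij fji cij cji; apply: (eq_of_near cij cji) => d d0.
pose s := d / 4.
have s0 : 0 < s by rewrite divr_gt0.
have ssd : `|s| + `|s| < d by rewrite gtr0_norm // /s; lra.
have [y1 le1 E1] := mixed_difference x s fi fij.
have [y2 le2 E2] := mixed_difference x s fj fji.
exists y1, y2; split; [exact: le_lt_trans ssd|exact: le_lt_trans ssd|].
apply: (@mulfI _ (s * s)); first by rewrite mulf_neq0 // gt_eqF.
apply: etrans (esym E1) _; apply: etrans _ E2.
have -> : x + s *: e_ i + s *: e_ j = x + s *: e_ j + s *: e_ i by exact: addrAC.
by congr (_ + _); exact: addrAC.
Qed.

End Partials.

Section RowMaps.
Context {R : realType} {V : normedModType R} {m : nat}.
Implicit Types (g : V -> 'rV[R]_m).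

Lemma cont_rV g x : (forall j, {for x, continuous (fun y => g y 0 j)}) ->
  {for x, continuous g}.
Proof.
move=> H; apply/cont_epsP => e e0.
have [|j d d' Hd d'0 d'd h hd|d d0 Hd] := @common_radius R 'I_m (fun j d => forall h, `|h| < d ->
    `|g (x + h) 0 j - g x 0 j| <= e).
- by move=> j; have /cont_epsP/(_ _ e0) := H j.
- by apply: Hd; exact: lt_le_trans d'd.
exists d => // h hd; apply: norm_rV_le (ltW e0) _ => j; rewrite !mxE; exact: Hd.
Qed.

Lemma cont_rV_coord g x j : {for x, continuous g} ->
  {for x, continuous (fun y => g y 0 j)}.
Proof.
move=> /cont_epsP H; apply/cont_epsP => e /H[d d0 Hd]; exists d => // h /Hd.
by apply: le_trans; have := norm_coord (g (x + h) - g x) j; rewrite !mxE.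
Qed.

Definition rowlin (F : 'I_m -> {linear V -> R}) (v : V) : 'rV[R]_m := \row_j F j v.

Lemma rowlin_is_linear F : linear (rowlin F).
Proof. by move=> a u v; apply/rowP => j; rewrite !mxE linearP. Qed.
HB.instance Definition _ F :=
  GRing.isLinear.Build R V 'rV[R]_m _ (rowlin F) (rowlin_is_linear F).

Lemma diff_rV g x : (forall j, differentiable (fun y => g y 0 j) x) ->
  differentiable g x /\
  forall v, 'd g x v = \row_j ('d (fun y => g y 0 j) x v : R).
Proof.
move=> H; pose F := rowlin (fun j => 'd (fun y => g y 0 j) x).
have [|e e0|dg E] := @diff_epsP _ _ _ g F x.
- move=> y; apply: cont_rV => j.
  have -> : (fun y => F y 0 j) = 'd (fun y => g y 0 j) x.
    by apply/funext => v; rewrite /F mxE.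
  exact: diff_continuous.
- have [|j d d' Hd d'0 d'd h hd|d d0 Hd] := @common_radius R 'I_m (fun j d => forall h, `|h| < d ->
    `|g (x + h) 0 j - g x 0 j - 'd (fun y => g y 0 j) x h| <= e * `|h|).
  + by move=> j; exact: diff_eps.
  + by apply: Hd; exact: lt_le_trans d'd.
  exists d => // h hd; apply: norm_rV_le => [|j]; first by rewrite mulr_ge0 // ltW.
  by rewrite !mxE; exact: Hd.
- by split=> // v; rewrite E /F /rowlin.
Qed.

End RowMaps.

Section CkCalculus.
Context {R : realType} {n : nat}.
Notation e_ i := (delta_mx 0 i : 'rV[R]_n).
Implicit Types (f g : 'rV[R]_n -> R) (s : seq 'I_n) (k : nat).

Lemma pderiv_rcons s i f : pderiv (rcons s i) f = pderiv s ('D_(e_ i) f).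
Proof. by rewrite /pderiv foldr_rcons. Qed.

Lemma CkP k f : Ck k f <-> forall s, (size s <= k)%N -> continuous (pderiv s f) /\
  ((size s < k)%N -> forall i x, derivable (pderiv s f) x (e_ i)).
Proof. by []. Qed.

Lemma Ck0P f : Ck 0 f <-> continuous f.
Proof.
split=> [/(_ [::] isT)[]//|cf s]; rewrite leqn0 size_eq0 => /eqP ->; split=> //.
Qed.

(** Peeling off the innermost derivative, that is the last letter of the index, makes the class
    inductive; the closure properties below rest on this form. *)
Lemma CkSP k f : Ck k.+1 f <->
  [/\ continuous f, forall i x, derivable f x (e_ i) & forall i, Ck k ('D_(e_ i) f)].
Proof.
split=> [H|[cf df Hf] s].
  split=> [|i x|i s sk]; first by have [] := H [::] isT.
    by have [_] := H [::] isT; apply.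
  have [|c d] := H (rcons s i); first by rewrite size_rcons.
  rewrite -pderiv_rcons; split=> // sk'; apply: d; by rewrite size_rcons.
case/lastP: s => [|s i]; first by split.
rewrite size_rcons ltnS => sk; rewrite pderiv_rcons.
by have [c d] := Hf i s sk; split.
Qed.

Lemma derive_coord (i j : 'I_n) x : is_derive x (e_ i) (fun y : 'rV[R]_n => y 0 j) (i == j)%:R.
Proof.
have E : (fun h : R => h^-1 *: (((fun y : 'rV[R]_n => y 0 j) \o shift x) (h *: e_ i) - x 0 j))
   = (fun h : R => h^-1 *: (h *: (i == j)%:R)).
  by apply/funext => h /=; rewrite !mxE eqxx /= addrK eq_sym.
have C : ((fun h : R => h^-1 *: (h *: (i == j)%:R)) @ 0^' --> ((i == j)%:R : R)).
  apply: cvg_near_cst; near=> h; rewrite scalerA mulVf ?scale1r //.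
  by near: h; exact: nbhs_dnbhs_neq.
split; first by rewrite /derivable E; apply/cvg_ex; exists (i == j)%:R.
by rewrite /derive E; exact: cvg_lim.
Unshelve. all: by end_near. Qed.

Local Opaque Ck derive.

Lemma Ck_le k k' f : (k <= k')%N -> Ck k' f -> Ck k f.
Proof.
move=> kk' /CkP H; apply/CkP => s sk; have [c d] := H s (leq_trans sk kk').
by split=> // sk'; apply: d; exact: leq_trans kk'.
Qed.

Lemma Ck_cont k f : Ck k f -> continuous f.
Proof. by move=> /(Ck_le (leq0n _))/Ck0P. Qed.

Lemma Ck_pderiv k s f : Ck (k + size s) f -> Ck k (pderiv s f).
Proof.
elim: s k f => [|i s IH] k f; first by rewrite addn0.
rewrite /= addnS -addSn => /IH/CkSP[_ _]; exact.
Qed.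

Lemma Ck_cst k (c : R) : Ck k (cst c : 'rV[R]_n -> R).
Proof.
elim: k c => [|k IH] c; first by apply/Ck0P; exact: cst_continuous.
apply/CkSP; split=> [|i x|i]; [exact: cst_continuous|exact: derivable_cst|].
by rewrite (_ : 'D_(e_ i) (cst c) = cst 0) //; apply/funext => x; rewrite derive_cst.
Qed.

Lemma CkD k f g : Ck k f -> Ck k g -> Ck k (f + g).
Proof.
elim: k f g => [|k IH] f g.
  by move=> /Ck0P cf /Ck0P cg; apply/Ck0P => x; apply: continuousD; [exact: cf|exact: cg].
move=> /CkSP[cf df Df] /CkSP[cg dg Dg]; apply/CkSP; split=> [x|i x|i].
- by apply: continuousD; [exact: cf|exact: cg].
- exact: derivableD.
- rewrite (_ : 'D_(e_ i) (f + g) = 'D_(e_ i) f + 'D_(e_ i) g); first exact: IH.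
  by apply/funext => x; rewrite deriveD.
Qed.

Lemma CkM k f g : Ck k f -> Ck k g -> Ck k (f * g).
Proof.
elim: k f g => [|k IH] f g.
  by move=> /Ck0P cf /Ck0P cg; apply/Ck0P => x; apply: continuousM; [exact: cf|exact: cg].
move=> Hf Hg; have /CkSP[cf df Df] := Hf; have /CkSP[cg dg Dg] := Hg.
apply/CkSP; split=> [x|i x|i].
- by apply: continuousM; [exact: cf|exact: cg].
- exact: derivableM.
- rewrite (_ : 'D_(e_ i) (f * g) = f * 'D_(e_ i) g + g * 'D_(e_ i) f).
    apply: CkD; apply: IH; [exact: Ck_le Hf|exact: Dg|exact: Ck_le Hg|exact: Df].
  by apply/funext => x; rewrite deriveM.
Qed.

Lemma Ck_zero k : Ck k (0 : 'rV[R]_n -> R).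
Proof. by rewrite (_ : 0 = cst 0) //; exact: Ck_cst. Qed.

Lemma Ck_one k : Ck k (1 : 'rV[R]_n -> R).
Proof. by rewrite (_ : 1 = cst 1) //; exact: Ck_cst. Qed.

Lemma CkZ k (a : R) f : Ck k f -> Ck k (a *: f).
Proof. by move=> Hf; have -> : a *: f = cst a * f by []; apply: CkM Hf; exact: Ck_cst. Qed.

Lemma CkN k f : Ck k f -> Ck k (- f).
Proof. by move=> Hf; rewrite -scaleN1r; exact: CkZ. Qed.

Lemma CkB k f g : Ck k f -> Ck k g -> Ck k (f - g).
Proof. by move=> Hf Hg; apply: CkD Hf _; exact: CkN. Qed.

Lemma Ck_sum k (I : Type) (r : seq I) (P : pred I) (F : I -> 'rV[R]_n -> R) :
  (forall i, P i -> Ck k (F i)) -> Ck k (\sum_(i <- r | P i) F i).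
Proof. by move=> H; elim/big_ind : _; [exact: Ck_zero|exact: CkD|exact: H]. Qed.

Lemma Ck_prod k (I : Type) (r : seq I) (P : pred I) (F : I -> 'rV[R]_n -> R) :
  (forall i, P i -> Ck k (F i)) -> Ck k (\prod_(i <- r | P i) F i).
Proof. by move=> H; elim/big_ind : _; [exact: Ck_one|exact: CkM|exact: H]. Qed.

Lemma Ck_sumf k (I : Type) (r : seq I) (P : pred I) (F : I -> 'rV[R]_n -> R) :
  (forall i, P i -> Ck k (F i)) -> Ck k (fun x => \sum_(i <- r | P i) F i x).
Proof.
move=> /Ck_sum; rewrite (_ : (fun x => _) = \sum_(i <- r | P i) F i) //.
by apply/funext => x; rewrite fct_sumE.
Qed.

Lemma Ck_prodf k (I : Type) (r : seq I) (P : pred I) (F : I -> 'rV[R]_n -> R) :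
  (forall i, P i -> Ck k (F i)) -> Ck k (fun x => \prod_(i <- r | P i) F i x).
Proof.
move=> /Ck_prod; rewrite (_ : (fun x => _) = \prod_(i <- r | P i) F i) //.
by apply/funext => x; elim/big_rec2 : _ => // i y z _ ->.
Qed.

Lemma Ck_coord k (j : 'I_n) : Ck k (fun y : 'rV[R]_n => y 0 j).
Proof.
case: k => [|k]; first by apply/Ck0P; exact: coord_continuous.
apply/CkSP; split=> [|i x|i]; first exact: coord_continuous.
  by have [] := derive_coord i j x.
rewrite (_ : 'D_(e_ i) _ = (cst (i == j)%:R : 'rV[R]_n -> R)); first exact: Ck_cst.
by apply/funext => x; exact: (@derive_val _ _ _ _ _ _ _ (derive_coord i j x)).
Qed.

Lemma Ck_diff f x : Ck 1 f ->
  differentiable f x /\ 'd f x = lincomb (fun i => 'D_(e_ i) f x) :> (_ -> R).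
Proof.
move=> /CkSP[cf df Df]; apply: diff_partials => [i y|i]; first exact: df.
by have /Ck0P := Df i; apply.
Qed.

Lemma Ck_sym2 f i j x : Ck 2 f -> pderiv [:: i; j] f x = pderiv [:: j; i] f x.
Proof.
move=> /CkSP[cf df Df] /=.
have H a b : (forall y, derivable ('D_(e_ a) f) y (e_ b)) /\
    continuous ('D_(e_ b) ('D_(e_ a) f)).
  by have /CkSP[_ d1 D1] := Df a; split; [move=> y; exact: d1|apply/Ck0P; exact: D1].
have [d1 c1] := H i j; have [d2 c2] := H j i.
exact: (Schwarz (df j) (df i) d2 d1 (c2 x) (c1 x)).
Qed.

(** The first letter of [s] is moved through [t] by swaps of the two outermost letters, each of them
    Schwarz's theorem for the derivative along the remaining ones. *)
Lemma pderiv_perm k f s t : Ck k f -> (size s <= k)%N -> perm_eq s t ->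
  pderiv s f = pderiv t f.
Proof.
move=> Hf sk; elim: s t sk => [|i s IH] t sk.
  by rewrite perm_sym => /perm_nilP ->.
move=> st; have it : i \in t by rewrite -(perm_mem st) mem_head.
case/splitPr: it st sk => t1 t2; rewrite perm_sym perm_catC /= perm_cons perm_catC perm_sym.
move=> st sk /=; rewrite (IH _ (ltnW sk) st).
have szt : ((size t1 + size t2).+1 <= k)%N by move: sk; rewrite (perm_size st) size_cat.
elim: t1 {st} szt => [//|a t1 IHt] /= szt; rewrite -(IHt (ltnW szt)).
apply/funext => x; apply: (@Ck_sym2 (pderiv (t1 ++ t2) f) i a x).
by apply: Ck_pderiv; apply: Ck_le Hf; rewrite size_cat addSn.
Qed.

End CkCalculus.

Section CkComp.
Context {R : realType} {p q : nat}.

(** Induction on k for all f at once: the chain rule writes a partial derivative of the composite as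
    a sum of products of D_j f composed with g and of partial derivatives of g, all of one order
    less. *)
Lemma Ck_comp k (f : 'rV[R]_p -> R) (g : 'rV[R]_q -> 'rV[R]_p) :
  Ck k f -> (forall j, Ck k (fun x => g x 0 j)) -> Ck k (f \o g).
Proof.
elim: k f => [|k IH] f.
  move=> /Ck0P cf Hg; apply/Ck0P => x; apply: continuous_comp; last exact: cf.
  by apply: cont_rV => j; have /Ck0P := Hg j; apply.
move=> Hf Hg.
have Hg1 : forall j, Ck 1 (fun x => g x 0 j) by move=> j; apply: Ck_le (Hg j).
have D x : differentiable (f \o g) x /\
    forall i, 'd (f \o g) x (delta_mx 0 i) =
      \sum_j 'D_(delta_mx 0 j) f (g x) * 'D_(delta_mx 0 i) (fun x => g x 0 j) x.
  have [df Ef] := Ck_diff (g x) (Ck_le (ltn0Sn _) Hf).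
  have [|dg Eg] := @diff_rV _ _ _ g x; first by move=> j; have [] := Ck_diff x (Hg1 j).
  split; first exact: differentiable_comp.
  move=> i; rewrite diff_comp //= Eg Ef /lincomb; apply: eq_bigr => j _.
  rewrite mxE mulrC; congr (_ * _).
  by rewrite -deriveE //; have [] := Ck_diff x (Hg1 j).
have /CkSP[cf df Df] := Hf.
apply/CkSP; split=> [x|i x|i].
- by apply: differentiable_continuous; have [] := D x.
- by apply: diff_derivable; have [] := D x.
- rewrite (_ : 'D_(delta_mx 0 i) (f \o g) = \sum_j ('D_(delta_mx 0 j) f \o g) *
     'D_(delta_mx 0 i) (fun x => g x 0 j)).
    apply: Ck_sum => j _; apply: CkM; last by have /CkSP[_ _] := Hg j; apply.
    by apply: IH => // j'; apply: Ck_le (Hg j').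
  by apply/funext => x; have [d E] := D x; rewrite deriveE // E fct_sumE.
Qed.

End CkComp.

Section CkInv.
Context {R : realType} {n : nat}.

Lemma Ck_inv k (f : 'rV[R]_n -> R) : (forall x, f x != 0) -> Ck k f ->
  Ck k (fun x => (f x)^-1).
Proof.
move=> f0; elim: k => [|k IH].
  by move=> /Ck0P cf; apply/Ck0P => x; apply: continuousV => //; exact: cf.
move=> Hf; have /CkSP[cf df Df] := Hf.
apply/CkSP; split=> [x|i x|i]; first by apply: continuousV => //; exact: cf.
  exact: derivableV.
have Hk := IH (Ck_le (leqnSn _) Hf).
rewrite (_ : 'D_(delta_mx 0 i) _ = - ((fun x => (f x)^-1) * (fun x => (f x)^-1) * 'D_(delta_mx 0 i) f)).
  by apply: CkN; apply: CkM; [exact: CkM|exact: Df].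
by apply/funext => x; rewrite deriveV // !fctE scaleNr expr2 invfM.
Qed.

End CkInv.

Local Opaque Ck derive diff.

(** * The inverse function theorem *)

Section ContinuousMaps.
Context {R : realType} {V : normedModType R}.

Lemma cont_normr (W : normedModType R) (f : V -> W) x :
  {for x, continuous f} -> {for x, continuous (fun y => `|f y|)}.
Proof.
move=> /cont_epsP cf; apply/cont_epsP => e /cf[d d0 Hd]; exists d => // h /Hd.
by apply: le_trans; exact: ler_dist_dist.
Qed.

Lemma mulmx_bound n m (A : 'M[R]_(n, m)) : exists2 K : R, 0 < K &
  forall u : 'rV[R]_n, `|u *m A| <= K * `|u|.
Proof.
exact: (linear_lipschitz (@rV_linear_continuous _ _ _ (mulmxr A))).
Qed.

Lemma cont_mulmx m n (A : 'M[R]_(m, n)) (f : V -> 'rV[R]_m) x :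
  {for x, continuous f} -> {for x, continuous (fun y => f y *m A)}.
Proof.
move=> /cont_epsP cf; have [K K0 HK] := mulmx_bound A; apply/cont_epsP => e e0.
have [d d0 Hd] := cf (e / K) (divr_gt0 e0 K0); exists d => // h hd.
by rewrite -mulmxBl; apply: le_trans (HK _) _; rewrite mulrC -ler_pdivlMr //; exact: Hd.
Qed.

Lemma cont_subl (W : normedModType R) (f : V -> W) a x :
  {for x, continuous f} -> {for x, continuous (fun y => a - f y)}.
Proof. by move=> cf; apply: continuousB => //; exact: cst_continuous. Qed.

Lemma cont_subr (W : normedModType R) (f : V -> W) a x :
  {for x, continuous f} -> {for x, continuous (fun y => f y - a)}.
Proof. by move=> cf; apply: continuousB => //; exact: cst_continuous. Qed.

End ContinuousMaps.

Section LocalLipschitz.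
Context {R : realType} {n : nat}.
Notation e_ i := (delta_mx 0 i : 'rV[R]_n).

Lemma convex_ball_norm (p x y : 'rV[R]_n) (r t : R) : 0 <= t <= 1 ->
  `|x - p| <= r -> `|y - p| <= r -> `|x + t *: (y - x) - p| <= r.
Proof.
move=> /andP[t0 t1] xr yr.
have -> : x + t *: (y - x) - p = (1 - t) *: (x - p) + t *: (y - p).
  by apply/rowP => j; rewrite !mxE; ring.
apply: le_trans (ler_normD _ _) _; rewrite !normrZ !ger0_norm ?subr_ge0 //.
have -> : r = (1 - t) * r + t * r by ring.
by apply: lerD; rewrite ler_wpM2l ?subr_ge0.
Qed.

(** The factor n is due to the sup norm: the differential is a sum of n terms, each bounded by c
    times the norm. *)
Lemma Ck1_lipschitz_ball (f : 'rV[R]_n -> R) p (r c : R) : Ck 1 f -> 0 <= c ->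
  (forall i x, `|x - p| <= r -> `|'D_(e_ i) f x| <= c) ->
  forall x y, `|x - p| <= r -> `|y - p| <= r -> `|f y - f x| <= n%:R * c * `|y - x|.
Proof.
move=> Hf c0 Hc x y xr yr.
have df z : differentiable f z by have [] := Ck_diff z Hf.
have [t /andP[t0 t1]] := @MVT_line _ _ f x (y - x) (fun z => diff_derivable (df z)).
rewrite [x + (y - x)]addrC subrK => ->.
rewrite deriveE //; have [_ ->] := Ck_diff (x + t *: (y - x)) Hf.
apply: le_trans (ler_norm_sum _ _ _) _.
have zr : `|x + t *: (y - x) - p| <= r by apply: convex_ball_norm => //; rewrite !ltW.
apply: (@le_trans _ _ (\sum_(i < n) `|y - x| * c)).
  by apply: ler_sum => i _; rewrite normrM; apply: ler_pM => //; [exact: norm_coord|exact: Hc].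
by rewrite sumr_const card_ord -[leLHS]mulr_natl -[leRHS]mulrA [c * _]mulrC.
Qed.

Lemma cont_dist (p : 'rV[R]_n) : continuous (fun x : 'rV[R]_n => `|x - p|).
Proof.
move=> x; apply: (@cont_normr R 'rV[R]_n 'rV[R]_n (fun x => x - p)).
apply: (@cont_subr R 'rV[R]_n 'rV[R]_n id p); exact: cvg_id.
Qed.

Lemma compact_closed_ball (p : 'rV[R]_n) (r : R) : compact [set x | `|x - p| <= r].
Proof.
apply: bounded_closed_compact.
  exists (`|p| + r); split; first exact: num_real.
  move=> M HM x /= xr; apply: le_trans (ltW HM).
  by rewrite -[x](subrK p) addrC; apply: le_trans (ler_normD _ _) _; rewrite lerD2l.
have -> : [set x : 'rV[R]_n | `|x - p| <= r] = (fun x => `|x - p|) @^-1` [set y | y <= r] by [].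
apply: closed_comp; last exact: closed_le.
by move=> x _; exact: cont_dist.
Qed.

Lemma cont_bounded_ball (f : 'rV[R]_n -> R) p (r : R) : continuous f ->
  exists2 c : R, 0 <= c & forall x, `|x - p| <= r -> `|f x| <= c.
Proof.
move=> cf; have [rn|r0] := ltP r 0.
  by exists 0 => // x xr; have := le_lt_trans xr rn; rewrite normr_lt0.
have [||c _ Hc] := @EVT_max_rV R n (fun x => `|f x|) [set x | `|x - p| <= r] _ (@compact_closed_ball p r).
- by exists p; rewrite /= subrr normr0.
- apply: continuous_subspaceT => x; apply: continuous_comp; first exact: cf.
  exact: norm_continuous.
- by exists `|f c| => // x xr; apply: Hc; rewrite inE.
Qed.

Lemma Ck1_locally_lipschitz (f : 'rV[R]_n -> R) p (r : R) : Ck 1 f ->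
  exists2 c : R, 0 <= c &
    forall x y, `|x - p| <= r -> `|y - p| <= r -> `|f y - f x| <= c * `|y - x|.
Proof.
move=> Hf.
have cD i : exists c : R, 0 <= c /\ forall x, `|x - p| <= r -> `|'D_(e_ i) f x| <= c.
  have /CkSP[_ _ D] := Hf; have /Ck0P cD := D i.
  by have [c c0 Hc] := cont_bounded_ball p r cD; exists c.
have [c Hc] := choice cD.
exists (n%:R * \sum_i c i).
  by rewrite mulr_ge0 // sumr_ge0 // => i _; have [] := Hc i.
apply: Ck1_lipschitz_ball => //; first by apply: sumr_ge0 => i _; have [] := Hc i.
move=> i x xr; have [_ /(_ x xr)] := Hc i; move/le_trans; apply.
by rewrite (bigD1 i) //= lerDl sumr_ge0 // => j _; have [] := Hc j.
Qed.

End LocalLipschitz.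

Section InverseFunction.
Context {R : realType} {n : nat}.
Notation e_ i := (delta_mx 0 i : 'rV[R]_n).
Variables (Psi : 'rV[R]_n -> 'rV[R]_n).
Hypothesis Psi1 : forall j, Ck 1 (fun x => Psi x 0 j).

Definition jac x : 'M[R]_n := \matrix_(i, j) 'D_(e_ i) (fun x => Psi x 0 j) x.

Lemma diff_jac x : differentiable Psi x /\ forall v, 'd Psi x v = v *m jac x.
Proof.
have [|d E] := @diff_rV _ _ _ Psi x; first by move=> j; have [] := Ck_diff x (Psi1 j).
split=> // v; rewrite E; apply/rowP => j; rewrite !mxE.
have [_ ->] := Ck_diff x (Psi1 j); apply: eq_bigr => i _; by rewrite mxE.
Qed.

Lemma cont_jac_mul m (A : 'M[R]_(n, m)) (u : 'rV[R]_n) : continuous (fun x => u *m jac x *m A).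
Proof.
move=> x; apply: cont_rV => j.
have -> : (fun y => (u *m jac y *m A) 0 j) =
    (fun y => \sum_k \sum_i u 0 i * A k j * 'D_(e_ i) (fun x => Psi x 0 k) y).
  apply/funext => y; rewrite mxE; apply: eq_bigr => k _; rewrite mxE mulr_suml.
  by apply: eq_bigr => i _; rewrite mxE mulrAC.
have H : Ck 0 (fun y => \sum_k \sum_i u 0 i * A k j * 'D_(e_ i) (fun x => Psi x 0 k) y).
  apply: Ck_sumf => k _; apply: Ck_sumf => i _; apply: (@CkZ _ _ 0 (u 0 i * A k j)).
  by have /CkSP[_ _] := Psi1 k; apply.
exact: (Ck_cont H).
Qed.

Variable p : 'rV[R]_n.
Hypothesis Jp : jac p \in unitmx.
Let A := invmx (jac p).

(** The map h(x) = x - Psi(x) A has zero differential at p. On a small ball its partial derivatives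
    are at most c = 1 / (2 (n + 1)), which makes it, and its differential, contract by 1/2. *)
Lemma contraction_radius : exists2 r : R, 0 < r &
  (forall x y, `|x - p| <= r -> `|y - p| <= r ->
    `|(y - x) - (Psi y - Psi x) *m A| <= 2^-1 * `|y - x|) /\
  (forall x (u : 'rV[R]_n), `|x - p| <= r -> `|u - u *m jac x *m A| <= 2^-1 * `|u|).
Proof.
pose c := (2 * n.+1%:R)^-1 : R.
have c0 : 0 < c by rewrite invr_gt0 mulr_gt0.
have nc : n%:R * c <= 2^-1.
  by rewrite /c invfM mulrCA ler_piMr // ler_pdivrMr ?ltr0n // mul1r ler_nat.
pose h x := x - Psi x *m A.
have hE j : (fun x => h x 0 j) =
    (fun x : 'rV[R]_n => x 0 j) - \sum_k (A k j *: (fun x : 'rV[R]_n => Psi x 0 k)).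
  apply/funext => x; rewrite !mxE !fctE fct_sumE; congr (_ - _).
  by apply: eq_bigr => k _; rewrite mulrC.
have h1 j : Ck 1 (fun x => h x 0 j).
  rewrite hE; apply: CkB; first exact: Ck_coord.
  by apply: Ck_sum => k _; apply: CkZ; exact: Psi1.
have Dh x i j : 'D_(e_ i) (fun x => h x 0 j) x = (e_ i - e_ i *m jac x *m A) 0 j.
  have dP k : derivable (fun x : 'rV[R]_n => Psi x 0 k) x (e_ i).
    by have /CkSP[_ d _] := Psi1 k; exact: d.
  have [dc cE] := derive_coord i j x.
  rewrite hE deriveB //; last by apply: derivable_sum => k; exact: derivableZ.
  rewrite cE derive_sum; last by move=> k; exact: derivableZ.
  rewrite !mxE eqxx /= eq_sym; congr (_ - _); apply: eq_bigr => k _.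
  by rewrite deriveZ // -rowE !mxE mulrC.
have [|ij d d' Hd d'0 d'd x xr|r r0 Hr] := @common_radius R ('I_n * 'I_n)%type
  (fun ij d => forall x, `|x - p| <= d -> `|'D_(e_ ij.1) (fun x => h x 0 ij.2) x| <= c).
- move=> [i j] /=; have /CkSP[_ _ /(_ i)/Ck0P/(_ p)/cont_epsP'/(_ c c0)[d d0 Hd]] := h1 j.
  exists (d / 2) => [|x xd]; first by rewrite divr_gt0.
  have := Hd x.
  have -> : 'D_(e_ i) (fun x => h x 0 j) p = 0 by rewrite Dh mulmxK // subrr mxE.
  rewrite subr0; apply.
  by apply: le_lt_trans xd _; rewrite ltr_pdivrMr // ltr_pMr // ltr1n.
- by apply: Hd; exact: le_trans d'd.
exists r => //; split=> [x y xr yr|x u xr].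
  have -> : y - x - (Psi y - Psi x) *m A = h y - h x.
    by rewrite mulmxBl /h; apply/rowP => k; rewrite !mxE; ring.
  apply: norm_rV_le => [|j]; first by rewrite mulr_ge0.
  have -> : (h y - h x) 0 j = h y 0 j - h x 0 j by rewrite !mxE.
  apply: le_trans (Ck1_lipschitz_ball (h1 j) (ltW c0) _ xr yr) _.
    by move=> i z zr; exact: (Hr (i, j)).
  by rewrite ler_wpM2r.
apply: norm_rV_le => [|j]; first by rewrite mulr_ge0.
have -> : (u - u *m jac x *m A) 0 j = \sum_i u 0 i * 'D_(e_ i) (fun x => h x 0 j) x.
  rewrite {1 2}[u]row_sum_basis !mulmx_suml -sumrB summxE; apply: eq_bigr => i _.
  by rewrite Dh -!scalemxAl -scalerBr mxE.
apply: le_trans (ler_norm_sum _ _ _) _.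
apply: (@le_trans _ _ (\sum_(i < n) `|u| * c)).
  apply: ler_sum => i _; rewrite normrM; apply: ler_pM => //; first exact: norm_coord.
  exact: (Hr (i, j)).
by rewrite sumr_const card_ord -[leLHS]mulr_natl mulrCA mulrC ler_wpM2r.
Qed.

(** Surjectivity comes from compactness instead of a fixed point: the residual |(y - Psi x) A|
    attains its minimum on the closed ball, and a Newton step would halve it. Injectivity, the
    Lipschitz bound of the inverse and the invertibility of nearby Jacobians all follow from the
    contraction estimate. *)
Theorem inverse_function : exists (U W : set 'rV[R]_n) (g : 'rV[R]_n -> 'rV[R]_n),
  [/\ open U /\ U p, open W, forall x, U x -> W (Psi x) /\ g (Psi x) = x,
      forall y, W y -> U (g y) /\ Psi (g y) = y & C1_on W g].
Proof.
have [r r0 [Hh HJ]] := contraction_radius.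
have cPsi x : {for x, continuous Psi}.
  by apply: differentiable_continuous; have [] := diff_jac x.
have [K K0 HK] := mulmx_bound A.
pose N y := `|(y - Psi p) *m A|.
have cN : continuous N.
  move=> y; apply: (@cont_normr R 'rV[R]_n 'rV[R]_n (fun y => (y - Psi p) *m A)).
  apply: (@cont_mulmx R 'rV[R]_n n n A (fun y => y - Psi p)).
  apply: (@cont_subr R 'rV[R]_n 'rV[R]_n id (Psi p)); exact: cvg_id.
(* With this bound a Newton step towards y sends the closed ball of radius r into the open one. *)
pose W := [set y | N y < r / 2].
pose U := [set x | `|x - p| < r] `&` (Psi @^-1` W).
have oW : open W.
  have -> : W = N @^-1` [set t | t < r / 2] by [].
  by apply: open_comp => [y _|]; [exact: cN|exact: open_lt].
have oU : open U.
  apply: openI; last by apply: open_comp => // x _; exact: cPsi.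
  have -> : [set x | `|x - p| < r] = (fun x => `|x - p|) @^-1` [set t | t < r] by [].
  apply: open_comp => [x _|]; last exact: open_lt.
  exact: cont_dist.
have Up : U p by split; rewrite /= /W /= /N ?subrr ?normr0 ?mul0mx ?normr0 ?divr_gt0.
have inj2 x y : `|x - p| <= r -> `|y - p| <= r -> `|y - x| <= 2 * `|(Psi y - Psi x) *m A|.
  move=> xr yr; have := Hh x y xr yr.
  set a := y - x; set b := _ *m A => H.
  have : `|a| <= `|a - b| + `|b| by have := ler_normD (a - b) b; rewrite subrK.
  by move: H; lra.
have surj y : W y -> exists x, U x /\ Psi x = y.
  rewrite /W /= => Wy.
  pose D := [set x | `|x - p| <= r].
  have [||x Dx Hx] := @EVT_min_rV R n (fun x => `|(y - Psi x) *m A|) D _ (@compact_closed_ball _ _ p r).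
  - by exists p; rewrite /D /= subrr normr0 ltW.
  - apply: continuous_subspaceT => x.
    apply: (@cont_normr R 'rV[R]_n 'rV[R]_n (fun x => (y - Psi x) *m A)).
    apply: (@cont_mulmx R 'rV[R]_n n n A (fun x => y - Psi x)).
    by apply: (@cont_subl R 'rV[R]_n 'rV[R]_n Psi y); exact: cPsi.
  rewrite inE /D /= in Dx.
  (* The Newton step with frozen Jacobian. It stays in the ball and at least halves the residual, so
     the minimal residual is 0. *)
  pose T x := x + (y - Psi x) *m A.
  have TD z : `|z - p| <= r -> `|T z - p| < r.
    move=> zr; have -> : T z - p = ((z - p) - (Psi z - Psi p) *m A) + (y - Psi p) *m A.
      by rewrite /T !mulmxBl; apply/rowP => j; rewrite !mxE; ring.
    apply: le_lt_trans (ler_normD _ _) _.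
    have pp : `|p - p| <= r by rewrite subrr normr0 ltW.
    have := Hh p z pp zr; have := Wy; rewrite /N; move: zr; lra.
  have E : (y - Psi x) *m A = 0.
    apply/eqP; rewrite -normr_eq0; apply/eqP.
    have Tx := TD x Dx.
    have /Hx : T x \in D by rewrite inE /D /= ltW.
    have := Hh x (T x) Dx (ltW Tx).
    have -> : T x - x = (y - Psi x) *m A by rewrite /T addrC addKr.
    have -> : (y - Psi x) *m A - (Psi (T x) - Psi x) *m A = (y - Psi (T x)) *m A.
      by rewrite -mulmxBl opprB addrA subrK.
    move: (normr_ge0 ((y - Psi x) *m A)).
    by set a := `|(y - Psi x) *m A|; set b := `|_ *m A|; lra.
  have Ey : Psi x = y.
    apply/esym/eqP; rewrite -subr_eq0; apply/eqP.
    by rewrite -[LHS](mulmxKV Jp) E mul0mx.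
  exists x; split=> //; split; last by rewrite /= Ey.
  have := TD x Dx; rewrite /T Ey subrr mul0mx addr0 //.
have [g Hg] : exists g, forall y, W y -> U (g y) /\ Psi (g y) = y.
  have [|g Hg] := @choice _ _ (fun y x => W y -> U x /\ Psi x = y); last by exists g.
  move=> y; have [/surj[x Hx]|nWy] := pselect (W y); first by exists x.
  by exists 0 => /nWy.
exists U, W, g; split=> //.
  move=> x Ux; have Wx : W (Psi x) by case: Ux.
  split=> //; have [[gr _] E] := Hg _ Wx; have [xr _] := Ux.
  apply/eqP; rewrite -subr_eq0 -normr_le0.
  have := inj2 x (g (Psi x)) (ltW xr) (ltW gr).
  by rewrite E subrr mul0mx normr0 mulr0.
have gr y : W y -> `|g y - p| <= r by move=> /Hg[[/ltW]].
have glip y y' : W y -> W y' -> `|g y' - g y| <= 2 * K * `|y' - y|.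
  move=> Wy Wy'; apply: le_trans (inj2 _ _ (gr _ Wy) (gr _ Wy')) _.
  by rewrite (Hg _ Wy).2 (Hg _ Wy').2 -mulrA ler_wpM2l.
have Jlow x (u : 'rV[R]_n) : `|x - p| <= r -> `|u| <= 2 * `|u *m jac x *m A|.
  move=> xr; have := HJ x u xr; set b := _ *m A => H.
  have : `|u| <= `|u - b| + `|b| by have := ler_normD (u - b) b; rewrite subrK.
  by move: H; lra.
have Junit x : `|x - p| <= r -> jac x \in unitmx.
  move=> xr; rewrite -row_free_unit -kermx_eq0.
  apply/rowV0P => u /sub_kermxP E; apply/eqP; rewrite -normr_le0.
  by have := Jlow x u xr; rewrite E mul0mx normr0 mulr0.
have Wnear y : W y -> exists2 d : R, 0 < d & forall k, `|k| < d -> W (y + k).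
  move=> Wy; have /nbhs_normP[d /= d0 Hd] : nbhs y W by apply: open_nbhs_nbhs.
  exists d => // k kd; apply: Hd.
  by rewrite /ball_/= opprD addrA subrr sub0r normrN.
have dg y : W y -> differentiable g y /\ forall v, 'd g y v = v *m invmx (jac (g y)).
  move=> Wy; set x := g y; have xr := gr _ Wy; have Jx := Junit _ xr.
  have [KB KB0 HKB] := mulmx_bound (invmx (jac x)).
  have [|e e0|dgy E] := @diff_epsP _ _ _ g (mulmxr (invmx (jac x))) y.
  - exact: rV_linear_continuous.
  - have e'0 : 0 < e / (KB * (2 * K)) by rewrite divr_gt0 // !mulr_gt0.
    have [d d0 Hd] := diff_eps (diff_jac x).1 e'0.
    have [d1 d10 Hd1] := Wnear y Wy.
    exists (Num.min d1 (d / (2 * K))); first by rewrite lt_min d10 divr_gt0 // mulr_gt0.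
    move=> k; rewrite lt_min => /andP[/Hd1 Wk kd].
    set eta := g (y + k) - x.
    have etale : `|eta| <= 2 * K * `|k|.
      by have := glip _ _ Wy Wk; rewrite [y + k - y]addrAC subrr add0r.
    have etad : `|eta| < d.
      by apply: le_lt_trans etale _; rewrite mulrC -ltr_pdivlMr // mulr_gt0.
    have := Hd eta etad; rewrite (diff_jac x).2 /eta addrCA subrr addr0 -/eta.
    rewrite (Hg _ Wk).2 (Hg _ Wy).2 [y + k - y]addrAC subrr add0r => H.
    rewrite -/eta /=.
    have -> : eta - k *m invmx (jac x) = - ((k - eta *m jac x) *m invmx (jac x)).
      by rewrite mulmxBl mulmxK // opprB.
    rewrite normrN; apply: le_trans (HKB _) _.
    apply: (@le_trans _ _ (KB * (e / (KB * (2 * K)) * (2 * K * `|k|)))).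
      by rewrite ler_wpM2l // ?(ltW KB0) //; apply: le_trans H _; rewrite ler_wpM2l // ltW.
    rewrite le_eqVlt; apply/orP; left; apply/eqP; field.
    by rewrite !gt_eqF.
  - by split=> // v; rewrite E.
move=> y Wy; split=> [|v]; first by have [] := dg y Wy.
apply/cont_epsP => e e0.
set u0 := v *m invmx (jac (g y)).
have e20 : 0 < e / 2 by rewrite divr_gt0.
have /cont_epsP/(_ _ e20)[d d0 Hd] := @cont_jac_mul _ A u0 (g y).
have [d1 d10 Hd1] := Wnear y Wy.
exists (Num.min d1 (d / (2 * K))); first by rewrite lt_min d10 divr_gt0 // mulr_gt0.
move=> k; rewrite lt_min => /andP[/Hd1 Wk kd].
have E1 := (dg _ Wy).2 v; have E2 := (dg _ Wk).2 v.
rewrite [X in `|X - _|]E2 [X in `|_ - X|]E1 -/u0 {E1 E2}.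
have etale : `|g (y + k) - g y| < d.
  apply: le_lt_trans (glip _ _ Wy Wk) _.
  by rewrite [y + k - y]addrAC subrr add0r mulrC -ltr_pdivlMr // mulr_gt0.
(* Applying the Jacobian at the displaced point to the difference of the two solutions leaves [u0]
   times a difference of Jacobians, so continuity of matrix inversion is not called upon. *)
apply: le_trans (Jlow _ _ (gr _ Wk)) _.
rewrite -ler_pdivlMl // mulrC; have := Hd _ etale.
rewrite [g y + _]addrCA subrr addr0 => /(le_trans _); apply.
have E3 : u0 *m jac (g y) = v by rewrite /u0 mulmxKV // Junit // gr.
have E4 : v *m invmx (jac (g (y + k))) *m jac (g (y + k)) = v.
  by rewrite mulmxKV // Junit // gr.
rewrite E3 !mulmxBl E4 [leRHS]distrC; exact: lexx.
Qed.

End InverseFunction.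

(** * Overdetermined systems avoid zero generically *)

Section GridAvoidance.
Context {R : realType}.

(** With q = (D + 1)^k + 1 one has (D q + 1)^k <= (D + 1)^k q^k < q^(k+1) <= q^m. *)
Lemma grid_cell_count (k m D : nat) : (k < m)%N ->
  exists2 q : nat, (0 < q)%N & ((D * q).+1 ^ k < q ^ m)%N.
Proof.
move=> km; pose q := ((D.+1) ^ k).+1; exists q => //.
have q1 : (0 < q)%N by [].
apply: (@leq_ltn_trans ((D.+1 * q) ^ k)).
  case: (posnP k) => [->|k0]; first by rewrite !expn0.
  by rewrite leq_exp2r // mulSn -add1n leq_add2r.
rewrite expnMn; apply: (@leq_trans (q ^ k.+1)); last by rewrite leq_pexp2l.
by rewrite expnS ltn_mul2r expn_gt0 q1 /= /q.
Qed.

(* Two parameters of a grid of step [beta / q] whose bad points share a cell of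
   size [eta] contradict [H]; such a pair exists because [m > k]. *)
Lemma grid_avoidance (k m : nat) (c beta r : R) : (k < m)%N ->
  0 <= c -> 0 < beta -> 0 < r ->
  exists2 eta : R, 0 < eta & exists2 eps : R, 0 < eps &
  forall (y0 : 'rV[R]_k) (G : 'rV[R]_m -> 'rV[R]_k -> 'rV[R]_m),
  (forall th th' y y', `|th| <= beta -> `|th'| <= beta ->
     `|y - y0| <= r -> `|y' - y0| <= r -> `|y' - y| <= eta ->
     2^-1 * `|th' - th| <= `|G th' y' - G th y| + c * eta) ->
  exists2 th, `|th| <= beta & forall y, `|y - y0| <= r -> eps <= `|G th y|.
Proof.
move=> km c0 b0 r0.
(* For cells of size eta = 2 r / (D q), the error c eta is then at most an eighth of the parameter
   step beta / q. *)
have [D D0 HD] : exists2 D : nat, (0 < D)%N & c * (2 * r / D%:R) <= beta / 8.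
  exists (Num.truncn (16 * c * r / beta)).+1 => //.
  have := truncnS_gt (16 * c * r / beta).
  set d := _.+1%:R; have d0 : 0 < d by rewrite ltr0n.
  rewrite ltr_pdivrMr // => H.
  rewrite mulrA ler_pdivrMr // ; lra.
have [q q0 Hq] := grid_cell_count D km.
have qR : 0 < q%:R :> R by rewrite ltr0n.
pose Q := (D * q)%N.
have QR : 0 < Q%:R :> R by rewrite ltr0n muln_gt0 D0.
pose eta := 2 * r / Q%:R.
have eta0 : 0 < eta by rewrite divr_gt0 // mulr_gt0.
have ceta : c * eta <= beta / (8 * q%:R).
  have -> : c * eta = c * (2 * r / D%:R) / q%:R.
    by rewrite /eta /Q natrM invfM; ring.
  by rewrite invfM [leRHS]mulrA ler_pM2r // invr_gt0.
(* For two distinct parameters whose near-zeros share a cell, half their distance is at least beta /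
   (2 q), whereas the right side of the hypothesis stays below 2 beta / (16 q) + beta / (8 q) = beta
   / (4 q). *)
exists eta => //; exists (beta / (16 * q%:R)); first by rewrite divr_gt0 // mulr_gt0.
move=> y0 G H; apply: contrapT => nH.
pose th (g : {ffun 'I_m -> 'I_q}) : 'rV[R]_m := \row_j (beta / q%:R * (g j)%:R).
have thb g : `|th g| <= beta.
  apply: norm_rV_le (ltW b0) _ => j; rewrite mxE ger0_norm; last first.
    by rewrite mulr_ge0 // ltW // divr_gt0.
  by rewrite mulrAC ler_pdivrMr // ler_wpM2l ?(ltW b0) // ler_nat ltnW.
have [|y Hy] := @choice {ffun 'I_m -> 'I_q} 'rV[R]_k
    (fun g y => `|y - y0| <= r /\ `|G (th g) y| < beta / (16 * q%:R)).
  move=> g; apply: contrapT => ng; apply: nH; exists (th g) => // y yr.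
  by rewrite leNgt; apply/negP => lt; apply: ng; exists y.
(* The quotient lies between 0 and [Q], whence Q + 1 cells per coordinate and no truncation by
   [inord]. *)
pose cell g : {ffun 'I_k -> 'I_Q.+1} := [ffun j => inord (Num.truncn ((y g 0 j - y0 0 j + r) / eta))].
have [g [g' [gg' cgg']]] : exists g g', g != g' /\ cell g = cell g'.
  apply: contrapT => ninj.
  have inj : injective cell.
    move=> g g' E; apply: contrapT => /eqP ne; apply: ninj; by exists g, g'.
  have := leq_card cell inj; rewrite !card_ffun !card_ord leqNgt.
  by rewrite Hq.
have yd : `|y g' - y g| <= eta.
  apply: norm_rV_le (ltW eta0) _ => j.
  have bnd h : 0 <= (y h 0 j - y0 0 j + r) / eta <= Q%:R.
    have [yr _] := Hy h; have := le_trans (norm_coord (y h - y0) j) yr.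
    rewrite !mxE ler_norml => /andP[A1 A2]; apply/andP; split.
      by rewrite divr_ge0 ?(ltW eta0) //; lra.
    rewrite ler_pdivrMr // /eta mulrCA divff ?gt_eqF // mulr1; lra.
  have Ec h : ((cell h) j)%:R <= (y h 0 j - y0 0 j + r) / eta < ((cell h) j)%:R + 1.
    have /andP[b1 b2] := bnd h.
    rewrite /cell ffunE inordK; last first.
      by rewrite ltnS -(ler_nat R); apply: le_trans b2; rewrite truncn_le.
    by rewrite natr1; apply: truncn_itv.
  have /andP[E1 E2] := Ec g; have /andP[E1' E2'] := Ec g'.
  rewrite cgg' in E1 E2; rewrite !mxE.
  have -> : y g' 0 j - y g 0 j =
    eta * ((y g' 0 j - y0 0 j + r) / eta - (y g 0 j - y0 0 j + r) / eta).
    by field; rewrite gt_eqF.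
  rewrite normrM (gtr0_norm eta0) -[leRHS]mulr1 ler_wpM2l ?(ltW eta0) //.
  by rewrite ler_norml; apply/andP; split; lra.
have [yr Gy] := Hy g; have [yr' Gy'] := Hy g'.
have thd : beta / q%:R <= `|th g' - th g|.
  have [j gj] : exists j, g j != g' j.
    apply: contrapT => E; move/eqP: gg'; apply; apply/ffunP => j.
    by apply/eqP; apply: contrapT => /negP ne; apply: E; exists j.
  apply: le_trans (norm_coord _ j); rewrite !mxE -mulrBr normrM.
  rewrite gtr0_norm ?divr_gt0 // -[leLHS]mulr1 ler_wpM2l // ?(ltW (divr_gt0 _ _)) //.
  have : (g j < g' j)%N || (g' j < g j)%N by rewrite -neq_ltn.
  move=> /orP[lt|lt].
    by rewrite -natrB ?(ltnW lt) // normr_nat ler1n subn_gt0.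
  by rewrite distrC -natrB ?(ltnW lt) // normr_nat ler1n subn_gt0.
have := H _ _ _ _ (thb g) (thb g') yr yr' yd.
have := ler_normB (G (th g') (y g')) (G (th g) (y g)).
have : 0 < beta / q%:R by rewrite divr_gt0.
have w8 (a : R) : beta / (a * q%:R) = beta / q%:R / a by rewrite invfM; ring.
move: Gy Gy' ceta thd; rewrite !w8.
set a := `|G (th g) _|; set b := `|G (th g') _|; set d := `|th g' - _|; set e := `|_ - _|.
set u := c * eta; set w := beta / q%:R.
lra.
Qed.

End GridAvoidance.

Section SpanLemma.
Context {R : realType} {m : nat}.

(** P is only a predicate, so a matrix of maximal rank with rows in P stands in for a basis.
    Maximality puts P into its row space; if that were proper, a nonzero vector orthogonal to the
    rows would annihilate P. *)
Lemma subspace_full (P : 'rV[R]_m -> Prop) :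
  (forall u v a, P u -> P v -> P (u + a *: v)) -> P 0 ->
  (forall mu : 'rV[R]_m, (forall u, P u -> dotv mu u = 0) -> mu = 0) ->
  forall u, P u.
Proof.
move=> PD P0 Pann.
have Psum (I : Type) (s : seq I) (Q : pred I) (a : I -> R) (F : I -> 'rV[R]_m) :
    (forall i, P (F i)) -> P (\sum_(i <- s | Q i) a i *: F i).
  move=> H; elim/big_rec : _ => // i x _ Px; rewrite addrC; exact: PD.
pose good r := `[< exists A : 'M[R]_m, (forall i, P (row i A)) /\ \rank A = r >].
have g0 : exists r, good r.
  by exists 0%N; apply/asboolP; exists 0; rewrite mxrank0; split=> // i; rewrite row0.
have gm r : good r -> (r <= m)%N by move=> /asboolP[A [_ <-]]; exact: rank_leq_row.
case: (ex_maxnP g0 gm) => r /asboolP[A [PA rA]] rmax.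
have full u : P u -> (u <= A)%MS.
  move=> Pu; apply: contrapT => /negP nu.
  have lt : (r < \rank (A + u)%MS)%N.
    rewrite -rA ltn_neqAle mxrankS ?addsmxSl // andbT.
    apply/negP => /eqP E; move/negP: nu; apply.
    have : (A + u <= A)%MS.
      by rewrite -(geq_leqif (mxrank_leqif_sup (addsmxSl A u))) E.
    by move/(submx_trans (addsmxSr A u)).
  suff /rmax : good (\rank (A + u)%MS) by rewrite leqNgt lt.
  apply/asboolP; exists (A + u)%MS; split=> // i.
  have /sub_addsmxP[[B C] /= E] : (row i (A + u)%MS <= A + u)%MS by exact: row_sub.
  rewrite E; rewrite mulmx_sum_row.
  have -> : C *m u = C 0 0 *: u.
    by rewrite [C]mx11_scalar mul_scalar_mx mxE eqxx.
  by apply: PD => //; exact: Psum.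
have rfull : row_full A.
  rewrite -[row_full A]negbK; apply/negP => nf.
  have /rowV0Pn[mu] : kermx A^T != 0.
    rewrite kermx_eq0; apply: contra nf => rf.
    by rewrite /row_full -mxrank_tr.
  move=> /sub_kermxP Amu mu0; move/eqP: mu0; apply; apply: Pann => u /full /submxP[D ->].
  rewrite /dotv.
  have -> : \sum_(i < m) mu 0 i * (D *m A) 0 i = (mu *m (D *m A)^T) 0 0.
    by rewrite mxE; apply: eq_bigr => i _; rewrite [(D *m A)^T _ _]mxE.
  by rewrite trmx_mul mulmxA Amu mul0mx mxE.
move=> u; have /submxP[D ->] := submx_full u rfull.
by rewrite mulmx_sum_row; exact: Psum.
Qed.

End SpanLemma.

Section Transport.
Context {R : realType} {V V' W : normedModType R}.
Local Transparent derive.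

(** A directional derivative only sees the restriction to a line. Functions on different spaces that
    agree along two lines share their difference quotients; translations and ridge functions are
    reduced to their profiles in this way. *)
Lemma derive_transport (f : V -> W) (f' : V' -> W) x v x' v' :
  (forall h : R, f (h *: v + x) = f' (h *: v' + x')) ->
  (derivable f x v -> derivable f' x' v') /\ 'D_v f x = 'D_v' f' x'.
Proof.
move=> H; have fx : f x = f' x' by have := H 0; rewrite !scale0r !add0r.
have E : (fun h : R => h^-1 *: ((f \o shift x) (h *: v) - f x)) =
   (fun h : R => h^-1 *: ((f' \o shift x') (h *: v') - f' x')).
  by apply/funext => h /=; rewrite H fx.
by rewrite /derivable /derive E.
Qed.

End Transport.

(** * Ridge functions, and local rules for iterated derivatives *)

Section Ridge.
Context {R : realType} {n : nat}.
Notation e_ i := (delta_mx 0 i : 'rV[R]_n).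

Lemma dotvE (u v : 'rV[R]_n) : dotv u v = (u *m v^T) 0 0.
Proof. by rewrite mxE; apply: eq_bigr => i _; rewrite mxE. Qed.

Lemma dotvC (u v : 'rV[R]_n) : dotv u v = dotv v u.
Proof. by apply: eq_bigr => i _; rewrite mulrC. Qed.

Lemma dotvDr (u v w : 'rV[R]_n) : dotv u (v + w) = dotv u v + dotv u w.
Proof. by rewrite -big_split; apply: eq_bigr => i _; rewrite mxE mulrDr. Qed.

Lemma dotvZr a (u v : 'rV[R]_n) : dotv u (a *: v) = a * dotv u v.
Proof. by rewrite [RHS]mulr_sumr; apply: eq_bigr => i _; rewrite mxE mulrCA. Qed.

Lemma dotvDl (u v w : 'rV[R]_n) : dotv (v + w) u = dotv v u + dotv w u.
Proof. by rewrite !(dotvC _ u) dotvDr. Qed.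

Lemma dotvZl a (u v : 'rV[R]_n) : dotv (a *: v) u = a * dotv v u.
Proof. by rewrite !(dotvC _ u) dotvZr. Qed.

Lemma dotv_delta (u : 'rV[R]_n) i : dotv u (e_ i) = u 0 i.
Proof.
rewrite /dotv (bigD1 i) //= big1 ?addr0 ?mxE ?eqxx ?mulr1 // => j /negbTE ji.
by rewrite mxE ji andbF mulr0.
Qed.

Definition ridge (kap : 'rV[R]_n) (c : R) (g : R -> R) (x : 'rV[R]_n) : R := g (dotv kap x + c).

Lemma derive_affine (a b t : R) : is_derive t 1 (cst a + b *: (id : R -> R)) b.
Proof.
have H := is_deriveD (is_derive_cst a t 1) (is_deriveZ b (is_derive_id t 1)).
by apply: is_derive_eq H _; rewrite add0r [_ *: _]mulr1.
Qed.

Lemma derive_ridge kap c (g g' : R -> R) i x : is_derive (dotv kap x + c) 1 g (g' (dotv kap x + c)) ->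
  is_derive x (e_ i) (ridge kap c g) (kap 0 i * g' (dotv kap x + c)).
Proof.
move=> dg; pose l t := dotv kap x + c + t * kap 0 i.
have E t : ridge kap c g (t *: e_ i + x) = g (l t).
  by rewrite /ridge /l dotvDr dotvZr dotv_delta [t * _ + _]addrC addrAC.
have dl (t : R) : is_derive t 1 l (kap 0 i).
  have -> : l = cst (dotv kap x + c) + kap 0 i *: (id : R -> R).
    by apply/funext => u; rewrite /l !fctE mulrC.
  exact: derive_affine.
have l0 : l 0 = dotv kap x + c by rewrite /l mul0r addr0.
have dgl : is_derive (0 : R) 1 (g \o l) (kap 0 i * g' (dotv kap x + c)).
  have d1 : derivable l 0 1 by have [] := dl 0.
  have d2 : derivable g (l 0) 1 by rewrite l0; have [] := dg.
  split; first exact/derivable1_diffP/differentiable_comp/derivable1_diffP/d2/derivable1_diffP/d1.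
  rewrite -derive1E derive1_comp // !derive1E l0.
  by rewrite (@derive_val _ _ _ _ _ _ _ dg) (@derive_val _ _ _ _ _ _ _ (dl 0)) mulrC.
have [D1 D2] := @derive_transport R R 'rV[R]_n R (g \o l) (ridge kap c g) 0 1 x (e_ i)
  (fun h => esym (etrans (E h) (congr1 (g \o l) (etrans (esym (mulr1 h)) (esym (addr0 _)))))).
have [d1 d2] := dgl; split; [exact: D1|by rewrite -D2].
Qed.

(** [E] lists the successive derivatives of the profile [E 0]. It is instantiated by sine waves and
    by a spline with only four continuous derivatives, hence the bound k. *)
Lemma pderiv_ridge (kap : 'rV[R]_n) (c : R) k (E : nat -> R -> R) :
  (forall p (t : R), (p < k)%N -> is_derive t 1 (E p) (E p.+1 t)) ->
  (forall p, (p <= k)%N -> continuous (E p)) ->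
  Ck k (ridge kap c (E 0%N)) /\ forall s, (size s <= k)%N ->
    pderiv s (ridge kap c (E 0%N)) = (\prod_(i <- s) kap 0 i) *: ridge kap c (E (size s)).
Proof.
move=> dE cE.
have cr p : (p <= k)%N -> continuous (ridge kap c (E p)).
  move=> pk x; apply: continuous_comp; last exact: cE.
  apply: (Ck_cont (k := 0)); apply: (@CkD _ _ _ (dotv kap) (cst c)); last exact: Ck_cst.
  apply: Ck_sumf => i _; apply: (@CkZ _ _ 0 (kap 0 i) (fun x : 'rV[R]_n => x 0 i)).
  exact: Ck_coord.
have dr p i x : (p < k)%N -> is_derive x (e_ i) (ridge kap c (E p)) (kap 0 i * ridge kap c (E p.+1) x).
  by move=> pk; apply: derive_ridge; exact: dE.
have H s : (size s <= k)%N ->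
    pderiv s (ridge kap c (E 0%N)) = (\prod_(i <- s) kap 0 i) *: ridge kap c (E (size s)).
  elim: s => [|i s IH] sk /=; first by rewrite big_nil scale1r.
  rewrite (IH (ltnW sk)); apply/funext => x; rewrite big_cons.
  have [d1 d2] := dr (size s) i x sk.
  transitivity (\prod_(i <- s) kap 0 i * (kap 0 i * ridge kap c (E (size s).+1) x)).
    by rewrite deriveZ // d2.
  by rewrite mulrA [_ * kap 0 i]mulrC.
split=> //; apply/CkP => s sk; rewrite H //; split=> [x|sk' i x].
  apply: continuousM; [exact: cst_continuous|exact: cr].
by apply: derivableZ; have [] := dr (size s) i x sk'.
Qed.

End Ridge.

Lemma nbhs_dist {R : realType} {V : normedModType R} (x : V) (d : R) : 0 < d ->
  nbhs x [set y | `|y - x| < d].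
Proof.
by move=> d0; apply/nbhs_normP; exists d => //= y; rewrite /ball_/= distrC.
Qed.

Section LocalPderiv.
Context {R : realType} {n : nat}.
Notation e_ i := (delta_mx 0 i : 'rV[R]_n).

Lemma pderiv_local (f g : 'rV[R]_n -> R) (U : set 'rV[R]_n) s : open U ->
  (forall x, U x -> f x = g x) -> forall x, U x -> pderiv s f x = pderiv s g x.
Proof.
move=> oU fg; elim: s => [|i s IH] x Ux /=; first exact: fg.
apply: near_eq_derive; have /= UU : nbhs x U by exact: open_nbhs_nbhs.
by apply: filterS UU => y Uy; exact: IH.
Qed.

Lemma pderiv_shift (f : 'rV[R]_n -> R) a s x :
  pderiv s (fun y => f (y + a)) x = pderiv s f (x + a).
Proof.
elim: s x => [//|i s IH] x /=.
have -> : pderiv s (fun y => f (y + a)) = (fun y => pderiv s f (y + a)) by apply/funext.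
by have [] := @derive_transport R _ _ R (fun y => pderiv s f (y + a)) (pderiv s f) x (e_ i)
  (x + a) (e_ i) (fun h => congr1 (pderiv s f) (esym (addrA _ _ _))).
Qed.

Lemma Ck_shift k (f : 'rV[R]_n -> R) a : Ck k f -> Ck k (fun y => f (y + a)).
Proof.
move=> Hf; apply: (@Ck_comp _ _ _ k f (fun y => y + a) Hf) => j.
have -> : (fun x : 'rV[R]_n => (x + a) 0 j) = (fun x : 'rV[R]_n => x 0 j) + cst (a 0 j).
  by apply/funext => x; rewrite !mxE.
by apply: CkD; [exact: Ck_coord|exact: Ck_cst].
Qed.

Lemma pderiv_sumZ k (I : Type) (r : seq I) (a : I -> R) (F : I -> 'rV[R]_n -> R) s :
  (forall i, Ck k (F i)) -> (size s <= k)%N ->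
  pderiv s (\sum_(i <- r) a i *: F i) = \sum_(i <- r) a i *: pderiv s (F i).
Proof.
move=> HF sk; elim: r => [|i r IH]; first by rewrite !big_nil pderiv0.
rewrite !big_cons (@pderivD _ _ k) // ?IH ?(@pderivZ _ _ k) //; first exact: CkZ.
by apply: Ck_sum => j _; exact: CkZ.
Qed.

(** Each derivative doubles the number of Leibniz terms, and each term is at most A B. *)
Lemma pderivM_bound (f g : 'rV[R]_n -> R) s (A B : R) x : Ck (size s) f -> Ck (size s) g ->
  0 <= A -> 0 <= B ->
  (forall t, (size t <= size s)%N -> `|pderiv t f x| <= A) ->
  (forall t, (size t <= size s)%N -> `|pderiv t g x| <= B) ->
  `|pderiv s (f * g) x| <= 2 ^+ size s * A * B.
Proof.
move=> + + A0 B0; elim/last_ind: s f g => [|s i IH] f g.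
  move=> _ _ /(_ [::] isT) fA /(_ [::] isT) gB /=.
  by rewrite expr0 mul1r fctE normrM ler_pM.
rewrite size_rcons => Hf Hg fA gB.
have /CkSP[cf df Df] := Hf; have /CkSP[cg dg Dg] := Hg.
have Hf' := Ck_le (leqnSn _) Hf; have Hg' := Ck_le (leqnSn _) Hg.
rewrite pderiv_rcons.
have -> : 'D_(e_ i) (f * g) = f * 'D_(e_ i) g + 'D_(e_ i) f * g.
  by apply/funext => y; rewrite deriveM //; congr (_ + _); exact: mulrC.
have HA := CkM Hf' (Dg i); have HB := CkM (Df i) Hg'.
rewrite (@pderivD R n (size s) _ _ s HA HB (leqnn _)) fctE.
apply: le_trans (ler_normD _ _) _.
rewrite exprS -!mulrA mulr_natl mulr2n mulrA; apply: lerD.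
- apply: (IH _ _ Hf' (Dg i)) => t ts; first by apply: fA; exact: leqW.
  by rewrite -pderiv_rcons; apply: gB; rewrite size_rcons.
- apply: (IH _ _ (Df i) Hg') => t ts; last by apply: gB; exact: leqW.
  by rewrite -pderiv_rcons; apply: fA; rewrite size_rcons.
Qed.

Lemma seq_radius k (P : seq 'I_n -> R -> Prop) :
  (forall s, (size s <= k)%N -> exists2 d : R, 0 < d & P s d) ->
  (forall s d d', P s d -> 0 < d' -> d' <= d -> P s d') ->
  exists2 d : R, 0 < d & forall s, (size s <= k)%N -> P s d.
Proof.
move=> ex mono.
have [|i d d' Hd d0 dd|d d0 Hd] := @common_radius R {m : 'I_k.+1 & m.-tuple 'I_n}
  (fun i d => P (tval (tagged i)) d).
- by move=> i; apply: ex; rewrite size_tuple -ltnS.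
- exact: mono Hd d0 dd.
exists d => // s sk.
have sk1 : (size s < k.+1)%N by [].
exact: (Hd (Tagged (fun m : 'I_k.+1 => m.-tuple 'I_n) (in_tuple s : (Ordinal sk1).-tuple 'I_n))).
Qed.

(** Bounds are turned into radii by taking reciprocals, after adding 1 to make them positive. *)
Lemma seq_bound k (P : seq 'I_n -> R -> Prop) :
  (forall s, (size s <= k)%N -> exists2 d : R, 0 <= d & P s d) ->
  (forall s d d', P s d -> d <= d' -> P s d') ->
  exists2 d : R, 0 <= d & forall s, (size s <= k)%N -> P s d.
Proof.
move=> ex mono.
have [s sk|s d d' Pd d'0 dd|d d0 Hd] := @seq_radius k (fun s d => P s d^-1).
- have [d d0 Pd] := ex s sk; exists (d + 1)^-1; first by rewrite invr_gt0 ltr_wpDl.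
  by rewrite invrK; apply: mono Pd _; rewrite lerDl.
- by apply: mono Pd _; rewrite lef_pV2 // posrE // (lt_le_trans d'0).
- by exists d^-1; rewrite ?invr_ge0 ?ltW.
Qed.

(** Heine's theorem in the form suited to translates: x is confined to the ball, x + tau may leave
    it. *)
Lemma unif_cont_ball (f : 'rV[R]_n -> R) p (r w : R) : continuous f -> 0 < w ->
  exists2 d : R, 0 < d & forall x, `|x - p| <= r ->
    forall tau, `|tau| <= d -> `|f (x + tau) - f x| <= w.
Proof.
move=> cf w0; pose K := [set x : 'rV[R]_n | `|x - p| <= r].
have /compact_near_coveringP/(_ R (0^'+)
  (fun d x => forall tau, `|tau| <= d -> `|f (x + tau) - f x| <= w)) H := @compact_closed_ball R n p r.
have /H Hn : forall x, K x -> \forall x \near x & d \near 0^'+,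
    forall tau, `|tau| <= d -> `|f (x + tau) - f x| <= w.
  move=> x _; have w20 : 0 < w / 2 by rewrite divr_gt0.
  have /cont_epsP'/(_ _ w20)[d d0 Hd] := cf x.
  have d20 : 0 < d / 2 by rewrite divr_gt0.
  exists ([set y | `|y - x| < d / 2], [set e | e < d / 2]).
    split => /=; last exact: nbhs_right_lt.
    exact: nbhs_dist.
  move=> [y e] [/= yx ed] tau te.
  have h1 : `|f y - f x| <= w / 2 by apply: Hd; lra.
  have h2 : `|f (y + tau) - f x| <= w / 2.
    apply: Hd; rewrite addrAC; apply: le_lt_trans (ler_normD _ _) _; lra.
  have -> : f (y + tau) - f y = (f (y + tau) - f x) - (f y - f x) by ring.
  by apply: le_trans (ler_normB _ _) _; lra.
near (0 : R)^'+ => d.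
exists d => // x xr; exact: (near Hn d).
Unshelve. all: by end_near. Qed.

End LocalPderiv.

(** * Finite averages over translates *)

Section Averages.
Context {R : realType} {n : nat}.
Notation e_ i := (delta_mx 0 i : 'rV[R]_n).
Variables (h : R) (N : nat).
Hypothesis h0 : 0 < h.
Implicit Types (g : 'rV[R]_n -> R) (x : 'rV[R]_n) (s : seq 'I_n).

Let stp (t : nat) : R := h * t%:R / N.+1%:R.

(* Averaging over finitely many translates replaces mollification: no integral is
   needed, and the average is Lipschitz at any scale coarser than the mesh. *)
Definition avg1 (i : 'I_n) g : 'rV[R]_n -> R :=
  \sum_(t < N.+1) N.+1%:R^-1 *: (fun x => g (x + stp t *: e_ i)).

Definition avg s g : 'rV[R]_n -> R := foldr avg1 g s.

Lemma avg1E i g x : avg1 i g x = \sum_(t < N.+1) N.+1%:R^-1 * g (x + stp t *: e_ i).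
Proof. by rewrite /avg1 fct_sumE. Qed.

Lemma stp_ge0 t : 0 <= stp t.
Proof. by rewrite /stp !mulr_ge0 // ltW. Qed.

Lemma stp_le t : (t <= N.+1)%N -> stp t <= h.
Proof.
by move=> tN; rewrite /stp ler_pdivrMr ?ltr0n // ler_wpM2l ?(ltW h0) // ler_nat.
Qed.

Lemma avg1_dist i g x c w :
  (forall t, (t <= N)%N -> `|g (x + stp t *: e_ i) - c| <= w) -> `|avg1 i g x - c| <= w.
Proof.
move=> H; have Nw (a : R) : a = \sum_(t < N.+1) N.+1%:R^-1 * a.
  by rewrite sumr_const card_ord -mulrnAl -[_ *+ _]mulr_natl mulfV ?mul1r // pnatr_eq0.
rewrite avg1E [X in _ - X]Nw -sumrB [leRHS]Nw.
apply: le_trans (ler_norm_sum _ _ _) _; apply: ler_sum => t _.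
rewrite -mulrBr normrM ger0_norm ?invr_ge0 // ler_wpM2l ?invr_ge0 //.
by apply: H; rewrite -ltnS.
Qed.

Lemma avg_dist s g x c w :
  (forall tau, `|tau| <= h * (size s)%:R -> `|g (x + tau) - c| <= w) -> `|avg s g x - c| <= w.
Proof.
elim: s x => [|i s IH] x H /=.
  by have := H 0; rewrite mulr0 normr0 addr0; apply.
apply: avg1_dist => t tN; apply: IH => tau taule; rewrite -addrA; apply: H.
apply: le_trans (ler_normD _ _) _; rewrite normrZ norm_delta mulr1 ger0_norm ?stp_ge0 //.
rewrite -natr1 mulrDr mulr1 addrC; apply: lerD => //.
by apply: stp_le; exact: leqW.
Qed.

Lemma avg_diff s g a x :
  avg s (fun y => g (y + a) - g y) x = avg s g (x + a) - avg s g x.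
Proof.
elim: s x => [//|i s IH] x /=.
rewrite !avg1E -sumrB; apply: eq_bigr => t _; rewrite -mulrBr IH.
by rewrite [x + a + _]addrAC.
Qed.

Lemma avg1_Ck k i g s : Ck k g ->
  Ck k (avg1 i g) /\ ((size s <= k)%N -> pderiv s (avg1 i g) = avg1 i (pderiv s g)).
Proof.
move=> Hg; have H (t : nat) := Ck_shift (stp t *: e_ i) Hg.
split; first by apply: Ck_sum => t _; apply: CkZ; exact: H.
move=> sk; rewrite /avg1 (@pderiv_sumZ R n k _ _ _ (fun (t : 'I_N.+1) x => g (x + stp t *: e_ i)) s) //.
by apply: eq_bigr => t _; congr (_ *: _); apply/funext => x; rewrite pderiv_shift.
Qed.

Lemma avg_Ck k r g : Ck k g -> Ck k (avg r g).
Proof. by move=> Hg; elim: r => [//|i r IH] /=; have [] := avg1_Ck i [::] IH. Qed.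

Lemma pderiv_avg k r g s : Ck k g -> (size s <= k)%N ->
  pderiv s (avg r g) = avg r (pderiv s g).
Proof.
move=> Hg sk; elim: r => [//|i r IH] /=.
by have [_ ->] := avg1_Ck i s (avg_Ck r Hg); rewrite ?IH.
Qed.

(** Shifting by one mesh step cancels all terms of the average but the two extreme ones, at a cost
    of 2 M / (N + 1); t steps cost t times as much. *)
Lemma avg1_step i g (M : R) x (t : nat) : (forall y, `|g y| <= M) ->
  `|avg1 i g (x + stp t *: e_ i) - avg1 i g x| <= 2 * M * (t%:R / N.+1%:R).
Proof.
move=> gM; elim: t x => [|t IH] x.
  by rewrite /stp mulr0 !mul0r scale0r addr0 subrr normr0 mulr0.
have stpS (k : nat) : stp k.+1 = stp 1 + stp k by rewrite /stp -addn1 natrD; ring.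
pose y := x + stp t *: e_ i.
have E : x + stp t.+1 *: e_ i = y + stp 1 *: e_ i.
  by rewrite /y stpS scalerDl [stp 1 *: _ + _]addrC addrA.
have S : avg1 i g (y + stp 1 *: e_ i) - avg1 i g y = N.+1%:R^-1 * (g (y + h *: e_ i) - g y).
  rewrite !avg1E big_ord_recr [in X in _ - X]big_ord_recl /=.
  rewrite (_ : stp 0 = 0) ?scale0r ?addr0; last by rewrite /stp mulr0 mul0r.
  rewrite (eq_bigr (fun t : 'I_N => N.+1%:R^-1 * g (y + stp (bump 0 t) *: e_ i))); last first.
    by move=> k _; rewrite -[X in g X]addrA -scalerDl -stpS /bump /= add1n.
  have -> : y + stp 1 *: e_ i + stp N *: e_ i = y + h *: e_ i.
    rewrite -addrA -scalerDl -stpS; congr (_ + _ *: _).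
    by rewrite /stp mulfK // pnatr_eq0.
  by set A := \sum_(_ < _) _; ring.
have -> : avg1 i g (x + stp t.+1 *: e_ i) - avg1 i g x =
  (avg1 i g (y + stp 1 *: e_ i) - avg1 i g y) + (avg1 i g (x + stp t *: e_ i) - avg1 i g x).
  by rewrite E /y; ring.
apply: le_trans (ler_normD _ _) _.
have -> : 2 * M * (t.+1%:R / N.+1%:R) = 2 * M * (1 / N.+1%:R) + 2 * M * (t%:R / N.+1%:R).
  by rewrite -[t.+1%:R]natr1; ring.
apply: lerD; last exact: IH.
rewrite S normrM ger0_norm ?invr_ge0 // div1r mulrC ler_wpM2r ?invr_ge0 //.
apply: le_trans (ler_normB _ _) _; have := gM (y + h *: e_ i); have := gM y; lra.
Qed.

(** The displacement u splits into t mesh steps, which cost at most 2 M u / h, and a remainder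
    shorter than the mesh, controlled by the oscillation w of g itself. *)
Lemma avg1_lip i g (M w u eps : R) x : (forall y, `|g y| <= M) -> 0 <= u <= eps ->
  (forall t rho, (t <= N)%N -> 0 <= rho <= h / N.+1%:R ->
     `|g (x + stp t *: e_ i + rho *: e_ i) - g (x + stp t *: e_ i)| <= w) ->
  `|avg1 i g (x + u *: e_ i) - avg1 i g x| <= 2 * M * (eps / h) + w.
Proof.
move=> gM /andP[u0 ue] osc.
have M0 : 0 <= M by apply: le_trans (gM 0).
have stp1 : 0 < h / N.+1%:R by rewrite divr_gt0.
pose t := Num.truncn (u / (h / N.+1%:R)).
have /andP[t1 t2] : t%:R <= u / (h / N.+1%:R) < t.+1%:R.
  by apply: truncn_itv; rewrite divr_ge0 // ltW.
have stE : stp t = t%:R * (h / N.+1%:R) by rewrite /stp; ring.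
rewrite ler_pdivlMr // -stE in t1.
rewrite -[X in _ < X]natr1 ltr_pdivrMr // mulrDl mul1r -stE in t2.
pose rho := u - stp t.
have rho0 : 0 <= rho <= h / N.+1%:R by rewrite /rho subr_ge0 t1 /= lerBlDl ltW.
have -> : x + u *: e_ i = (x + rho *: e_ i) + stp t *: e_ i.
  by rewrite -addrA -scalerDl /rho subrK.
have -> : avg1 i g (x + rho *: e_ i + stp t *: e_ i) - avg1 i g x =
  (avg1 i g (x + rho *: e_ i + stp t *: e_ i) - avg1 i g (x + rho *: e_ i)) +
  (avg1 i g (x + rho *: e_ i) - avg1 i g x) by ring.
apply: le_trans (ler_normD _ _) _; apply: lerD.
  apply: le_trans (avg1_step i (x + rho *: e_ i) t gM) _.
  rewrite ler_wpM2l ?mulr_ge0 // ler_pdivrMr // mulrAC ler_pdivlMr //.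
  move: t1; rewrite /stp ler_pdivrMr // => t1; rewrite [leLHS]mulrC.
  by apply: le_trans t1 _; rewrite ler_wpM2r.
rewrite -[X in `|X|]subr0 -(avg_diff [:: i] g (rho *: e_ i) x) /=.
by apply: avg1_dist => k kN; rewrite subr0; exact: osc.
Qed.

(** The averaging in direction i does the work. Those in the other directions are convex
    combinations of translates, which preserve both the bound on g and its oscillation. *)
Lemma avg_lip s i g (M w u eps : R) x : (forall y, `|g y| <= M) -> 0 <= u <= eps ->
  i \in s ->
  (forall tau rho, `|tau| <= h * (size s)%:R -> 0 <= rho <= h / N.+1%:R ->
     `|g (x + tau + rho *: e_ i) - g (x + tau)| <= w) ->
  `|avg s g (x + u *: e_ i) - avg s g x| <= 2 * M * (eps / h) + w.
Proof.
move=> gM ue; elim: s x => [//|j s IH] x is' osc.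
have step t tau : (t <= N)%N -> `|tau| <= h * (size s)%:R ->
    `|stp t *: e_ j + tau| <= h * (size (j :: s))%:R.
  move=> tN taule; apply: le_trans (ler_normD _ _) _.
  rewrite normrZ norm_delta mulr1 ger0_norm ?stp_ge0 //= -natr1 mulrDr mulr1 addrC.
  by apply: lerD => //; apply: stp_le; exact: leqW.
have [ij|ij] := eqVneq i j; last first.
  have {}is' : i \in s by move: is'; rewrite inE (negbTE ij).
  rewrite /= -[X in `|X|]subr0 -(avg_diff [:: j] (avg s g) (u *: e_ i) x) /=.
  apply: avg1_dist => t tN; rewrite subr0; apply: IH => // tau rho taule rhole.
  by rewrite -[x + _ + tau]addrA; apply: osc => //; exact: step.
rewrite -ij /=; apply: avg1_lip => // [y|t rho tN rhole].
  by rewrite -[X in `|X|]subr0; apply: avg_dist => tau _; rewrite subr0.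
rewrite -[X in `|X|]subr0 -avg_diff; apply: avg_dist => tau taule.
by rewrite subr0 -[x + _ + tau]addrA; apply: osc => //; rewrite ij; exact: step.
Qed.

(** The move from x to x' is made one coordinate at a time. In the sup norm the corners remain in
    the unit ball around z0, because each of their coordinates comes from x or from x'. *)
Lemma avg_scale_lip g (M w eps : R) z0 : (forall y, `|g y| <= M) -> 0 <= eps -> 0 <= w ->
  (forall y i rho, `|y - z0| <= 1 + h * n%:R -> 0 <= rho <= h / N.+1%:R ->
     `|g (y + rho *: e_ i) - g y| <= w) ->
  forall x x', `|x - z0| <= 1 -> `|x' - z0| <= 1 -> `|x' - x| <= eps ->
  `|avg (enum 'I_n) g x' - avg (enum 'I_n) g x| <= n%:R * (2 * M * (eps / h) + w).
Proof.
move=> gM e0 w0 osc x x' xz x'z xx'.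
set F := avg _ g; pose d := x' - x.
have E : F x' - F x = \sum_(k < n) (F (x + trunc_row d k.+1) - F (x + trunc_row d k)).
  rewrite -(big_mkord xpredT (fun k => F (x + trunc_row d k.+1) - F (x + trunc_row d k))).
  rewrite (telescope_sumr (fun k => F (x + trunc_row d k))) // trunc_row0 trunc_rown addr0.
  by rewrite /d addrCA subrr addr0.
have near k : `|x + trunc_row d k - z0| <= 1.
  apply: norm_rV_le => // j; have := le_trans (norm_coord (x - z0) j) xz.
  have := le_trans (norm_coord (x' - z0) j) x'z; rewrite !mxE.
  case: ifP => _; last by rewrite addr0.
  by rewrite addrCA subrr addr0.
have key (y : 'rV[R]_n) i u : `|y - z0| <= 1 -> 0 <= u <= eps ->
    `|F (y + u *: e_ i) - F y| <= 2 * M * (eps / h) + w.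
  move=> yz ue; apply: avg_lip => //; first by rewrite mem_enum.
  move=> tau rho; rewrite size_enum_ord => taule rhole; apply: osc => //.
  by rewrite addrAC; apply: le_trans (ler_normD _ _) _; exact: lerD.
rewrite E; apply: le_trans (ler_norm_sum _ _ _) _.
rewrite (_ : n%:R * _ = \sum_(k < n) (2 * M * (eps / h) + w)); last first.
  by rewrite sumr_const card_ord mulr_natl.
apply: ler_sum => k _.
have ud : `|d 0 k| <= eps by apply: le_trans (norm_coord _ _) xx'.
have [u0|u0] := leP 0 (d 0 k).
  rewrite trunc_rowS addrA; apply: key => //.
  by rewrite u0 /=; move: ud; rewrite ger0_norm.
have -> : x + trunc_row d k = (x + trunc_row d k.+1) + (- d 0 k) *: e_ k.
  by rewrite trunc_rowS scaleNr addrA addrK.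
rewrite distrC; apply: key => //.
by move: ud; rewrite ltr0_norm // => ->; rewrite oppr_ge0 ltW.
Qed.

End Averages.

(** * Truncated powers and a C^4 cut-off function *)

Section TruncatedPowers.
Context {R : realType}.

Definition posp (p : nat) (t : R) : R := if 0 < t then t ^+ p else 0.

Lemma posp1_lip (x y : R) : `|posp 1 y - posp 1 x| <= `|y - x|.
Proof.
have H1 := ler_norm (y - x); have := ler_norm (x - y); rewrite (distrC x y) => H2.
by rewrite /posp !expr1; case: (ltP 0 x) => h1; case: (ltP 0 y) => h2; rewrite ler_norml; apply/andP; split; lra.
Qed.

Lemma posp_cont1 : continuous (posp 1).
Proof.
move=> x; apply/cont_epsP' => e e0; exists e => // y ye.
by apply: le_trans (posp1_lip x y) _; exact: ltW.
Qed.

(** Only the origin needs an estimate: the exponent is at least 2, so the function is o(t) there. *)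
Lemma derive_posp p (t : R) : is_derive t 1 (posp p.+2) (p.+2%:R * posp p.+1 t).
Proof.
have [t0|t0|t0] := ltgtP t 0.
- apply: (@near_eq_is_derive R R R (cst 0)).
    have := nbhs_dist t (_ : 0 < - t); rewrite oppr_gt0 => /(_ t0).
    apply: filterS => y /=; rewrite ltr_norml => /andP[_ yt].
    by rewrite /posp ltNge (_ : y <= 0) //; lra.
  by rewrite /posp ltNge ltW //= mulr0; exact: is_derive_cst.
- apply: (@near_eq_is_derive R R R (fun u : R => u ^+ p.+2)).
    have := nbhs_dist t t0; apply: filterS => y /=; rewrite ltr_norml => /andP[yt _].
    by rewrite /posp (_ : 0 < y) //; lra.
  rewrite /posp t0; have := is_deriveX p.+2 (is_derive_id t 1).
  have -> : (id : R -> R) ^+ p.+2 = (fun u => u ^+ p.+2) by apply/funext => u; rewrite exprfctE.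
  by move=> H; apply: is_derive_eq H _; rewrite [_ *: _]mulr1 -mulr_natl.
- rewrite t0 /posp ltxx mulr0 -/(posp p.+2).
  have [|e e0|d E] := @diff_epsP R R R (posp p.+2) (\0 : {linear R -> R}) 0.
  + exact: cst_continuous.
  + exists (Num.min 1 e); first by rewrite lt_min ltr01.
    move=> h; rewrite lt_min => /andP[h1 he].
    rewrite add0r {2}/posp ltxx !subr0 /posp; case: ifP => h0; last first.
      by rewrite normr0 mulr_ge0 // ltW.
    rewrite normrX !exprS; apply: ler_pM => //.
    * exact: ltW.
    * by rewrite ler_piMr // exprn_ile1 // ltW.
  + split; first exact: diff_derivable.
    by rewrite deriveE // E.
Qed.

(* [spline 0] is the fifth backward difference of [t_+^5 / 5!], and [spline p] its
   [p]-th derivative: a [C^4] function that is [0] for [t <= 0] and [1] for [5 <= t]. *)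
Definition spline_coef (j : nat) : R := [:: 1; -5; 10; -10; 5; -1]`_j / 120.

Definition spline (p : nat) : R -> R :=
  \sum_(j < 6) (spline_coef j * (5 ^_ p)%:R) *: (fun t => posp (5 - p) (t - j%:R)).

Lemma splineE p t : spline p t =
  \sum_(j < 6) spline_coef j * (5 ^_ p)%:R * posp (5 - p) (t - j%:R).
Proof. by rewrite /spline fct_sumE. Qed.

Lemma derive_spline p (t : R) : (p < 4)%N -> is_derive t 1 (spline p) (spline p.+1 t).
Proof.
move=> p4; have [q qE] : exists q, (5 - p = q.+2)%N.
  by move: p4; case: p => [|[|[|[|p]]]] // _; [exists 3%N|exists 2%N|exists 1%N|exists 0%N].
have D (j : 'I_6) : is_derive t 1 (fun t => posp (5 - p) (t - j%:R))
    ((5 - p)%:R * posp (5 - p.+1) (t - j%:R)).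
  have -> : (5 - p.+1 = q.+1)%N by rewrite subnS qE.
  rewrite qE; have [d1 d2] := derive_posp q (t - j%:R).
  have [D1 D2] := @derive_transport R R R R (posp q.+2) (fun t => posp q.+2 (t - j%:R))
     (t - j%:R) 1 t 1 (fun h => congr1 (posp q.+2) (addrA _ _ _)).
  by split; [exact: D1|rewrite -D2].
have := is_derive_sum (fun j : 'I_6 => is_deriveZ (spline_coef j * (5 ^_ p)%:R) (D j)).
move=> H; apply: is_derive_eq H _; rewrite splineE; apply: eq_bigr => j _.
by rewrite ffactnSr natrM /GRing.scale /= !mulrA.
Qed.

Lemma cont_spline p : (p <= 4)%N -> continuous (spline p).
Proof.
rewrite leq_eqVlt => /orP[/eqP ->|p4] t; last first.
  apply: differentiable_continuous; apply/derivable1_diffP.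
  by have [] := derive_spline t p4.
rewrite /spline; elim/big_ind : _ => [|f g cf cg|j _].
- exact: cst_continuous.
- exact: continuousD.
- have -> : (spline_coef j * (5 ^_ 4)%:R) *: (fun t : R => posp (5 - 4) (t - j%:R)) =
      cst (spline_coef j * (5 ^_ 4)%:R) * (fun t : R => posp 1 (t - j%:R)) by [].
  apply: continuousM; first exact: cst_continuous.
  apply: (@continuous_comp _ _ _ (fun t : R => t - j%:R) (posp 1)); last exact: posp_cont1.
  by apply: continuousB; [exact: cvg_id|exact: cst_continuous].
Qed.

Lemma spline_le0 t : t <= 0 -> spline 0 t = 0.
Proof.
move=> t0; rewrite splineE big1 // => j _; rewrite /posp ltNge.
by rewrite (_ : t - j%:R <= 0) ?mulr0 // subr_le0 (le_trans t0).
Qed.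

(** All six truncated powers are plain powers here, at t = 5 included since the last one is then 0;
    the fifth difference of t^5 / 5! is 1. *)
Lemma spline_ge5 t : 5 <= t -> spline 0 t = 1.
Proof.
move=> t5; rewrite splineE.
have P (j : 'I_6) : posp (5 - 0) (t - j%:R) = (t - j%:R) ^+ 5.
  rewrite /posp subn0; case: ltP => // tj.
  have jt : (j%:R : R) <= 5 by rewrite ler_nat -ltnS.
  have -> : t - j%:R = 0 by apply/eqP; rewrite eq_le tj /=; lra.
  by rewrite expr0n.
under eq_bigr do rewrite P.
rewrite !big_ord_recr big_ord0 /= /spline_coef /= ffactn0.
by field.
Qed.

Context {n : nat}.
Notation e_ i := (delta_mx 0 i : 'rV[R]_n).

(** A product of two splines per coordinate. The shift 7 = 5 + 2 keeps both arguments above 5 when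
    the coordinate is at most 2 in absolute value, and makes one of them negative beyond 7. *)
Lemma cutoff_exists (z0 : 'rV[R]_n) : exists chi : 'rV[R]_n -> R,
  [/\ Ck 4 chi, forall z, `|z - z0| <= 2 -> chi z = 1 &
      forall z, 7 < `|z - z0| -> chi z = 0].
Proof.
have C (kap : 'rV[R]_n) c : Ck 4 (ridge kap c (spline 0)).
  have [] := @pderiv_ridge R n kap c 4 spline (fun p t pk => derive_spline t pk) (fun p pk => cont_spline pk).
  by [].
pose F i := ridge (e_ i) (7 - z0 0 i) (spline 0) * ridge (- e_ i) (7 + z0 0 i) (spline 0).
have FE i z : F i z = spline 0 (7 + (z - z0) 0 i) * spline 0 (7 - (z - z0) 0 i).
  rewrite /F fctE /ridge -[- e_ i]scaleN1r dotvZl (dotvC _ z) dotv_delta !mxE.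
  by congr (spline 0 _ * spline 0 _); ring.
exists (fun z => \prod_i F i z); split.
- by apply: Ck_prodf => i _; apply: CkM; exact: C.
- move=> z zz; apply: big1 => i _; have := le_trans (norm_coord (z - z0) i) zz.
  by rewrite FE ler_norml => /andP[? ?]; rewrite !spline_ge5 ?mulr1 //; lra.
- move=> z zz; have [i iz] : exists i, 7 < `|(z - z0) 0 i|.
    apply: contrapT => H; have : `|z - z0| <= 7.
      apply: norm_rV_le => // i; rewrite leNgt; apply/negP => lt; apply: H; by exists i.
    by rewrite leNgt zz.
  rewrite (bigD1 i) //= FE; move: iz; rewrite lter_normr => /orP[?|?].
    by rewrite [X in _ * X * _]spline_le0 ?mulr0 ?mul0r //; lra.
  by rewrite [X in X * _ * _]spline_le0 ?mul0r //; lra.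
Qed.

End TruncatedPowers.

(** * Approximation of C^4 functions, Lipschitz at a prescribed scale *)

Section Approximation.
Context {R : realType} {n : nat}.
Notation e_ i := (delta_mx 0 i : 'rV[R]_n).

Lemma pderivB k (f g : 'rV[R]_n -> R) s : Ck k f -> Ck k g -> (size s <= k)%N ->
  pderiv s (f - g) = pderiv s f - pderiv s g.
Proof.
move=> Hf Hg sk; rewrite -(scaleN1r g).
by rewrite (pderivD Hf (CkZ (-1) Hg) sk) (pderivZ (-1) Hg sk) scaleN1r.
Qed.

Definition mkCb k (f : 'rV[R]_n -> R) (H : Ckb k f) : Cb R n k := MkCb (introT (asboolP _) H).

Lemma Cb_dist k (f g : Cb R n k) (C : R) :
  (forall s x, (size s <= k)%N -> `|pderiv s (Cb_fun f - Cb_fun g) x| <= C) -> `|f - g| <= C.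
Proof. exact: Ck_norm_le. Qed.

(* [psi1] is as close as wanted to [psi0] with a Lipschitz constant [C] that does
   not depend on the scale [eps] at which the estimate is required. *)
Lemma scale_lipschitz_approx (psi0 : Cb R n 4) (z0 : 'rV[R]_n) (delta : R) : 0 < delta ->
  exists2 C : R, 0 <= C & forall eps : R, 0 < eps -> exists2 psi1 : Cb R n 4,
    `|psi1 - psi0| <= delta &
    forall s x x', (size s <= 4)%N -> `|x - z0| <= 1 -> `|x' - z0| <= 1 -> `|x' - x| <= eps ->
      `|pderiv s psi1 x' - pderiv s psi1 x| <= C * eps.
Proof.
move=> dl0; have [chi [Cchi chi1 chi0]] := cutoff_exists z0.
have [Cpsi Bpsi] := CbP psi0.
have psiM s x : (size s <= 4)%N -> `|pderiv s psi0 x| <= `|psi0|.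
  exact: (Ck_norm_ub x (CbP psi0)).
(* The fourth derivatives of psi0 need not be uniformly continuous on R^n, so averages are close to
   psi0 on bounded sets only; the correction is therefore cut off far from z0. *)
pose far := [set x | 7 < `|x - z0|].
have ofar : open far.
  have -> : far = (fun x => `|x - z0|) @^-1` [set t | 7 < t] by [].
  by apply: open_comp => [x _|]; [exact: cont_dist|exact: open_gt].
have zero_far (f : 'rV[R]_n -> R) s x : far x -> pderiv s (chi * f) x = 0.
  move=> fx; rewrite (@pderiv_local _ _ _ 0 far s ofar) ?pderiv0 // => y fy.
  by rewrite fctE chi0 // mul0r.
have [A A0 HA] : exists2 A : R, 0 <= A & forall s, (size s <= 4)%N ->
    forall x, `|x - z0| <= 7 -> `|pderiv s chi x| <= A.
  apply: seq_bound => [s s4|s d d' H dd x xz]; last exact: le_trans (H x xz) dd.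
  by apply: cont_bounded_ball; apply: (@Ck_cont _ _ 0); apply: Ck_pderiv; exact: Ck_le Cchi.
(* By the Leibniz bound, the derivatives of the correction are then at most 2^4 A w0 <= delta. *)
pose w0 := delta / (16 * (A + 1)).
have A1 : 0 < A + 1 by rewrite ltr_wpDl.
have w00 : 0 < w0 by rewrite divr_gt0 // mulr_gt0.
have cpsi s : (size s <= 4)%N -> continuous (pderiv s psi0).
  by move=> s4; apply: (@Ck_cont _ _ 0); apply: Ck_pderiv; exact: Ck_le Cpsi.
have [|s d d' H d'0 dd x xz tau ht|d d0 Hd] := @seq_radius R n 4 (fun s d => forall x, `|x - z0| <= 7 ->
   forall tau, `|tau| <= d -> `|pderiv s psi0 (x + tau) - pderiv s psi0 x| <= w0).
- by move=> s s4; apply: unif_cont_ball => //; exact: cpsi.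
- by apply: H => //; exact: le_trans dd.
(* Translates by at most h n stay within d, so averaging changes the derivatives by at most w0. The
   length h, and with it the Lipschitz constant, is fixed before eps. *)
pose h := d / n.+1%:R.
have h0 : 0 < h by rewrite divr_gt0.
have hn : h * n%:R <= d.
  by rewrite /h mulrAC ler_pdivrMr ?ltr0n // ler_wpM2l ?(ltW d0) // ler_nat.
exists (n%:R * (2 * `|psi0| / h + 1)).
  by rewrite mulr_ge0 // addr_ge0 // divr_ge0 ?mulr_ge0 // ltW.
move=> eps e0.
have [|s d2 d2' H d2'0 dd x xz tau ht|d2 d20 Hd2] := @seq_radius R n 4 (fun s d => forall x, `|x - z0| <= 1 + h * n%:R ->
   forall tau, `|tau| <= d -> `|pderiv s psi0 (x + tau) - pderiv s psi0 x| <= eps).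
- by move=> s s4; apply: unif_cont_ball => //; exact: cpsi.
- by apply: H => //; exact: le_trans dd.
(* The number of translates is what depends on eps: the mesh h / (N + 1) must not exceed d2, the
   scale below which the derivatives of psi0 oscillate by at most eps. *)
pose N := Num.truncn (h / d2).
have hN : h / N.+1%:R <= d2.
  rewrite ler_pdivrMr ?ltr0n // mulrC -ler_pdivrMr //; apply: ltW.
  exact: truncnS_gt.
pose F := avg h N (enum 'I_n) psi0.
have CF : Ck 4 F by exact: avg_Ck.
have pF s : (size s <= 4)%N -> pderiv s F = avg h N (enum 'I_n) (pderiv s psi0).
  exact: pderiv_avg.
have CD : Ck 4 (F - psi0) by exact: CkB.
have D s x : (size s <= 4)%N -> `|pderiv s (chi * (F - psi0)) x| <= delta.
  move=> s4; have [xz|xz] := leP `|x - z0| 7; last first.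
    by rewrite zero_far // normr0 ltW.
  have H := @pderivM_bound R n chi (F - psi0) s A w0 x (Ck_le s4 Cchi) (Ck_le s4 CD) A0 (ltW w00).
  apply: le_trans (H _ _) _.
  - by move=> t ts; apply: HA => //; exact: leq_trans s4.
  - move=> t ts; have t4 : (size t <= 4)%N by exact: leq_trans s4.
    rewrite (pderivB CF Cpsi t4) pF //.
    apply: avg_dist => // tau; rewrite size_enum_ord => ht; apply: Hd => //.
    exact: le_trans hn.
  - have -> : delta = 16 * (A + 1) * w0 by rewrite /w0; field; rewrite gt_eqF.
    rewrite ler_wpM2r ?(ltW w00) //; apply: ler_pM => //; last by rewrite lerDl.
    have -> : (16 : R) = 2 ^+ 4 by ring.
    by rewrite ler_weXn2l // ler1n.
have Cg : Ck 4 (chi * (F - psi0)) by exact: CkM.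
have B1 : Ckb 4 (chi * (F - psi0)).
  split=> [//|s s4]; apply/Defs.bounded_funP.
  by exists delta => x; exact: D.
exists (mkCb (CkbD (CbP psi0) B1)).
  apply: Cb_dist => s x s4 /=.
  by rewrite addrAC subrr add0r; exact: D.
(* The cut-off is 1 on the ball of radius 2, so on the unit ball the new function has the jet of the
   average. *)
have near1 s x : (size s <= 4)%N -> `|x - z0| <= 1 ->
    pderiv s ((psi0 : _ -> R) + chi * (F - psi0)) x = avg h N (enum 'I_n) (pderiv s psi0) x.
  move=> s4 xz; rewrite -pF //.
  apply: (@pderiv_local _ _ _ _ [set y | `|y - z0| < 2]).
  - have -> : [set y | `|y - z0| < 2] = (fun x => `|x - z0|) @^-1` [set t | t < 2] by [].
    by apply: open_comp => [y _|]; [exact: cont_dist|exact: open_lt].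
  - by move=> y /= yz; rewrite !fctE chi1 ?ltW // mul1r addrC subrK.
  - by rewrite /=; apply: le_lt_trans xz _; rewrite ltr1n.
move=> s x x' s4 xz x'z xx' /=.
rewrite !near1 //.
have := @avg_scale_lip R n h N h0 (pderiv s psi0) `|psi0| eps eps z0
  (fun y => psiM s y s4) (ltW e0) (ltW e0) _ x x' xz x'z xx'.
have -> : n%:R * (2 * `|psi0| * (eps / h) + eps) = n%:R * (2 * `|psi0| / h + 1) * eps by ring.
apply=> y i rho yz /andP[r0 rN]; apply: Hd2 => //.
by rewrite normrZ norm_delta mulr1 ger0_norm //; exact: le_trans hN.
Qed.

End Approximation.

Lemma denseT (T : topologicalType) : dense [set: T].
Proof. by move=> O [x Ox] _; exists x. Qed.

(** * Systems of equations linear in the 4-jet *)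

Section Systems.
Context {R : realType} {n k : nat}.
Implicit Types (J : seq 'I_n -> R) (y : 'rV[R]_k).

(** Longer indices are sent to 0, as derivatives of order above 4 would be junk values for a C^4
    function; this keeps the jet linear in f. *)
Definition jet (f : 'rV[R]_n -> R) (z : 'rV[R]_n) : seq 'I_n -> R :=
  fun s => if (size s <= 4)%N then pderiv s f z else 0.

Definition jbound J (B : R) := forall s, (size s <= 4)%N -> `|J s| <= B.

Lemma jet_linear (f g : 'rV[R]_n -> R) a z : Ck 4 f -> Ck 4 g ->
  jet (f + a *: g) z = jet f z + a *: jet g z.
Proof.
move=> Hf Hg; apply/funext => s.
change (jet (f + a *: g) z s = jet f z s + a * jet g z s); rewrite /jet.
case: ifP => s4; last by rewrite mulr0 addr0.
by rewrite (pderivD Hf (CkZ a Hg) s4) (pderivZ a Hg s4).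
Qed.

Definition jetC z (f : Cb R n 4) : seq 'I_n -> R := jet f z.

Lemma jetC_is_linear z : linear (jetC z).
Proof.
move=> a f g; rewrite [a *: f + g]addrC [RHS]addrC.
exact: (jet_linear a z (CbP g).1 (CbP f).1).
Qed.
HB.instance Definition _ z :=
  GRing.isLinear.Build R (Cb R n 4) (seq 'I_n -> R) _ (jetC z) (jetC_is_linear z).

Lemma jetCB z (f g : Cb R n 4) : jetC z (f - g) = jetC z f - jetC z g.
Proof. exact: (linearB (jetC z)). Qed.

Lemma jetC_bound z f : jbound (jetC z f) `|f|.
Proof. by move=> s s4; rewrite /jetC /jet s4; exact: (Ck_norm_ub z (CbP f)). Qed.

(** The values are bounded along with the increments so that the class is closed under products. *)
Definition lipf (y0 : 'rV[R]_k) (f : 'rV[R]_k -> R) := exists2 C : R, 0 <= C &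
  forall y y', `|y - y0| <= 1 -> `|y' - y0| <= 1 -> `|f y| <= C /\ `|f y' - f y| <= C * `|y' - y|.

Lemma lipf_cst y0 c : lipf y0 (fun _ => c).
Proof. by exists `|c| => // y y' _ _; rewrite subrr normr0 mulr_ge0. Qed.

Lemma lipf_coord y0 j : lipf y0 (fun y => y 0 j).
Proof.
exists (`|y0| + 1); first by rewrite addr_ge0.
move=> y y' yy _; split.
  apply: le_trans (norm_coord _ _) _; rewrite -[y](subrK y0) addrC.
  by apply: le_trans (ler_normD _ _) _; rewrite lerD2l.
have := norm_coord (y' - y) j; rewrite !mxE => /le_trans; apply.
by rewrite ler_peMl // lerDr.
Qed.

Lemma lipfD y0 f g : lipf y0 f -> lipf y0 g -> lipf y0 (fun y => f y + g y).
Proof.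
move=> [A A0 HA] [B B0 HB]; exists (A + B); first exact: addr_ge0.
move=> y y' hy hy'; have [a1 a2] := HA y y' hy hy'; have [b1 b2] := HB y y' hy hy'.
split; first by apply: le_trans (ler_normD _ _) _; exact: lerD.
have -> : f y' + g y' - (f y + g y) = (f y' - f y) + (g y' - g y) by ring.
by apply: le_trans (ler_normD _ _) _; rewrite mulrDl; exact: lerD.
Qed.

Lemma lipfM y0 f g : lipf y0 f -> lipf y0 g -> lipf y0 (fun y => f y * g y).
Proof.
move=> [A A0 HA] [B B0 HB]; exists (2 * A * B + A * B); first by rewrite !addr_ge0 ?mulr_ge0.
move=> y y' hy hy'; have [a1 a2] := HA y y' hy hy'; have [b1 b2] := HB y y' hy hy'.
have [a1' _] := HA y' y hy' hy.
split.
  rewrite normrM; apply: le_trans (ler_pM _ _ a1 b1) _ => //.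
  by rewrite lerDr !mulr_ge0.
have -> : f y' * g y' - f y * g y = f y' * (g y' - g y) + (f y' - f y) * g y by ring.
apply: le_trans (ler_normD _ _) _; rewrite !normrM.
apply: (@le_trans _ _ (A * (B * `|y' - y|) + (A * `|y' - y|) * B)).
  by apply: lerD; apply: ler_pM.
have -> : A * (B * `|y' - y|) + A * `|y' - y| * B = 2 * A * B * `|y' - y| by ring.
by rewrite ler_wpM2r // lerDl mulr_ge0.
Qed.

Lemma lipf_sum y0 (I : Type) (r : seq I) (P : pred I) (F : I -> 'rV[R]_k -> R) :
  (forall i, lipf y0 (F i)) -> lipf y0 (fun y => \sum_(i <- r | P i) F i y).
Proof.
move=> H; elim: r => [|i r IH].
  have := lipf_cst y0 0; congr lipf; apply/funext => y; by rewrite big_nil.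
have : lipf y0 (fun y => (if P i then F i y else 0) + \sum_(i <- r | P i) F i y).
  by apply: lipfD => //; case: (P i) => //; exact: lipf_cst.
congr lipf; apply/funext => y; rewrite big_cons; case: (P i) => //; by rewrite add0r.
Qed.

(* [F J y] is linear in the jet [J], with coefficients that are locally Lipschitz in [y]. *)
Definition jform (y0 : 'rV[R]_k) (F : (seq 'I_n -> R) -> 'rV[R]_k -> R) :=
  (forall a J J' y, F (J + a *: J') y = F J y + a * F J' y) /\
  exists2 C : R, 0 <= C & forall J B, 0 <= B -> jbound J B ->
    forall y y', `|y - y0| <= 1 -> `|y' - y0| <= 1 ->
    `|F J y| <= C * B /\ `|F J y' - F J y| <= C * B * `|y' - y|.

Lemma jform_proj y0 s : (size s <= 4)%N -> jform y0 (fun J _ => J s).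
Proof.
move=> s4; split=> //; exists 1 => // J B B0 /(_ s s4) H y y' _ _.
by rewrite mul1r subrr normr0 mulr_ge0.
Qed.

Lemma jformD y0 F G : jform y0 F -> jform y0 G -> jform y0 (fun J y => F J y + G J y).
Proof.
move=> [lF [A A0 HA]] [lG [B B0 HB]]; split=> [a J J' y|].
  by rewrite lF lG; ring.
exists (A + B); first exact: addr_ge0.
move=> J M M0 JM y y' hy hy'.
have [a1 a2] := HA J M M0 JM y y' hy hy'; have [b1 b2] := HB J M M0 JM y y' hy hy'.
split; first by apply: le_trans (ler_normD _ _) _; rewrite mulrDl; exact: lerD.
have -> : F J y' + G J y' - (F J y + G J y) = (F J y' - F J y) + (G J y' - G J y) by ring.
by apply: le_trans (ler_normD _ _) _; rewrite !mulrDl; exact: lerD.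
Qed.

Lemma jformM y0 f F : lipf y0 f -> jform y0 F -> jform y0 (fun J y => f y * F J y).
Proof.
move=> [A A0 HA] [lF [B B0 HB]]; split=> [a J J' y|]; first by rewrite lF; ring.
exists (2 * A * B + A * B); first by rewrite !addr_ge0 ?mulr_ge0.
move=> J M M0 JM y y' hy hy'.
have [a1 a2] := HA y y' hy hy'; have [b1 b2] := HB J M M0 JM y y' hy hy'.
have [a1' _] := HA y' y hy' hy.
split.
  rewrite normrM; apply: le_trans (ler_pM _ _ a1 b1) _ => //.
  by rewrite mulrA ler_wpM2r // lerDr !mulr_ge0.
have -> : f y' * F J y' - f y * F J y = f y' * (F J y' - F J y) + (f y' - f y) * F J y by ring.
apply: le_trans (ler_normD _ _) _; rewrite !normrM.
apply: (@le_trans _ _ (A * (B * M * `|y' - y|) + (A * `|y' - y|) * (B * M))).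
  by apply: lerD; apply: ler_pM.
have -> : A * (B * M * `|y' - y|) + A * `|y' - y| * (B * M) = 2 * A * B * M * `|y' - y| by ring.
by rewrite ler_wpM2r // ler_wpM2r // lerDl mulr_ge0.
Qed.

Lemma jform_sum y0 (I : Type) (r : seq I) (P : pred I) (F : I -> (seq 'I_n -> R) -> 'rV[R]_k -> R) :
  (forall i, jform y0 (F i)) -> jform y0 (fun J y => \sum_(i <- r | P i) F i J y).
Proof.
have j0 : jform y0 (fun _ _ => 0).
  split=> [a J J' y|]; first by rewrite mulr0 addr0.
  by exists 0 => // *; rewrite !mul0r subrr normr0.
move=> H; elim: r => [|i r IH].
  by congr jform: j0; apply/funext => J; apply/funext => y; rewrite big_nil.
have : jform y0 (fun J y => (if P i then F i J y else 0) + \sum_(i <- r | P i) F i J y).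
  by apply: jformD => //; case: (P i).
congr jform; apply/funext => J; apply/funext => y; rewrite big_cons; case: (P i) => //.
by rewrite add0r.
Qed.

(** The admissible perturbations. Unlike psi, they have Lipschitz fourth derivatives, hence
    contribute Lipschitz terms to the system. *)
Definition nice (f : 'rV[R]_n -> R) := Ckb 4 f /\ exists2 C : R, 0 <= C &
  forall s x x', (size s <= 4)%N -> `|pderiv s f x' - pderiv s f x| <= C * `|x' - x|.

Lemma niceD f g a : nice f -> nice g -> nice (f + a *: g).
Proof.
move=> [Bf [A A0 HA]] [Bg [B B0 HB]]; split; first exact: CkbD Bf (CkbZ a Bg).
exists (A + `|a| * B); first by rewrite addr_ge0 ?mulr_ge0.
move=> s x x' s4; rewrite (pderivD Bf.1 (CkZ a Bg.1) s4) (pderivZ a Bg.1 s4) !fctE.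
have -> : pderiv s f x' + a * pderiv s g x' - (pderiv s f x + a * pderiv s g x) =
  (pderiv s f x' - pderiv s f x) + a * (pderiv s g x' - pderiv s g x) by ring.
apply: le_trans (ler_normD _ _) _; rewrite mulrDl; apply: lerD; first exact: HA.
by rewrite normrM -mulrA ler_wpM2l //; exact: HB.
Qed.

Lemma nice0 : nice 0.
Proof.
split; first exact: Ckb0.
have Z (x : 'rV[R]_n) : (0 : 'rV[R]_n -> R) x = 0 by [].
by exists 0 => // s x x' _; rewrite pderiv0 !Z subrr normr0 mul0r.
Qed.

End Systems.

(** * Overdetermined systems have no regular zeros for generic psi *)

Section Residual.
Context {R : realType} {n k m : nat}.
Variables (Lam : (seq 'I_n -> R) -> 'rV[R]_k -> 'rV[R]_m) (gg : 'rV[R]_k -> 'rV[R]_m)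
  (zz : 'rV[R]_k -> 'rV[R]_n).
Hypothesis LamJ : forall y0 l, jform y0 (fun J y => Lam J y 0 l).
Hypothesis ggL : forall y0 l, lipf y0 (fun y => gg y 0 l).
Hypothesis zzL : forall y y', `|zz y' - zz y| <= `|y' - y|.

(** The vector y collects the k unknowns, and [zz y] is the point where the jet is taken; [Lam] is
    the part linear in the jet, [gg] the part free of psi. *)
Definition sys (psi : 'rV[R]_n -> R) y := Lam (jet psi (zz y)) y + gg y.

(* No linear combination of the equations is insensitive to perturbations of [psi]. *)
Definition regular_param y := forall mu : 'rV[R]_m,
  (forall f, nice f -> dotv mu (Lam (jet f (zz y)) y) = 0) -> mu = 0.

Lemma Lam_lin a J J' y : Lam (J + a *: J') y = Lam J y + a *: Lam J' y.
Proof. by apply/rowP => l; have [-> _] := LamJ y l; rewrite !mxE. Qed.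

Lemma Lam0 y : Lam 0 y = 0.
Proof.
have := Lam_lin (-1) 0 0 y; rewrite scaler0 addr0 scaleN1r subrr; exact.
Qed.

Lemma LamB J J' y : Lam (J - J') y = Lam J y - Lam J' y.
Proof. by rewrite -scaleN1r Lam_lin scaleN1r. Qed.

Lemma Lam_sum (I : Type) (r : seq I) (a : I -> R) (J : I -> _) y :
  Lam (\sum_(i <- r) a i *: J i) y = \sum_(i <- r) a i *: Lam (J i) y.
Proof.
elim: r => [|i r IH]; first by rewrite !big_nil Lam0.
by rewrite !big_cons addrC Lam_lin IH addrC.
Qed.

Lemma sys_bounds y0 : exists2 C : R, 0 <= C & forall y y', `|y - y0| <= 1 -> `|y' - y0| <= 1 ->
  (forall J B, 0 <= B -> jbound J B ->
    `|Lam J y| <= C * B /\ `|Lam J y' - Lam J y| <= C * B * `|y' - y|) /\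
  `|gg y' - gg y| <= C * `|y' - y|.
Proof.
have H l : exists C : R, 0 <= C /\ forall y y', `|y - y0| <= 1 -> `|y' - y0| <= 1 ->
  (forall J B, 0 <= B -> jbound J B ->
    `|Lam J y 0 l| <= C * B /\ `|Lam J y' 0 l - Lam J y 0 l| <= C * B * `|y' - y|) /\
  `|gg y' 0 l - gg y 0 l| <= C * `|y' - y|.
  have [_ [A A0 HA]] := LamJ y0 l; have [B B0 HB] := ggL y0 l.
  exists (A + B); split; first exact: addr_ge0.
  move=> y y' hy hy'; split=> [J M M0 JM|].
    have [a b] := HA J M M0 JM y y' hy hy'; split.
      by apply: le_trans a _; rewrite ler_wpM2r // lerDl.
    by apply: le_trans b _; rewrite !ler_wpM2r // lerDl.
  by have [_ /le_trans] := HB y y' hy hy'; apply; rewrite ler_wpM2r // lerDr.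
have [C HC] := choice H.
have C0 l : 0 <= C l by have [] := HC l.
exists (\sum_l C l); first by apply: sumr_ge0.
have Cl l : C l <= \sum_l C l by rewrite (bigD1 l) //= lerDl sumr_ge0.
have S0 : 0 <= \sum_l C l by apply: sumr_ge0.
move=> y y' hy hy'; split=> [J B B0 JB|].
  split; apply: norm_rV_le => [|l].
  - by rewrite mulr_ge0.
  - have [_ /(_ y y' hy hy')[/(_ J B B0 JB)[a _] _]] := HC l.
    by apply: le_trans a _; rewrite ler_wpM2r.
  - by rewrite !mulr_ge0.
  - have [_ /(_ y y' hy hy')[/(_ J B B0 JB)[_ a] _]] := HC l.
    by rewrite !mxE; apply: le_trans a _; rewrite !ler_wpM2r.
apply: norm_rV_le => [|l]; first by rewrite mulr_ge0.
have [_ /(_ y y' hy hy')[_ a]] := HC l.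
by rewrite !mxE; apply: le_trans a _; rewrite !ler_wpM2r.
Qed.

(** By duality: the values of [Lam] on jets of nice functions form a subspace, and regularity says
    that nothing annihilates it. *)
Lemma regular_dual_basis y0 : regular_param y0 -> exists f : 'I_m -> 'rV[R]_n -> R,
  forall l, nice (f l) /\ Lam (jet (f l) (zz y0)) y0 = delta_mx 0 l.
Proof.
move=> reg; pose P u := exists f, nice f /\ Lam (jet f (zz y0)) y0 = u.
have full : forall u, P u.
  apply: subspace_full.
  - move=> u v a [f [nf <-]] [g [ng <-]]; exists (f + a *: g); split; first exact: niceD.
    by rewrite jet_linear ?Lam_lin //; [exact: nf.1.1|exact: ng.1.1].
  - exists 0; split; first exact: nice0.
    rewrite (_ : jet 0 (zz y0) = 0) ?Lam0 //; apply/funext => s.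
    by rewrite /jet pderiv0; case: ifP.
  - move=> mu H; apply: reg => f nf; apply: H; by exists f.
have [f Hf] := choice (fun l => full (delta_mx 0 l)); by exists f.
Qed.

Hypothesis km : (k < m)%N.

(** In the dual basis, theta enters the system at y0 through the identity, hence up to relative
    error 1/2 on a ball whose radius is chosen before psi0 and delta. All other changes of the
    system between points at distance eta are at most c eta, as [grid_avoidance] requires. The order
    of choices is essential: C1, then c, then eta, and only then psi1, which depends on eta. *)
Lemma local_avoidance y0 : regular_param y0 -> exists2 r : R, 0 < r &
  forall (psi0 : Cb R n 4) (delta : R), 0 < delta -> exists2 psi : Cb R n 4,
    `|psi - psi0| <= delta &
    exists2 eps : R, 0 < eps & forall y, `|y - y0| <= r -> eps <= `|sys psi y|.
Proof.
move=> reg; have [f Hf] := regular_dual_basis reg.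
have [C C0 HC] := sys_bounds y0.
have m0 : (0 < m%:R :> R) by rewrite ltr0n; exact: leq_trans km.
pose fC l : Cb R n 4 := mkCb (Hf l).1.1.
pose Bf := \sum_l `|fC l|.
have Bf0 : 0 <= Bf by apply: sumr_ge0.
have Bfl l : `|fC l| <= Bf by rewrite /Bf (bigD1 l) //= lerDl sumr_ge0.
have [l|Cl HCl] := @choice 'I_m R (fun l C => 0 <= C /\ forall s x x', (size s <= 4)%N ->
    `|pderiv s (f l) x' - pderiv s (f l) x| <= C * `|x' - x|).
  by have [_ [A A0 HA]] := (Hf l).1; exists A.
pose Cf := \sum_l Cl l.
have Cl0 l : 0 <= Cl l by have [] := HCl l.
have Cf0 : 0 <= Cf by apply: sumr_ge0.
have jf l z z' : jbound (jetC z' (fC l) - jetC z (fC l)) (Cf * `|z' - z|).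
  move=> s s4; rewrite /jetC /jet !fctE s4 /=.
  have [_ /(_ s z z' s4)] := HCl l; move/le_trans; apply.
  by rewrite ler_wpM2r // /Cf (bigD1 l) //= lerDl sumr_ge0.
pose D := C * Cf + C * Bf + 1.
have D0 : 0 < D by rewrite ltr_wpDl // addr_ge0 // mulr_ge0.
(* D bounds the variation of [Lam] on the jets of the dual basis per unit of distance. Within r,
   each of the m images is off by at most 1 / (2 m), and the m errors add up to 1/2. *)
pose r := Num.min 1 (2 * m%:R * D)^-1.
have r0 : 0 < r by rewrite lt_min ltr01 invr_gt0 !mulr_gt0.
have r1 : r <= 1 by rewrite ge_min lexx.
have rD : D * r <= (2 * m%:R)^-1.
  apply: le_trans (_ : D * (2 * m%:R * D)^-1 <= _).
    by rewrite ler_wpM2l ?(ltW D0) // ge_min lexx orbT.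
  by rewrite invfM mulrCA divff ?gt_eqF // mulr1.
have y00 : `|y0 - y0| <= 1 by rewrite subrr normr0.
have Lf l y : `|y - y0| <= r -> `|Lam (jetC (zz y) (fC l)) y - delta_mx 0 l| <= (2 * m%:R)^-1.
  move=> yr; have y1 := le_trans yr r1.
  rewrite -(Hf l).2.
  have -> : Lam (jetC (zz y) (fC l)) y - Lam (jet (f l) (zz y0)) y0 =
    Lam (jetC (zz y) (fC l) - jetC (zz y0) (fC l)) y +
    (Lam (jetC (zz y0) (fC l)) y - Lam (jetC (zz y0) (fC l)) y0).
    by rewrite LamB addrA subrK.
  apply: le_trans (ler_normD _ _) _.
  have [H1 _] := HC y y0 y1 y00; have [H2 _] := HC y0 y y00 y1.
  have M0 : 0 <= Cf * `|zz y - zz y0| by rewrite mulr_ge0.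
  have [a1 _] := H1 _ _ M0 (jf l (zz y0) (zz y)).
  have [_ a2] := H2 _ _ (normr_ge0 _) (jetC_bound (zz y0) (fC l)).
  apply: le_trans rD; have -> : D * r = C * (Cf * r) + C * Bf * r + r by rewrite /D; ring.
  rewrite -[leLHS]addr0; apply: lerD; last exact: ltW.
  apply: lerD.
    apply: le_trans a1 _; rewrite ler_wpM2l // ler_wpM2l //.
    exact: le_trans (zzL _ _) yr.
  apply: le_trans a2 _; apply: ler_pM => //; first by rewrite mulr_ge0.
  by rewrite ler_wpM2l.
exists r => // psi0 delta dl0.
(* One half of delta pays for the combination of the dual basis, the other half for the
   approximation psi1. *)
pose beta := delta / (2 * (m%:R * Bf + 1)).
have E0 : 0 < m%:R * Bf + 1 by rewrite ltr_wpDl // mulr_ge0 // ltW.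
have b0 : 0 < beta by rewrite divr_gt0 // mulr_gt0.
have mb : m%:R * Bf * beta <= delta / 2.
  have -> : delta / 2 = (m%:R * Bf + 1) * beta by rewrite /beta; field; rewrite gt_eqF.
  by rewrite ler_wpM2r ?(ltW b0) // lerDl.
have dl2 : 0 < delta / 2 by rewrite divr_gt0.
have [C1 C10 Happ] := scale_lipschitz_approx psi0 (zz y0) dl2.
pose M := `|psi0| + delta.
have M0 : 0 <= M by rewrite addr_ge0 // ltW.
(* Per unit of eta: the change of [Lam] in y on jets of size M, the change of the jets of psi1 and
   of the perturbation, and the change of [gg]. *)
pose c := C * M + C * (C1 + m%:R * beta * Cf) + C.
have mbC : 0 <= m%:R * beta * Cf by exact: mulr_ge0 (mulr_ge0 (ltW m0) (ltW b0)) Cf0.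
have c0 : 0 <= c by apply: addr_ge0 => //; apply: addr_ge0; apply: mulr_ge0 => //; apply: addr_ge0.
have [eta eta0 [eps eps0 Hgrid]] := grid_avoidance km c0 b0 r0.
have [psi1 psi1d Hpsi1] := Happ eta eta0.
pose Pth (th : 'rV[R]_m) : Cb R n 4 := psi1 + \sum_l th 0 l *: fC l.
have Pd th : `|th| <= beta -> `|Pth th - psi0| <= delta.
  move=> thb; have -> : Pth th - psi0 = (psi1 - psi0) + \sum_l th 0 l *: fC l.
    by rewrite /Pth addrAC.
  have -> : delta = delta / 2 + delta / 2 by field.
  apply: le_trans (ler_normD _ _) _; apply: lerD => //.
  apply: le_trans (ler_norm_sum _ _ _) _; apply: le_trans mb.
  have -> : m%:R * Bf * beta = \sum_(l < m) beta * Bf.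
    by rewrite sumr_const card_ord -[RHS]mulr_natl; ring.
  apply: ler_sum => l _; rewrite normrZ; apply: ler_pM => //.
  exact: le_trans (norm_coord _ _) thb.
have [|th thb Hth] := Hgrid y0 (fun th y => sys (Pth th) y); last first.
  by exists (Pth th); [exact: Pd|exists eps].
move=> th th' y y' thb thb' yr yr' yy'.
have y1 := le_trans yr r1; have y1' := le_trans yr' r1.
have [HL Hg] := HC y y' y1 y1'.
have zy : `|zz y - zz y0| <= 1 by exact: le_trans (zzL _ _) y1.
have zy' : `|zz y' - zz y0| <= 1 by exact: le_trans (zzL _ _) y1'.
have zyy : `|zz y' - zz y| <= eta by exact: le_trans (zzL _ _) yy'.
pose J' := jetC (zz y') (Pth th'); pose J := jetC (zz y) (Pth th').
have JE z t : jetC z (Pth t) = jetC z psi1 + \sum_l t 0 l *: jetC z (fC l).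
  by rewrite /Pth linearD linear_sum; congr (_ + _); apply: eq_bigr => l _; rewrite linearZ.
pose T := Lam (J - jetC (zz y) (Pth th)) y.
have TE : T = \sum_l (th' - th) 0 l *: Lam (jetC (zz y) (fC l)) y.
  rewrite /T /J !JE opprD addrACA subrr add0r -sumrB -Lam_sum; congr (Lam _ y).
  by apply: eq_bigr => l _; rewrite -scalerBl !mxE.
have T2 : 2^-1 * `|th' - th| <= `|T|.
  have : `|T - (th' - th)| <= 2^-1 * `|th' - th|.
    rewrite TE {2}[th' - th]row_sum_basis -sumrB.
    apply: le_trans (ler_norm_sum _ _ _) _.
    have -> : 2^-1 * `|th' - th| = \sum_(l < m) `|th' - th| * (2 * m%:R)^-1.
      by rewrite sumr_const card_ord -[RHS]mulr_natl; field; rewrite gt_eqF.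
    apply: ler_sum => l _; rewrite -scalerBr normrZ.
    apply: ler_pM => //; first exact: norm_coord.
    exact: Lf.
  have := ler_normD (T - (th' - th)) (- T); rewrite addrAC subrr add0r !normrN; lra.
apply: le_trans T2 _.
(* This isolates the response T to the change of parameter; the other terms are the effects of
   moving the unknowns in [Lam], in the jet and in [gg]. *)
have -> : T = (sys (Pth th') y' - sys (Pth th) y) - (Lam J' y' - Lam J' y) - Lam (J' - J) y
   - (gg y' - gg y).
  rewrite /T /sys !LamB -/(jetC (zz y') (Pth th')) -/(jetC (zz y) (Pth th)) -/J' -/J.
  by apply/rowP => l; rewrite !mxE; ring.
have JM : jbound J' M.
  move=> s s4; apply: le_trans (jetC_bound _ _ s4) _.
  rewrite -[Pth th'](subrK psi0) addrC; apply: le_trans (ler_normD _ _) _.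
  by rewrite lerD2l; exact: Pd.
have JJ : jbound (J' - J) ((C1 + m%:R * beta * Cf) * eta).
  have JJE : J' - J = (jetC (zz y') psi1 - jetC (zz y) psi1) +
     \sum_l th' 0 l *: (jetC (zz y') (fC l) - jetC (zz y) (fC l)).
    rewrite /J' /J !JE opprD addrACA; congr (_ + _); rewrite -sumrB.
    by apply: eq_bigr => l _; rewrite scalerBr.
  move=> s s4; rewrite JJE fctE; apply: le_trans (ler_normD _ _) _.
  rewrite mulrDl; apply: lerD.
    rewrite /jetC /jet !fctE s4 /=; exact: Hpsi1.
  rewrite fct_sumE; apply: le_trans (ler_norm_sum _ _ _) _.
  have -> : m%:R * beta * Cf * eta = \sum_(l < m) beta * (Cf * eta).
    by rewrite sumr_const card_ord -[RHS]mulr_natl; ring.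
  apply: ler_sum => l _; rewrite normrM; apply: ler_pM => //.
    exact: le_trans (norm_coord _ _) thb'.
  by apply: le_trans (jf l (zz y) (zz y') s s4) _; rewrite ler_wpM2l.
have [_ b1] := HL J' M M0 JM.
have E1 : 0 <= (C1 + m%:R * beta * Cf) * eta by rewrite mulr_ge0 ?addr_ge0 // ltW.
have [b2 _] := HL _ _ E1 JJ.
have e1 : C * M * `|y' - y| <= C * M * eta by rewrite ler_wpM2l // mulr_ge0.
have e2 : C * `|y' - y| <= C * eta by rewrite ler_wpM2l.
have -> : c * eta = C * M * eta + C * ((C1 + m%:R * beta * Cf) * eta) + C * eta.
  by rewrite /c; ring.
apply: le_trans (ler_normB _ _) _; rewrite !addrA; apply: lerD; last exact: le_trans e2.
apply: le_trans (ler_normB _ _) _; apply: lerD => //.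
by apply: le_trans (ler_normB _ _) _; apply: lerD => //; exact: le_trans e1.
Qed.

Definition avoiding (V : set 'rV[R]_k) : set (Cb R n 4) :=
  [set psi | exists2 eps : R, 0 < eps & forall y, V y -> eps <= `|sys psi y|].

(** The lower bound eps is uniform over V, so half of it survives any perturbation of psi that moves
    the system by at most eps / 2. *)
Lemma avoiding_open y0 (V : set 'rV[R]_k) : (forall y, V y -> `|y - y0| <= 1) -> open (avoiding V).
Proof.
move=> V1; have [C C0 HC] := sys_bounds y0.
rewrite openE => psi [eps eps0 Hpsi].
have e0 : 0 < eps / 2 / (C + 1) by rewrite !divr_gt0 // ltr_wpDl.
have := nbhs_dist psi e0; apply: filterS => psi' /= psid.
exists (eps / 2) => [|y Vy]; first by rewrite divr_gt0.
have [H _] := HC y y (V1 y Vy) (V1 y Vy).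
have [a _] := H _ _ (normr_ge0 _) (jetC_bound (zz y) (psi' - psi)).
have E : sys psi' y - sys psi y = Lam (jetC (zz y) (psi' - psi)) y.
  by rewrite jetCB LamB /sys /jetC opprD addrACA subrr addr0.
have b : `|sys psi' y - sys psi y| <= eps / 2.
  rewrite E; apply: le_trans a _; move: (ltW psid); rewrite ler_pdivlMr ?ltr_wpDl // mulrC.
  by apply: le_trans; rewrite ler_wpM2r // lerDl.
have := Hpsi y Vy; have := ler_normB (sys psi' y) (sys psi' y - sys psi y).
rewrite opprB addrCA subrr addr0; lra.
Qed.

(** Neither [regular_param] nor the radius of [local_avoidance] involves psi. Each regular y thus
    lies in a ball, from a fixed countable family, whose avoiding set is dense, and it suffices to
    belong to all those sets. *)
Lemma residual_avoidance : exists2 M : set (Cb R n 4), Gdelta_dense M &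
  forall psi y, M psi -> regular_param y -> sys psi y != 0.
Proof.
pose V (qj : 'rV[rat]_k * nat) := [set y : 'rV[R]_k | `|y - map_mx ratr qj.1| <= qj.2.+1%:R^-1].
(* Balls whose avoiding set fails to be dense contribute the whole space. *)
pose F i := if unpickle i is Some qj then
  if `[< dense (avoiding (V qj)) >] then avoiding (V qj) else setT else setT.
exists (\bigcap_i F i).
  exists F => // i; rewrite /F; case: unpickle => [qj|]; last by split; [exact: openT|exact: denseT].
  case: asboolP => [dV|_]; last by split; [exact: openT|exact: denseT].
  split=> //; apply: (@avoiding_open (map_mx ratr qj.1)) => y /= /le_trans; apply.
  by rewrite invf_le1 ?ltr0n // ler1n.
move=> psi y Mpsi reg; have [r r0 Hr] := local_avoidance reg.
(* A ball of radius 1 / (j + 1) <= r / 2 that contains y lies in the ball of radius r around y. *)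
pose j := Num.truncn (2 / r).
have jr : j.+1%:R^-1 <= r / 2.
  rewrite -[r / 2]invrK lef_pV2 ?posrE ?ltr0n // ?invr_gt0 ?divr_gt0 //.
  by rewrite invf_div; apply: ltW; exact: truncnS_gt.
have [i|q Hq] := @choice 'I_k rat (fun i q => `|y 0 i - ratr q| <= j.+1%:R^-1).
  have [|x] := @rat_in_itvoo R (y 0 i) (y 0 i + j.+1%:R^-1); first by rewrite ltrDl invr_gt0.
  rewrite in_itv /= => /andP[x1 x2]; exists x.
  by rewrite distrC ger0_norm ?subr_ge0 ?(ltW x1) // lerBlDl ltW.
pose qj := (\row_i q i : 'rV[rat]_k, j).
have Vy : V qj y.
  apply: norm_rV_le; first by rewrite invr_ge0.
  by move=> i; rewrite !mxE; exact: Hq.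
have dV : dense (avoiding (V qj)).
  move=> O [psi0 Opsi0] oO.
  have /nbhs_normP[d /= d0 Hd] : nbhs psi0 O by exact: open_nbhs_nbhs.
  have d20 : 0 < d / 2 by rewrite divr_gt0.
  have [psi2 psi2d [eps eps0 Heps]] := Hr psi0 (d / 2) d20.
  exists psi2; split.
    apply: Hd; rewrite /ball_/= distrC; apply: le_lt_trans psi2d _.
    by rewrite ltr_pdivrMr // ltr_pMr // ltr1n.
  exists eps => // y' Vy'; apply: Heps.
  have -> : y' - y = (y' - map_mx ratr qj.1) - (y - map_mx ratr qj.1) by rewrite opprB addrA subrK.
  apply: le_trans (ler_normB _ _) _; rewrite (splitr r); apply: lerD; exact: le_trans jr.
have := Mpsi (pickle qj) I; rewrite /F pickleK; case: asboolP => // _ [eps eps0 /(_ y Vy)].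
by move=> h; apply/eqP => s0; move: h; rewrite s0 normr0 leNgt eps0.
Qed.

End Residual.

Lemma Gdelta_denseI (T : topologicalType) (K : countType) (M : K -> set T) :
  (forall i, Gdelta_dense (M i)) -> Gdelta_dense (\bigcap_i M i).
Proof.
move=> H.
have [|F HF] := @choice K (nat -> set T)
    (fun i F => (forall j, open (F j) /\ dense (F j)) /\ M i = \bigcap_j F j).
  by move=> i; have [F oF ->] := H i; exists F.
exists (fun j => if unpickle j is Some ij then F (ij.1 : K) (ij.2 : nat) else setT).
  move=> j; case: unpickle => [[i l]|] /=; first exact: (HF i).1.
  by split; [exact: openT|exact: denseT].
rewrite eqEsubset; split=> x /= Hx.
  move=> j _ /=; case: unpickle => [[i l]|] //=.
  by have := Hx i I; rewrite (HF i).2; exact.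
move=> i _; rewrite (HF i).2 => l _.
by have := Hx (pickle (i, l)) I; rewrite pickleK.
Qed.

(** * The degeneracy systems *)

Section Contractions.
Context {R : realType} {n : nat}.
Implicit Types (J : seq 'I_n -> R) (u v w x : 'rV[R]_n).
Notation e_ i := (delta_mx 0 i : 'rV[R]_n).

(** Contractions with the last slot left free: if J is the jet of f at z, then [D3 J u v] is the row
    vector D^3 f(z)(u, v, .), and likewise for the others. *)
Definition D1 J : 'rV[R]_n := \row_l J [:: l].
Definition D2 J u : 'rV[R]_n := \row_l \sum_i u 0 i * J [:: i; l].
Definition D3 J u v : 'rV[R]_n := \row_l \sum_i u 0 i * \sum_j v 0 j * J [:: i; j; l].
Definition D4 J u v w : 'rV[R]_n :=
  \row_l \sum_i u 0 i * \sum_j v 0 j * \sum_h w 0 h * J [:: i; j; h; l].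

Lemma D2_hessian f z u : D2 (jet f z) u = u *m hessian f z.
Proof. by apply/rowP => l; rewrite !mxE; apply: eq_bigr => i _; rewrite mxE. Qed.

Lemma D2Z J a u : D2 J (a *: u) = a *: D2 J u.
Proof.
by apply/rowP => l; rewrite !mxE mulr_sumr; apply: eq_bigr => i _; rewrite mxE mulrA.
Qed.

Lemma D3Zl J a u v : D3 J (a *: u) v = a *: D3 J u v.
Proof.
by apply/rowP => l; rewrite !mxE mulr_sumr; apply: eq_bigr => i _; rewrite mxE mulrA.
Qed.

Lemma D3Zr J a u v : D3 J u (a *: v) = a *: D3 J u v.
Proof.
apply/rowP => l; rewrite !mxE mulr_sumr; apply: eq_bigr => i _.
rewrite mulrCA; congr (_ * _); rewrite mulr_sumr; apply: eq_bigr => j _.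
by rewrite mxE mulrA.
Qed.

Lemma D4Z J a u : D4 J (a *: u) (a *: u) (a *: u) = a ^+ 3 *: D4 J u u u.
Proof.
apply/rowP => l; rewrite !mxE mulr_sumr; apply: eq_bigr => i _.
rewrite mxE !mulr_sumr; apply: eq_bigr => j _; rewrite mxE !mulr_sumr.
by apply: eq_bigr => h _; rewrite mxE; ring.
Qed.

Context {k : nat}.
Variable y0 : 'rV[R]_k.
Implicit Types U V W : 'rV[R]_k -> 'rV[R]_n.

Definition lipv m (U : 'rV[R]_k -> 'rV[R]_m) := forall i, lipf y0 (fun y => U y 0 i).

Lemma jform_D1 l : jform y0 (fun J _ => D1 J 0 l).
Proof.
have := @jform_proj R n k y0 [:: l] isT.
by congr jform; apply/funext => J; apply/funext => y; rewrite mxE.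
Qed.

Lemma jform_D2 U l : lipv U -> jform y0 (fun J y => D2 J (U y) 0 l).
Proof.
move=> HU; have : jform y0 (fun (J : seq 'I_n -> R) y => \sum_i U y 0 i * J [:: i; l]).
  by apply: jform_sum => i; apply: jformM; [exact: HU|exact: jform_proj].
by congr jform; apply/funext => J; apply/funext => y; rewrite mxE.
Qed.

Lemma jform_D3 U V l : lipv U -> lipv V -> jform y0 (fun J y => D3 J (U y) (V y) 0 l).
Proof.
move=> HU HV; have : jform y0 (fun (J : seq 'I_n -> R) y =>
    \sum_i U y 0 i * \sum_j V y 0 j * J [:: i; j; l]).
  apply: jform_sum => i; apply: jformM; first exact: HU.
  by apply: jform_sum => j; apply: jformM; [exact: HV|exact: jform_proj].
by congr jform; apply/funext => J; apply/funext => y; rewrite mxE.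
Qed.

Lemma jform_D4 U V W l : lipv U -> lipv V -> lipv W ->
  jform y0 (fun J y => D4 J (U y) (V y) (W y) 0 l).
Proof.
move=> HU HV HW; have : jform y0 (fun (J : seq 'I_n -> R) y =>
    \sum_i U y 0 i * \sum_j V y 0 j * \sum_h W y 0 h * J [:: i; j; h; l]).
  apply: jform_sum => i; apply: jformM; first exact: HU.
  apply: jform_sum => j; apply: jformM; first exact: HV.
  by apply: jform_sum => h; apply: jformM; [exact: HW|exact: jform_proj].
by congr jform; apply/funext => J; apply/funext => y; rewrite mxE.
Qed.

Lemma jformZ (a : R) F : jform y0 F -> jform y0 (fun (J : seq 'I_n -> R) y => a * F J y).
Proof. by move=> HF; apply: jformM HF; exact: lipf_cst. Qed.

Variable f : 'rV[R]_n -> R.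
Hypothesis f5 : Ck 5 f.

(** Jets have order at most 4, so five derivatives of f make them locally Lipschitz. *)
Lemma lipf_jet (om : 'rV[R]_k -> 'rV[R]_n) s : (forall y y', `|om y' - om y| <= `|y' - y|) ->
  lipf y0 (fun y => jet f (om y) s).
Proof.
move=> omL; rewrite /jet; have [s4|s4] := leqP (size s) 4; last exact: lipf_cst.
have f1 : Ck 1 (pderiv s f) by apply: Ck_pderiv; apply: Ck_le f5.
have [A A0 HA] := cont_bounded_ball (om y0) 1 (Ck_cont f1).
have [B B0 HB] := Ck1_locally_lipschitz (om y0) 1 f1.
exists (A + B); first exact: addr_ge0.
move=> y y' hy hy'; have oy := le_trans (omL y0 y) hy; have oy' := le_trans (omL y0 y') hy'.
split; first by apply: le_trans (HA _ oy) _; rewrite lerDl.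
apply: le_trans (HB _ _ oy oy') _; apply: ler_pM => //; first by rewrite lerDr.
Qed.

Lemma lipv_D1 (om : 'rV[R]_k -> 'rV[R]_n) : (forall y y', `|om y' - om y| <= `|y' - y|) ->
  lipv (fun y => D1 (jet f (om y))).
Proof.
move=> omL l; have := lipf_jet [:: l] omL; congr lipf.
by apply/funext => y; rewrite mxE.
Qed.

Lemma lipv_D2 (om : 'rV[R]_k -> 'rV[R]_n) U : (forall y y', `|om y' - om y| <= `|y' - y|) ->
  lipv U -> lipv (fun y => D2 (jet f (om y)) (U y)).
Proof.
move=> omL HU l; have : lipf y0 (fun y => \sum_i U y 0 i * jet f (om y) [:: i; l]).
  by apply: lipf_sum => i; apply: lipfM; [exact: HU|exact: lipf_jet].
by congr lipf; apply/funext => y; rewrite mxE.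
Qed.

Lemma lipv_D3 (om : 'rV[R]_k -> 'rV[R]_n) U V : (forall y y', `|om y' - om y| <= `|y' - y|) ->
  lipv U -> lipv V -> lipv (fun y => D3 (jet f (om y)) (U y) (V y)).
Proof.
move=> omL HU HV l; have : lipf y0 (fun y => \sum_i U y 0 i * \sum_j V y 0 j * jet f (om y) [:: i; j; l]).
  apply: lipf_sum => i; apply: lipfM; first exact: HU.
  by apply: lipf_sum => j; apply: lipfM; [exact: HV|exact: lipf_jet].
by congr lipf; apply/funext => y; rewrite mxE.
Qed.

Lemma lipv_D4 (om : 'rV[R]_k -> 'rV[R]_n) U V W : (forall y y', `|om y' - om y| <= `|y' - y|) ->
  lipv U -> lipv V -> lipv W -> lipv (fun y => D4 (jet f (om y)) (U y) (V y) (W y)).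
Proof.
move=> omL HU HV HW l; have : lipf y0 (fun y =>
    \sum_i U y 0 i * \sum_j V y 0 j * \sum_h W y 0 h * jet f (om y) [:: i; j; h; l]).
  apply: lipf_sum => i; apply: lipfM; first exact: HU.
  apply: lipf_sum => j; apply: lipfM; first exact: HV.
  by apply: lipf_sum => h; apply: lipfM; [exact: HW|exact: lipf_jet].
by congr lipf; apply/funext => y; rewrite mxE.
Qed.

Lemma lipvD m (U V : 'rV[R]_k -> 'rV[R]_m) : lipv U -> lipv V -> lipv (fun y => U y + V y).
Proof.
move=> HU HV l; have := lipfD (HU l) (HV l).
by congr lipf; apply/funext => y; rewrite mxE.
Qed.

Lemma lipvZ m (a : R) (U : 'rV[R]_k -> 'rV[R]_m) : lipv U -> lipv (fun y => a *: U y).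
Proof.
move=> HU l; have := lipfM (lipf_cst y0 a) (HU l).
by congr lipf; apply/funext => y; rewrite mxE.
Qed.

(* Coercivity of [A y] makes the solution [c] of [c A = xi] locally Lipschitz. *)
Lemma lipv_solve (A : 'rV[R]_k -> 'M[R]_n) (xi : 'rV[R]_k -> 'rV[R]_n) (K : R) : 0 <= K ->
  (forall y (u : 'rV[R]_n), `|u| <= K * `|u *m A y|) -> (forall y, A y \in unitmx) ->
  (forall i j, lipf y0 (fun y => A y i j)) -> lipv xi ->
  lipv (fun y => xi y *m invmx (A y)).
Proof.
move=> K0 HK Au HA Hxi l.
have [X HX] := choice (fun i => let: ex_intro2 C C0 HC := Hxi i in
  ex_intro (fun C => 0 <= C /\ forall y y', `|y - y0| <= 1 -> `|y' - y0| <= 1 ->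
    `|xi y 0 i| <= C /\ `|xi y' 0 i - xi y 0 i| <= C * `|y' - y|) C (conj C0 HC)).
have [Y HY] := choice (fun ij : 'I_n * 'I_n => let: ex_intro2 C C0 HC := HA ij.1 ij.2 in
  ex_intro (fun C => 0 <= C /\ forall y y', `|y - y0| <= 1 -> `|y' - y0| <= 1 ->
    `|A y ij.1 ij.2| <= C /\ `|A y' ij.1 ij.2 - A y ij.1 ij.2| <= C * `|y' - y|) C (conj C0 HC)).
pose SX := \sum_i X i; pose SY := \sum_ij Y ij.
have X0 i : 0 <= X i by have [] := HX i.
have Y0 ij : 0 <= Y ij by have [] := HY ij.
have SX0 : 0 <= SX by apply: sumr_ge0.
have SY0 : 0 <= SY by apply: sumr_ge0.
have XS i : X i <= SX by rewrite /SX (bigD1 i) //= lerDl sumr_ge0.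
have YS ij : Y ij <= SY by rewrite /SY (bigD1 ij) //= lerDl sumr_ge0.
have cb y : `|y - y0| <= 1 -> `|xi y *m invmx (A y)| <= K * SX.
  move=> hy; apply: le_trans (HK y _) _; rewrite mulmxKV // ler_wpM2l //.
  apply: norm_rV_le => // i; have [_ /(_ y y hy hy)[h _]] := HX i.
  exact: le_trans h (XS i).
exists (K * SX + K * (SX + n%:R * (K * SX * SY))).
  by rewrite addr_ge0 ?mulr_ge0 ?addr_ge0 ?mulr_ge0.
move=> y y' hy hy'; split.
  apply: le_trans (norm_coord _ _) _; apply: le_trans (cb y hy) _.
  by rewrite lerDl mulr_ge0 ?addr_ge0 ?mulr_ge0.
set c := fun y => xi y *m invmx (A y).
have -> : c y' 0 l - c y 0 l = (c y' - c y) 0 l by rewrite !mxE.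
apply: le_trans (norm_coord _ _) _; apply: le_trans (HK y' _) _.
have -> : (c y' - c y) *m A y' = (xi y' - xi y) - c y *m (A y' - A y).
  by rewrite mulmxBl mulmxBr /c !mulmxKV // opprB addrA subrK.
rewrite mulrDl -[leLHS]add0r; apply: lerD; first by rewrite !mulr_ge0.
rewrite -mulrA ler_wpM2l // mulrDl; apply: le_trans (ler_normB _ _) _; apply: lerD.
  apply: norm_rV_le => [|i]; first by rewrite mulr_ge0.
  have [_ /(_ y y' hy hy')[_ h]] := HX i.
  by rewrite !mxE; apply: le_trans h _; rewrite ler_wpM2r.
apply: norm_rV_le => [|i]; first by rewrite !mulr_ge0.
rewrite mxE; apply: le_trans (ler_norm_sum _ _ _) _.
have -> : n%:R * (K * SX * SY) * `|y' - y| = \sum_(j < n) K * SX * (SY * `|y' - y|).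
  by rewrite sumr_const card_ord -[RHS]mulr_natl !mulrA.
apply: ler_sum => j _; rewrite normrM; apply: ler_pM => //.
  exact: le_trans (norm_coord _ _) (cb y hy).
have [_ /(_ y y' hy hy')[_ h]] := HY (j, i).
by rewrite !mxE; apply: le_trans h _; rewrite ler_wpM2r.
Qed.

End Contractions.

Section UniformConvexity.
Context {R : realType} {n : nat}.
Implicit Types (u : 'rV[R]_n).

Lemma dotv_ge u : `|u| ^+ 2 <= dotv u u.
Proof.
have [->|u0] := eqVneq `|u| 0.
  by rewrite expr0n /=; apply: sumr_ge0 => i _; rewrite -expr2 sqr_ge0.
have [[i j] /= E] := mx_norm_neq0 u0.
have -> : `|u| = `|u 0 j| by move: E; rewrite (ord1 i).
rewrite real_normK ?num_real // /dotv (bigD1 j) //= -expr2 lerDl.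
by apply: sumr_ge0 => h _; rewrite -expr2 sqr_ge0.
Qed.

Lemma dotv_le u (v : 'rV[R]_n) : dotv u v <= n%:R * (`|u| * `|v|).
Proof.
apply: le_trans (ler_norm _) _; apply: le_trans (ler_norm_sum _ _ _) _.
have -> : n%:R * (`|u| * `|v|) = \sum_(i < n) `|u| * `|v|.
  by rewrite sumr_const card_ord mulr_natl.
by apply: ler_sum => i _; rewrite normrM; apply: ler_pM => //; exact: norm_coord.
Qed.

Lemma dotv_eq0 u : dotv u u = 0 -> u = 0.
Proof.
move=> E; apply/eqP; rewrite -normr_eq0 -sqrf_eq0 eq_le sqr_ge0 andbT -E.
exact: dotv_ge.
Qed.

Lemma hessian_coercive (L : 'rV[R]_n -> R) : uniformly_convex L ->
  exists2 d : R, 0 < d & forall om u, d * dotv u u <= dotv (u *m hessian L om) u.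
Proof.
move=> [d d0 H]; exists d => // om u; have := H om u.
rewrite mulmxBr mul_mx_scalar.
rewrite (_ : u *m hessian L om - d *: u = u *m hessian L om + (- d) *: u); last by rewrite scaleNr.
by rewrite dotvDl dotvZl mulNr subr_ge0.
Qed.

(** K is uniform in om: coercivity gives d |u|^2 <= (D^2 L u) . u, and the sup norms cost a factor
    n. *)
Lemma hessian_lower (L : 'rV[R]_n -> R) : uniformly_convex L ->
  exists2 K : R, 0 <= K & forall om u, `|u| <= K * `|u *m hessian L om|.
Proof.
move=> /hessian_coercive[d d0 H]; exists (n%:R / d); first by rewrite divr_ge0 // ltW.
move=> om u; have [->|u0] := eqVneq u 0; first by rewrite mul0mx normr0 mulr0.
have un : 0 < `|u| by rewrite normr_gt0.
have := le_trans (H om u) (dotv_le _ _).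
have := ler_wpM2l (ltW d0) (dotv_ge u) => h1 /(le_trans h1).
rewrite expr2 !mulrA ler_pM2r // mulrC => h2.
by rewrite mulrAC ler_pdivlMr.
Qed.

Lemma hessian_unit (L : 'rV[R]_n -> R) om : uniformly_convex L -> hessian L om \in unitmx.
Proof.
move=> /hessian_lower[K K0 H]; rewrite -row_free_unit -kermx_eq0.
apply/rowV0P => u /sub_kermxP E; apply/eqP; rewrite -normr_le0.
by have := H om u; rewrite E normr0 mulr0.
Qed.

End UniformConvexity.

(** * Jets of sine waves *)

Section RidgeJets.
Context {R : realType} {n : nat}.
Implicit Types (kap : 'rV[R]_n).

(** The p-th derivative of the sine, written as a phase shift to treat all orders alike. *)
Definition wave (p : nat) (t : R) : R := sin (t + p%:R * (pi / 2)).

Lemma waveSS p t : wave p.+2 t = - wave p t.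
Proof.
rewrite /wave; have -> : t + p.+2%:R * (pi / 2) = t + p%:R * (pi / 2) + pi.
  by rewrite -addn2 natrD; field.
by rewrite sinDpi.
Qed.

Lemma derive_wave p (t : R) : is_derive t 1 (wave p) (wave p.+1 t).
Proof.
have E : wave p.+1 t = cos (t + p%:R * (pi / 2)).
  rewrite /wave; have -> : t + p.+1%:R * (pi / 2) = t + p%:R * (pi / 2) + pi / 2.
    by rewrite -natr1; ring.
  by rewrite sinDpihalf.
have [d1 d2] := is_derive_sin (t + p%:R * (pi / 2)).
have [T1 T2] := @derive_transport R R R R sin (wave p) (t + p%:R * (pi / 2)) 1 t 1
  (fun h => congr1 sin (addrA _ _ _)).
by rewrite E; split; [exact: T1|rewrite -T2].
Qed.

Lemma cont_wave p : continuous (wave p).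
Proof.
move=> t; apply: differentiable_continuous; apply/derivable1_diffP.
by have [] := derive_wave p t.
Qed.

Lemma nice_of_Ckb5 (f : 'rV[R]_n -> R) : Ckb 5 f -> nice f.
Proof.
move=> Hf; have [C5 _] := Hf; split.
  split; first exact: Ck_le C5.
  by move=> s s4; apply: Hf.2; exact: leqW.
exists (n%:R * Ck_norm 5 f).
  by rewrite mulr_ge0 //; apply: le_trans (Ck_norm_ub 0 Hf (leq0n 5 : size [::] <= 5)%N).
move=> s x x' s4.
have f1 : Ck 1 (pderiv s f) by apply: Ck_pderiv; apply: Ck_le C5.
apply: (@Ck1_lipschitz_ball _ _ _ x `|x' - x| _ f1); last 2 first.
- by rewrite subrr normr0.
- exact: lexx.
- by apply: le_trans (Ck_norm_ub 0 Hf (leq0n 5 : size [::] <= 5)%N).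
- move=> i z _; exact: (Ck_norm_ub z Hf (s4 : size (i :: s) <= 5)%N).
Qed.

Lemma nice_wave kap c : nice (ridge kap c (wave 0)).
Proof.
have [C5 E] := @pderiv_ridge R n kap c 5 wave (fun p t _ => derive_wave p t) (fun p _ => @cont_wave p).
apply: nice_of_Ckb5; split=> // s s5; apply/Defs.bounded_funP.
exists `|\prod_(i <- s) kap 0 i| => x; rewrite E //.
change (`|\prod_(i <- s) kap 0 i * sin (dotv kap x + c + (size s)%:R * (pi / 2))| <= `|\prod_(i <- s) kap 0 i|).
rewrite normrM ler_piMr // ler_norml; by rewrite sin_geN1 sin_le1.
Qed.

Lemma jet_wave kap c z s : (size s <= 4)%N ->
  jet (ridge kap c (wave 0)) z s = (\prod_(i <- s) kap 0 i) * wave (size s) (dotv kap z + c).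
Proof.
move=> s4; rewrite /jet s4.
have [_ E] := @pderiv_ridge R n kap c 4 wave (fun p t _ => derive_wave p t) (fun p _ => @cont_wave p).
by rewrite E.
Qed.

Variables (kap : 'rV[R]_n) (c : R) (z : 'rV[R]_n).
Let J := jet (ridge kap c (wave 0)) z.
Let e p := wave p (dotv kap z + c).

(** Contractions of the jet of a wave are multiples of kap whose degree in kap is the order of the
    derivative; the separation by homogeneity relies on this. *)
Lemma D1_wave : D1 J = e 1 *: kap.
Proof. by apply/rowP => l; rewrite !mxE /J jet_wave // big_seq1 mulrC. Qed.

Lemma D2_wave u : D2 J u = (e 2 * dotv kap u) *: kap.
Proof.
apply/rowP => l; rewrite !mxE mulr_sumr mulr_suml; apply: eq_bigr => i _.
by rewrite /J jet_wave // !big_cons big_nil /= /e; ring.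
Qed.

Let pull (a : R) (F : 'I_n -> R) (u : 'rV[R]_n) : (forall i, F i = a * (kap 0 i * u 0 i)) ->
  \sum_i F i = a * dotv kap u.
Proof. by move=> H; rewrite mulr_sumr; apply: eq_bigr. Qed.

Lemma D3_wave u v : D3 J u v = (e 3 * dotv kap u * dotv kap v) *: kap.
Proof.
apply/rowP => l; rewrite !mxE (@pull (e 3 * dotv kap v * kap 0 l) _ u); first by ring.
move=> i; rewrite (@pull (e 3 * kap 0 i * kap 0 l) _ v); first by ring.
by move=> j; rewrite /J jet_wave // !big_cons big_nil /= /e; ring.
Qed.

Lemma D4_wave u v w : D4 J u v w = (e 4 * dotv kap u * dotv kap v * dotv kap w) *: kap.
Proof.
apply/rowP => l; rewrite !mxE (@pull (e 4 * dotv kap v * dotv kap w * kap 0 l) _ u); first by ring.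
move=> i; rewrite (@pull (e 4 * dotv kap w * kap 0 i * kap 0 l) _ v); first by ring.
move=> j; rewrite (@pull (e 4 * kap 0 i * kap 0 j * kap 0 l) _ w); first by ring.
by move=> h; rewrite /J jet_wave // !big_cons big_nil /= /e; ring.
Qed.

End RidgeJets.

(** * Separation by homogeneity, and products of linear forms *)

Section Separation.
Context {R : realType} {n : nat}.

(* [X1], ..., [X4] are homogeneous of degrees [1], ..., [4]: comparing [kap] with
   [2 *: kap] and two phases separates them. *)
Lemma wave_separation (X1 X2 X3 X4 : 'rV[R]_n -> R) z :
  (forall kap, X1 (2 *: kap) = 2 * X1 kap) -> (forall kap, X2 (2 *: kap) = 4 * X2 kap) ->
  (forall kap, X3 (2 *: kap) = 8 * X3 kap) -> (forall kap, X4 (2 *: kap) = 16 * X4 kap) ->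
  (forall kap c, wave 1 (dotv kap z + c) * X1 kap + wave 2 (dotv kap z + c) * X2 kap +
    wave 3 (dotv kap z + c) * X3 kap + wave 4 (dotv kap z + c) * X4 kap = 0) ->
  forall kap, [/\ X1 kap = 0, X2 kap = 0, X3 kap = 0 & X4 kap = 0].
Proof.
move=> h1 h2 h3 h4 H.
have w1 : wave 1 0 = 1 :> R by rewrite /wave add0r mul1r sin_pihalf.
have w2 : wave 2 0 = 0 :> R by rewrite waveSS /wave mul0r addr0 sin0 oppr0.
(* At phase 0 the waves of orders 1 to 4 take the values 1, 0, -1, 0, and at phase pi/2 the values
   0, -1, 0, 1. *)
have P0 kap : X1 kap - X3 kap = 0.
  have := H kap (- dotv kap z); rewrite subrr !waveSS w1 -[wave 0 0]opprK -waveSS w2.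
  by move=> <-; ring.
have P1 kap : - X2 kap + X4 kap = 0.
  have := H kap (pi / 2 - dotv kap z); rewrite addrCA subrr addr0.
  have s p : wave p (pi / 2) = wave p.+1 0 :> R.
    by rewrite /wave -natr1; congr sin; ring.
  rewrite !s !waveSS w1 -[wave 0 0]opprK -waveSS w2.
  by move=> <-; ring.
move=> kap; have := P0 kap; have := P0 (2 *: kap); have := P1 kap; have := P1 (2 *: kap).
rewrite h1 h2 h3 h4; split; lra.
Qed.

(** The vector is sought on the moment curve (1, t, t^2, ...). Its product with each u is a nonzero
    polynomial in t, and the product Q of these cannot vanish at as many integers as its size. *)
Lemma nonorthogonal (us : seq 'rV[R]_n) : (forall u, u \in us -> u != 0) ->
  exists kap : 'rV[R]_n, forall u, u \in us -> dotv kap u != 0.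
Proof.
move=> us0; pose P (u : 'rV[R]_n) := \poly_(i < n) (if insub i is Some j then u 0 j else 0) : {poly R}.
have PE (u : 'rV[R]_n) t : (P u).[t] = dotv (\row_i t ^+ i) u.
  rewrite horner_poly; apply: eq_bigr => i _.
  by rewrite valK mxE mulrC.
have Pn u : u \in us -> P u != 0.
  move=> uus; apply: contra (us0 u uus) => /eqP E; apply/eqP/rowP => j; rewrite mxE.
  by have := congr1 (fun p : {poly R} => p`_j) E; rewrite coef_poly ltn_ord valK coef0.
pose Q := \prod_(u <- us) P u.
have Qn : Q != 0 by rewrite /Q prodf_seq_neq0; apply/allP => u uus /=; exact: Pn.
have [t tQ] : exists t, Q.[t] != 0.
  apply: contrapT => nt.
  have := @max_poly_roots _ Q [seq i%:R | i <- iota 0 (size Q)] Qn.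
  rewrite size_map size_iota ltnn => H; have : false; last by [].
  apply: H.
    apply/allP => x _; apply/rootP; apply: contrapT => /eqP ne; apply: nt; by exists x.
  rewrite map_inj_uniq ?iota_uniq // => i j /eqP; rewrite eqr_nat => /eqP //.
exists (\row_i t ^+ i) => u uus; rewrite -PE; apply: contra tQ => /eqP E.
by rewrite /Q horner_prod (big_rem u) //= E mul0r.
Qed.

End Separation.

Section LinearFormProducts.
Context {R : realType}.

(** If both vectors were nonzero, some kap would be orthogonal to neither of them. *)
Lemma prod_nonzero q (u v : 'rV[R]_q) : (forall kap : 'rV[R]_q, dotv kap u * dotv kap v = 0) ->
  u != 0 -> v = 0.
Proof.
move=> H u0; apply: contrapT => /eqP v0.
have [|kap Hk] := @nonorthogonal R q [:: u; v].
  by move=> w; rewrite !inE => /orP[/eqP ->|/eqP ->].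
have := H kap; move/eqP; rewrite mulf_eq0 => /orP[]; apply/negP; apply: Hk; rewrite !inE eqxx ?orbT //.
Qed.

Lemma prod_nonzero3 q (u v w : 'rV[R]_q) :
  (forall kap : 'rV[R]_q, dotv kap u * dotv kap v * dotv kap w = 0) -> u != 0 -> v != 0 -> w = 0.
Proof.
move=> H u0 v0; apply: contrapT => /eqP w0.
have [|kap Hk] := @nonorthogonal R q [:: u; v; w].
  by move=> x; rewrite !inE => /or3P[/eqP ->|/eqP ->|/eqP ->].
have := H kap; move/eqP; rewrite !mulf_eq0 => /orP[/orP[]|]; apply/negP; apply: Hk;
  rewrite !inE eqxx ?orbT //.
Qed.

End LinearFormProducts.

Section Blocks.
Context {R : realType}.

Lemma dotv_row_mx p q (a c : 'rV[R]_p) (b d : 'rV[R]_q) :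
  dotv (row_mx a b) (row_mx c d) = dotv a c + dotv b d.
Proof.
rewrite /dotv big_split_ord /=; congr (_ + _); apply: eq_bigr => i _.
  by rewrite !row_mxEl.
by rewrite !row_mxEr.
Qed.

Lemma lsubmx_norm p q (u : 'rV[R]_(p + q)) : `|lsubmx u| <= `|u|.
Proof. by apply: norm_rV_le => // i; rewrite mxE; exact: norm_coord. Qed.

Lemma rsubmx_norm p q (u : 'rV[R]_(p + q)) : `|rsubmx u| <= `|u|.
Proof. by apply: norm_rV_le => // i; rewrite mxE; exact: norm_coord. Qed.

Lemma dotv0r p (u : 'rV[R]_p) : dotv u 0 = 0.
Proof. by rewrite /dotv big1 // => i _; rewrite mxE mulr0. Qed.

Lemma dotv0l p (u : 'rV[R]_p) : dotv 0 u = 0.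
Proof. by rewrite /dotv big1 // => i _; rewrite mxE mul0r. Qed.

(** Inverse to the deletion of a coordinate. With b = 1 it parametrises the normalised v and a; with
    b = 0 it extends a multiplier to an equation that was dropped. *)
Definition ins p (i : 'I_p.+1) (w : 'rV[R]_p) (b : R) : 'rV[R]_p.+1 :=
  \row_j (if unlift i j is Some h then w 0 h else b).

Lemma ins_at p (i : 'I_p.+1) w b : ins i w b 0 i = b.
Proof. by rewrite mxE unlift_none. Qed.

Lemma ins_lift p (i : 'I_p.+1) w b h : ins i w b 0 (lift i h) = w 0 h.
Proof. by rewrite mxE liftK. Qed.

Lemma ins_col' p (i : 'I_p.+1) (v : 'rV[R]_p.+1) : ins i (col' i v) (v 0 i) = v.
Proof.
apply/rowP => j; case: (unliftP i j) => [h ->|->]; last by rewrite ins_at.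
by rewrite ins_lift mxE.
Qed.

Lemma dotv_ins p (i : 'I_p.+1) w b (x : 'rV[R]_p.+1) :
  dotv (ins i w b) x = b * x 0 i + dotv w (col' i x).
Proof.
rewrite /dotv (bigD1_ord i) //= ins_at; congr (_ + _); apply: eq_bigr => h _.
by rewrite ins_lift mxE.
Qed.

Context {n k : nat}.
Variable y0 : 'rV[R]_k.

Definition jformv m (F : (seq 'I_n -> R) -> 'rV[R]_k -> 'rV[R]_m) :=
  forall l, jform y0 (fun J y => F J y 0 l).

Lemma jformvD m F G : jformv F -> jformv G -> @jformv m (fun J y => F J y + G J y).
Proof.
move=> HF HG l; have := jformD (HF l) (HG l).
by congr jform; apply/funext => J; apply/funext => y; rewrite mxE.
Qed.

Lemma jformvZ m a F : jformv F -> @jformv m (fun J y => a *: F J y).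
Proof.
move=> HF l; have := jformZ a (HF l).
by congr jform; apply/funext => J; apply/funext => y; rewrite mxE.
Qed.

Lemma jformv_row_mx p q F G : jformv F -> jformv G -> @jformv (p + q) (fun J y => row_mx (F J y) (G J y)).
Proof.
move=> HF HG l; case: (split_ordP l) => i ->.
  have := HF i; congr jform; apply/funext => J; apply/funext => y; by rewrite row_mxEl.
have := HG i; congr jform; apply/funext => J; apply/funext => y; by rewrite row_mxEr.
Qed.

Lemma jformv_col' p (i : 'I_p.+1) F : jformv F -> @jformv p (fun J y => col' i (F J y)).
Proof.
move=> HF l; have := HF (lift i l).
by congr jform; apply/funext => J; apply/funext => y; rewrite mxE.
Qed.

Lemma lipv_row_mx p q (U : 'rV[R]_k -> 'rV[R]_p) (V : 'rV[R]_k -> 'rV[R]_q) :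
  lipv y0 U -> lipv y0 V -> lipv y0 (fun y => row_mx (U y) (V y)).
Proof.
move=> HU HV l; case: (split_ordP l) => i ->.
  have := HU i; congr lipf; apply/funext => y; by rewrite row_mxEl.
have := HV i; congr lipf; apply/funext => y; by rewrite row_mxEr.
Qed.

Lemma lipv_col' p (i : 'I_p.+1) (U : 'rV[R]_k -> 'rV[R]_p.+1) :
  lipv y0 U -> lipv y0 (fun y => col' i (U y)).
Proof.
move=> HU l; have := HU (lift i l).
by congr lipf; apply/funext => y; rewrite mxE.
Qed.

Lemma lipv_lsubmx p q (U : 'rV[R]_k -> 'rV[R]_(p + q)) : lipv y0 U -> lipv y0 (fun y => lsubmx (U y)).
Proof.
move=> HU l; have := HU (lshift q l).
by congr lipf; apply/funext => y; rewrite mxE.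
Qed.

Lemma lipv_rsubmx p q (U : 'rV[R]_k -> 'rV[R]_(p + q)) : lipv y0 U -> lipv y0 (fun y => rsubmx (U y)).
Proof.
move=> HU l; have := HU (rshift p l).
by congr lipf; apply/funext => y; rewrite mxE.
Qed.

Lemma lipv_id : lipv y0 (fun y => y).
Proof. by move=> l; exact: lipf_coord. Qed.

Lemma lipv0 m : @lipv R k y0 m (fun _ => 0).
Proof.
move=> l; have := lipf_cst y0 0; congr lipf; apply/funext => y; by rewrite mxE.
Qed.

Lemma lipv_ins p (i : 'I_p.+1) b (U : 'rV[R]_k -> 'rV[R]_p) : lipv y0 U -> lipv y0 (fun y => ins i (U y) b).
Proof.
move=> HU l; case: (unliftP i l) => [h ->|->].
  have := HU h; congr lipf; apply/funext => y; by rewrite ins_lift.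
have := lipf_cst y0 b; congr lipf; apply/funext => y; by rewrite ins_at.
Qed.

End Blocks.

(** * The equations for the multipliers (a, b) *)

Section DegeneracySystems.
Context {R : realType} {p : nat}.
Notation n := p.+1.
Variables (L : 'rV[R]_n -> R) (T : R).
Hypotheses (L5 : Ck 5 L) (L_convex : uniformly_convex L) (T_gt0 : 0 < T).
Implicit Types (psi : 'rV[R]_n -> R) (J : seq 'I_n -> R) (z om v a : 'rV[R]_n) (b : R).

(* The derivative of the velocity in [z] is known only through the derivative of
   [eq_costate]; pairing the latter with [adj om a b v] eliminates it. *)
Definition adj om a b v : 'rV[R]_n :=
  (D3 (jet L om) a v + (b / T ^+ 2) *: D4 (jet L om) v v v) *m invmx (hessian L om).

(** The parts linear in the jet of psi. For the combination of stationarity paired with a and of b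
    times degeneracy, [base_form] belongs to its derivative in z, where L acts through [adj], and
    [fibre_form] to its derivative in v; the factor 3 is that of a cubic form. *)
Definition stat_form J v := T *: D2 J v.
Definition base_form J om a b v := T *: D3 J a v + (b *: D4 J v v v + (-1) *: D2 J (adj om a b v)).
Definition fibre_form J a b v := T *: D2 J a + (3 * b) *: D3 J v v.

Definition eq_costate psi z om := D1 (jet psi z) + D1 (jet L om) = 0.
Definition eq_stat psi z om v := stat_form (jet psi z) v + D2 (jet L om) v = 0.
Definition eq_base psi z om a b v := base_form (jet psi z) om a b v = 0.
Definition eq_fibre psi z om a b v :=
  fibre_form (jet psi z) a b v + (D2 (jet L om) a + (3 * b / T ^+ 2) *: D3 (jet L om) v v) = 0.

(** Stationarity is linear in v and degeneracy cubic, so scaling v by s is compensated by the weight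
    s^2 of a relative to b, while t scales both multipliers. These weights permit the normalisations
    of v, a and b. *)
Lemma adj_scale om a b v (s t : R) :
  adj om ((t * s ^+ 2) *: a) (t * b) (s *: v) = (t * s ^+ 3) *: adj om a b v.
Proof.
rewrite /adj scalemxAl; congr (_ *m _); rewrite D3Zl D3Zr D4Z scalerA scalerDr.
by rewrite !scalerA; congr (_ *: _ + _ *: _); ring.
Qed.

Lemma base_scale J om a b v (s t : R) :
  base_form J om ((t * s ^+ 2) *: a) (t * b) (s *: v) = (t * s ^+ 3) *: base_form J om a b v.
Proof.
rewrite /base_form adj_scale D3Zl D3Zr D4Z D2Z !scalerDr !scalerA.
by congr (_ *: _ + (_ *: _ + _ *: _)); ring.
Qed.

Lemma stat_scale J J' v (s : R) :
  stat_form J (s *: v) + D2 J' (s *: v) = s *: (stat_form J v + D2 J' v).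
Proof. by rewrite /stat_form !D2Z scalerDr !scalerA [T * s]mulrC. Qed.

Lemma fibre_scale J J' a b v (s t : R) :
  fibre_form J ((t * s ^+ 2) *: a) (t * b) (s *: v) +
    (D2 J' ((t * s ^+ 2) *: a) + (3 * (t * b) / T ^+ 2) *: D3 J' (s *: v) (s *: v)) =
  (t * s ^+ 2) *: (fibre_form J a b v + (D2 J' a + (3 * b / T ^+ 2) *: D3 J' v v)).
Proof.
rewrite /fibre_form !D2Z !D3Zl !D3Zr !scalerDr !scalerA.
by congr (_ *: _ + _ *: _ + (_ + _ *: _)); ring.
Qed.

Section Regularity.
Context {k : nat}.
Variable y0 : 'rV[R]_k.
Variables (Om A V : 'rV[R]_k -> 'rV[R]_n).
Hypotheses (OmL : forall y y', `|Om y' - Om y| <= `|y' - y|) (AL : lipv y0 A) (VL : lipv y0 V).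

Lemma lipv_adj b : lipv y0 (fun y => adj (Om y) (A y) b (V y)).
Proof.
have [K K0 HK] := hessian_lower L_convex.
apply: (@lipv_solve R n k y0 (fun y => hessian L (Om y)) _ K K0) => //.
- by move=> y; exact: hessian_unit.
- move=> i j; have := @lipf_jet R n k y0 L L5 Om [:: i; j] OmL.
  by congr lipf; apply/funext => y; rewrite mxE.
- apply: lipvD; first exact: (lipv_D3 L5 OmL AL VL).
  by apply: lipvZ; exact: (lipv_D4 L5 OmL VL VL VL).
Qed.

Lemma jformv_base b : jformv y0 (fun J y => base_form J (Om y) (A y) b (V y)).
Proof.
apply: jformvD; first by apply: jformvZ => l; exact: jform_D3.
apply: jformvD; first by apply: jformvZ => l; exact: jform_D4.
by apply: jformvZ => l; apply: jform_D2; exact: lipv_adj.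
Qed.

Lemma jformv_fibre b : jformv y0 (fun J y => fibre_form J (A y) b (V y)).
Proof.
apply: jformvD; first by apply: jformvZ => l; exact: jform_D2.
by apply: jformvZ => l; exact: jform_D3.
Qed.

Lemma jformv_stat : jformv y0 (fun J y => stat_form J (V y)).
Proof. by apply: jformvZ => l; exact: jform_D2. Qed.

End Regularity.

(** Up to the phase factor, this is mu . D^2 f x for a wave f. *)
Let Mx (kap x mu : 'rV[R]_n) := dotv kap x * dotv kap mu.

Section Evaluation.
Variables (om a v z : 'rV[R]_n) (b : R) (m0 m1 m2 m3 : 'rV[R]_n).
Hypothesis H : forall f, nice f -> dotv m0 (D1 (jet f z)) + dotv m1 (stat_form (jet f z) v) +
  dotv m2 (base_form (jet f z) om a b v) + dotv m3 (fibre_form (jet f z) a b v) = 0.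

(** Testing the annihilator on all waves and sorting by degree in kap: degrees 1 to 4 collect the
    derivatives of the same order, the adjoint term being of degree 2. *)
Lemma evaluation kap : [/\ dotv kap m0 = 0,
  T * (Mx kap v m1) - Mx kap (adj om a b v) m2 + T * Mx kap a m3 = 0,
  T * (dotv kap a * dotv kap v * dotv kap m2) + 3 * b * (dotv kap v * dotv kap v * dotv kap m3) = 0 &
  b * (dotv kap v * dotv kap v * dotv kap v * dotv kap m2) = 0].
Proof.
apply: (@wave_separation R n (fun kap => dotv kap m0)
  (fun kap => T * (Mx kap v m1) - Mx kap (adj om a b v) m2 + T * Mx kap a m3)
  (fun kap => T * (dotv kap a * dotv kap v * dotv kap m2) + 3 * b * (dotv kap v * dotv kap v * dotv kap m3))
  (fun kap => b * (dotv kap v * dotv kap v * dotv kap v * dotv kap m2)) z) => [{}kap|{}kap|{}kap|{}kap|{}kap c].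
- by rewrite /= (@dotvZl R n).
- by rewrite /Mx !(@dotvZl R n); ring.
- by rewrite !(@dotvZl R n); ring.
- by rewrite !(@dotvZl R n); ring.
- rewrite -[RHS](H (nice_wave kap c)) /stat_form /base_form /fibre_form.
  rewrite D1_wave !D2_wave !D3_wave !D4_wave !dotvDr !dotvZr !(dotvC _ kap) /Mx; ring.
Qed.

End Evaluation.

(* [z], [om], [a] and the coordinates of [v] other than the normalised [v 0 i] are
   [4 n - 1] unknowns for [4 n] equations. *)
Theorem generic_no_base_multiplier (i : 'I_n) : exists2 M : set (Cb R n 4), Gdelta_dense M &
  forall (psi : Cb R n 4) z om v a, M psi -> v 0 i = 1 ->
  eq_costate psi z om -> eq_stat psi z om v -> eq_base psi z om a 1 v ->
  eq_fibre psi z om a 1 v -> False.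
Proof.
pose k := (n + (n + (p + n)))%N; pose m := (n + (n + (n + n)))%N.
pose zz (y : 'rV[R]_k) : 'rV[R]_n := lsubmx y.
pose Om (y : 'rV[R]_k) : 'rV[R]_n := lsubmx (rsubmx y).
pose V (y : 'rV[R]_k) : 'rV[R]_n := ins i (lsubmx (rsubmx (rsubmx y))) 1.
pose A (y : 'rV[R]_k) : 'rV[R]_n := rsubmx (rsubmx (rsubmx y)).
have zzL y y' : `|zz y' - zz y| <= `|y' - y| by rewrite -linearB; exact: lsubmx_norm.
have OmL y y' : `|Om y' - Om y| <= `|y' - y|.
  by rewrite -!linearB; apply: le_trans (lsubmx_norm _) (rsubmx_norm _).
have VL y0 : lipv y0 V by apply: lipv_ins; apply: lipv_lsubmx; do 2 apply: lipv_rsubmx; exact: lipv_id.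
have AL y0 : lipv y0 A by do 3 apply: lipv_rsubmx; exact: lipv_id.
pose Lam J (y : 'rV[R]_k) : 'rV[R]_m := row_mx (D1 J) (row_mx (stat_form J (V y))
  (row_mx (base_form J (Om y) (A y) 1 (V y)) (fibre_form J (A y) 1 (V y)))).
pose gg (y : 'rV[R]_k) : 'rV[R]_m := row_mx (D1 (jet L (Om y))) (row_mx (D2 (jet L (Om y)) (V y))
  (row_mx 0 (D2 (jet L (Om y)) (A y) + (3 * 1 / T ^+ 2) *: D3 (jet L (Om y)) (V y) (V y)))).
have LamJ y0 : jformv y0 Lam.
  apply: jformv_row_mx; first by move=> l; exact: jform_D1.
  apply: jformv_row_mx; first exact: jformv_stat.
  apply: jformv_row_mx; first exact: jformv_base.
  exact: jformv_fibre.
have ggL y0 : lipv y0 gg.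
  apply: lipv_row_mx; first exact: lipv_D1.
  apply: lipv_row_mx; first exact: lipv_D2.
  apply: lipv_row_mx; first exact: lipv0.
  by apply: lipvD; [exact: lipv_D2|apply: lipvZ; exact: lipv_D3].
have km : (k < m)%N by rewrite /k /m !ltn_add2l ltn_add2r.
have [M GM HM] := @residual_avoidance R n k m Lam gg zz LamJ ggL zzL km.
exists M => // psi z om v a Mpsi vi e0 e1 e3 e4.
pose y : 'rV[R]_k := row_mx z (row_mx om (row_mx (col' i v) a)).
have zE : zz y = z by rewrite /zz /y row_mxKl.
have omE : Om y = om by rewrite /Om /y row_mxKr row_mxKl.
have vE : V y = v by rewrite /V /y !row_mxKr row_mxKl -vi ins_col'.
have aE : A y = a by rewrite /A /y !row_mxKr.
have v0 : v != 0 by apply: contraTneq (oner_neq0 R) => v0; rewrite -vi v0 mxE eqxx.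
have /HM : M psi by []. move=> /(_ y); rewrite /sys /Lam /gg zE omE vE aE !add_row_mx.
rewrite e0 e1 e3 e4 addr0 !row_mx0 eqxx => Hreg.
suff /Hreg : regular_param Lam zz y by [].
move=> mu; rewrite /Lam zE omE vE aE.
rewrite -[mu]hsubmxK -[rsubmx mu]hsubmxK -[rsubmx (rsubmx mu)]hsubmxK.
move: (lsubmx mu) (lsubmx (rsubmx mu)) (lsubmx (rsubmx (rsubmx mu))) (rsubmx (rsubmx (rsubmx mu))).
move=> m0 m1 m2 m3 H.
have ev := @evaluation om a v z 1 m0 m1 m2 m3 _.
have {H}/ev{}ev f : nice f -> dotv m0 (D1 (jet f z)) + dotv m1 (stat_form (jet f z) v) +
  dotv m2 (base_form (jet f z) om a 1 v) + dotv m3 (fibre_form (jet f z) a 1 v) = 0.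
  by move=> /H; rewrite !dotv_row_mx !addrA.
(* From the top order down: D^4 eliminates m2, D^3 then m3, D^2 then m1, and D^1 m0. *)
have m2z : m2 = 0.
  apply: prod_nonzero v0 => kap; have [_ _ _ /eqP] := ev kap.
  rewrite mul1r !mulf_eq0 => /orP[/orP[/orP[]|]|] /eqP ->; by rewrite ?mul0r ?mulr0.
have m3z : m3 = 0.
  apply: prod_nonzero v0 => kap; have [_ _ + _] := ev kap.
  rewrite m2z dotv0r mulr0 mulr0 add0r mulr1 => /eqP.
  by rewrite !mulf_eq0 pnatr_eq0 /= => /orP[/orP[]|] /eqP ->; rewrite ?mul0r ?mulr0.
have m1z : m1 = 0.
  apply: prod_nonzero v0 => kap; have [_ + _ _] := ev kap.
  rewrite m2z m3z /Mx !dotv0r !mulr0 subr0 addr0 => /eqP.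
  by rewrite mulf_eq0 gt_eqF //= => /eqP.
have m0z : m0 = 0 by apply: dotv_eq0; have [] := ev m0.
by rewrite m0z m1z m2z m3z !row_mx0.
Qed.

(* Both [v] and [a] are normalised, and the [i]-th fibre equation is not used:
   [4 n - 2] unknowns for [4 n - 1] equations.  That equation has to be dropped
   because its pairing with [v] already follows from stationarity, by symmetry of the Hessians. *)
Theorem generic_no_transverse_multiplier (i i' : 'I_n) : exists2 M : set (Cb R n 4), Gdelta_dense M &
  forall (psi : Cb R n 4) z om v a, M psi -> v 0 i = 1 -> a 0 i' = 1 -> a <> a 0 i *: v ->
  eq_costate psi z om -> eq_stat psi z om v -> eq_base psi z om a 0 v ->
  eq_fibre psi z om a 0 v -> False.
Proof.
pose k := (n + (n + (p + p)))%N; pose m := (n + (n + (n + p)))%N.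
pose zz (y : 'rV[R]_k) : 'rV[R]_n := lsubmx y.
pose Om (y : 'rV[R]_k) : 'rV[R]_n := lsubmx (rsubmx y).
pose V (y : 'rV[R]_k) : 'rV[R]_n := ins i (lsubmx (rsubmx (rsubmx y))) 1.
pose A (y : 'rV[R]_k) : 'rV[R]_n := ins i' (rsubmx (rsubmx (rsubmx y))) 1.
have zzL y y' : `|zz y' - zz y| <= `|y' - y| by rewrite -linearB; exact: lsubmx_norm.
have OmL y y' : `|Om y' - Om y| <= `|y' - y|.
  by rewrite -!linearB; apply: le_trans (lsubmx_norm _) (rsubmx_norm _).
have VL y0 : lipv y0 V by apply: lipv_ins; apply: lipv_lsubmx; do 2 apply: lipv_rsubmx; exact: lipv_id.
have AL y0 : lipv y0 A by apply: lipv_ins; do 3 apply: lipv_rsubmx; exact: lipv_id.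
pose Lam J (y : 'rV[R]_k) : 'rV[R]_m := row_mx (D1 J) (row_mx (stat_form J (V y))
  (row_mx (base_form J (Om y) (A y) 0 (V y)) (col' i (fibre_form J (A y) 0 (V y))))).
pose gg (y : 'rV[R]_k) : 'rV[R]_m := row_mx (D1 (jet L (Om y))) (row_mx (D2 (jet L (Om y)) (V y))
  (row_mx 0 (col' i (D2 (jet L (Om y)) (A y) +
     (3 * 0 / T ^+ 2) *: D3 (jet L (Om y)) (V y) (V y))))).
have LamJ y0 : jformv y0 Lam.
  apply: jformv_row_mx; first by move=> l; exact: jform_D1.
  apply: jformv_row_mx; first exact: jformv_stat.
  apply: jformv_row_mx; first exact: jformv_base.
  by apply: jformv_col'; exact: jformv_fibre.
have ggL y0 : lipv y0 gg.
  apply: lipv_row_mx; first exact: lipv_D1.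
  apply: lipv_row_mx; first exact: lipv_D2.
  apply: lipv_row_mx; first exact: lipv0.
  by apply: lipv_col'; apply: lipvD; [exact: lipv_D2|apply: lipvZ; exact: lipv_D3].
have km : (k < m)%N by rewrite /k /m !ltn_add2l ltn_add2r.
have [M GM HM] := @residual_avoidance R n k m Lam gg zz LamJ ggL zzL km.
exists M => // psi z om v a Mpsi vi ai' nav e0 e1 e3 e4.
pose y : 'rV[R]_k := row_mx z (row_mx om (row_mx (col' i v) (col' i' a))).
have zE : zz y = z by rewrite /zz /y row_mxKl.
have omE : Om y = om by rewrite /Om /y row_mxKr row_mxKl.
have vE : V y = v by rewrite /V /y !row_mxKr row_mxKl -vi ins_col'.
have aE : A y = a by rewrite /A /y !row_mxKr -ai' ins_col'.
have v0 : v != 0 by apply: contraTneq (oner_neq0 R) => v0; rewrite -vi v0 mxE eqxx.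
have a0 : a != 0 by apply: contraTneq (oner_neq0 R) => a0; rewrite -ai' a0 mxE eqxx.
have /HM : M psi by []. move=> /(_ y); rewrite /sys /Lam /gg zE omE vE aE !add_row_mx.
have -> : forall x x' : 'rV[R]_n, col' i x + col' i x' = col' i (x + x').
  by move=> x x'; apply/rowP => j; rewrite !mxE.
rewrite e0 e1 e3 e4 addr0.
have -> : col' i (0 : 'rV[R]_n) = 0 by apply/rowP => j; rewrite !mxE.
rewrite !row_mx0 eqxx => Hreg.
suff /Hreg : regular_param Lam zz y by [].
move=> mu; rewrite /Lam zE omE vE aE.
rewrite -[mu]hsubmxK -[rsubmx mu]hsubmxK -[rsubmx (rsubmx mu)]hsubmxK.
move: (lsubmx mu) (lsubmx (rsubmx mu)) (lsubmx (rsubmx (rsubmx mu))) (rsubmx (rsubmx (rsubmx mu))).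
move=> m0 m1 m2 m3 H.
have ev := @evaluation om a v z 0 m0 m1 m2 (ins i m3 0) _.
have {H}/ev{}ev f : nice f -> dotv m0 (D1 (jet f z)) + dotv m1 (stat_form (jet f z) v) +
  dotv m2 (base_form (jet f z) om a 0 v) + dotv (ins i m3 0) (fibre_form (jet f z) a 0 v) = 0.
  by move=> /H; rewrite !dotv_row_mx !addrA dotv_ins mul0r add0r.
have m2z : m2 = 0.
  apply: (prod_nonzero3 (u := a) (v := v)) => // kap; have [_ _ + _] := ev kap.
  by rewrite mulr0 mul0r addr0 => /eqP; rewrite mulf_eq0 gt_eqF //= => /eqP.
have m3z : m3 = 0.
  apply: (@prod_nonzero _ p (col' i a - a 0 i *: col' i v)) => [kap|]; last first.
    apply: contra_notN nav => /eqP E; rewrite -[LHS](ins_col' i).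
    apply/rowP => j; rewrite mxE; case: (unliftP i j) => [h ->|->].
      by have /rowP/(_ h) := E; rewrite !mxE => /eqP; rewrite subr_eq0 => /eqP.
    by rewrite mxE vi mulr1.
  (* This covector is orthogonal to v, as v has i-th coordinate 1, which removes the m1 term; its
     product with a is that of [kap] with the part of a transverse to v. *)
  have [_ + _ _] := ev (ins i kap (- dotv kap (col' i v))).
  rewrite m2z /Mx !dotv0r mulr0 subr0 !dotv_ins vi mulr1 addNr mul0r mulr0 add0r.
  rewrite ins_at mulr0 add0r => /eqP; rewrite mulf_eq0 gt_eqF //= => /eqP.
  rewrite (_ : col' i (ins i m3 0) = m3); last by apply/rowP => j; rewrite mxE ins_lift.
  by move=> <-; rewrite dotvDr -scaleNr dotvZr; ring.
have m1z : m1 = 0.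
  apply: prod_nonzero v0 => kap; have [_ + _ _] := ev kap.
  have -> : ins i m3 0 = 0.
    by apply/rowP => j; rewrite m3z !mxE; case: unlift => [h|]; rewrite ?mxE.
  rewrite m2z /Mx !dotv0r !mulr0 subr0 addr0 => /eqP.
  by rewrite mulf_eq0 gt_eqF //= => /eqP.
have m0z : m0 = 0 by apply: dotv_eq0; have [] := ev m0.
by rewrite m0z m1z m2z m3z !row_mx0.
Qed.

(* For [a = v] the fibre equation repeats stationarity, which leaves [3 n - 1]
   unknowns for [3 n] equations. *)
Theorem generic_no_parallel_multiplier (i : 'I_n) : exists2 M : set (Cb R n 4), Gdelta_dense M &
  forall (psi : Cb R n 4) z om v, M psi -> v 0 i = 1 ->
  eq_costate psi z om -> eq_stat psi z om v -> eq_base psi z om v 0 v -> False.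
Proof.
pose k := (n + (n + p))%N; pose m := (n + (n + n))%N.
pose zz (y : 'rV[R]_k) : 'rV[R]_n := lsubmx y.
pose Om (y : 'rV[R]_k) : 'rV[R]_n := lsubmx (rsubmx y).
pose V (y : 'rV[R]_k) : 'rV[R]_n := ins i (rsubmx (rsubmx y)) 1.
have zzL y y' : `|zz y' - zz y| <= `|y' - y| by rewrite -linearB; exact: lsubmx_norm.
have OmL y y' : `|Om y' - Om y| <= `|y' - y|.
  by rewrite -!linearB; apply: le_trans (lsubmx_norm _) (rsubmx_norm _).
have VL y0 : lipv y0 V by apply: lipv_ins; do 2 apply: lipv_rsubmx; exact: lipv_id.
pose Lam J (y : 'rV[R]_k) : 'rV[R]_m :=
  row_mx (D1 J) (row_mx (stat_form J (V y)) (base_form J (Om y) (V y) 0 (V y))).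
pose gg (y : 'rV[R]_k) : 'rV[R]_m :=
  row_mx (D1 (jet L (Om y))) (row_mx (D2 (jet L (Om y)) (V y)) 0).
have LamJ y0 : jformv y0 Lam.
  apply: jformv_row_mx; first by move=> l; exact: jform_D1.
  apply: jformv_row_mx; first exact: jformv_stat.
  exact: jformv_base.
have ggL y0 : lipv y0 gg.
  apply: lipv_row_mx; first exact: lipv_D1.
  by apply: lipv_row_mx; [exact: lipv_D2|exact: lipv0].
have km : (k < m)%N by rewrite /k /m !ltn_add2l.
have [M GM HM] := @residual_avoidance R n k m Lam gg zz LamJ ggL zzL km.
exists M => // psi z om v Mpsi vi e0 e1 e3.
pose y : 'rV[R]_k := row_mx z (row_mx om (col' i v)).
have zE : zz y = z by rewrite /zz /y row_mxKl.
have omE : Om y = om by rewrite /Om /y row_mxKr row_mxKl.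
have vE : V y = v by rewrite /V /y !row_mxKr -vi ins_col'.
have v0 : v != 0 by apply: contraTneq (oner_neq0 R) => v0; rewrite -vi v0 mxE eqxx.
have /HM : M psi by []. move=> /(_ y); rewrite /sys /Lam /gg zE omE vE !add_row_mx.
rewrite e0 e1 e3 addr0 !row_mx0 eqxx => Hreg.
suff /Hreg : regular_param Lam zz y by [].
move=> mu; rewrite /Lam zE omE vE.
rewrite -[mu]hsubmxK -[rsubmx mu]hsubmxK.
move: (lsubmx mu) (lsubmx (rsubmx mu)) (rsubmx (rsubmx mu)) => m0 m1 m2 H.
have ev := @evaluation om v v z 0 m0 m1 m2 0 _.
have {H}/ev{}ev f : nice f -> dotv m0 (D1 (jet f z)) + dotv m1 (stat_form (jet f z) v) +
  dotv m2 (base_form (jet f z) om v 0 v) + dotv 0 (fibre_form (jet f z) v 0 v) = 0.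
  by move=> /H; rewrite !dotv_row_mx !addrA dotv0l addr0.
have m2z : m2 = 0.
  apply: (prod_nonzero3 (u := v) (v := v)) => // kap; have [_ _ + _] := ev kap.
  by rewrite mulr0 mul0r addr0 => /eqP; rewrite mulf_eq0 gt_eqF //= => /eqP.
have m1z : m1 = 0.
  apply: prod_nonzero v0 => kap; have [_ + _ _] := ev kap.
  rewrite m2z /Mx !dotv0r !mulr0 subr0 addr0 => /eqP.
  by rewrite mulf_eq0 gt_eqF //= => /eqP.
have m0z : m0 = 0 by apply: dotv_eq0; have [] := ev m0.
by rewrite m0z m1z m2z !row_mx0.
Qed.

(** Dividing by nonzero coordinates of v and a, or by b, brings every (a, b) <> 0 into one of the
    three normalised cases; the sets for the finitely many choices of coordinates are
    intersected. *)
Theorem generic_nondegeneracy : exists2 M : set (Cb R n 4), Gdelta_dense M &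
  forall (psi : Cb R n 4) z om v a b, M psi -> v != 0 ->
  eq_costate psi z om -> eq_stat psi z om v -> eq_base psi z om a b v ->
  eq_fibre psi z om a b v -> a = 0 /\ b = 0.
Proof.
have [MA HA] := choice (fun i => let: ex_intro2 M G H := generic_no_parallel_multiplier i in
  ex_intro (fun M => Gdelta_dense M /\ _) M (conj G H)).
have [MB HB] := choice (fun ij : 'I_n * 'I_n => let: ex_intro2 M G H := generic_no_transverse_multiplier ij.1 ij.2 in
  ex_intro (fun M => Gdelta_dense M /\ _) M (conj G H)).
have [MC HC] := choice (fun i => let: ex_intro2 M G H := generic_no_base_multiplier i in
  ex_intro (fun M => Gdelta_dense M /\ _) M (conj G H)).
pose M (x : 'I_n + 'I_n * 'I_n + 'I_n) := match x with
  | inl (inl i) => MA i | inl (inr ij) => MB ij | inr i => MC i end.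
exists (\bigcap_x M x).
  apply: Gdelta_denseI => -[[i|ij]|i] /=; [exact: (HA i).1|exact: (HB ij).1|exact: (HC i).1].
move=> psi z om v a b Mpsi v0 e0 e1 e3 e4.
have [i vi] : exists i, v 0 i != 0.
  apply: contrapT => H; move/eqP: v0; apply; apply/rowP => i; rewrite mxE.
  by apply/eqP; apply: contrapT => /negP ne; apply: H; exists i.
have [s [v' [s0 v'i vE]]] : exists s v', [/\ s != 0, v' 0 i = 1 & v = s *: v'].
  exists (v 0 i), ((v 0 i)^-1 *: v); split=> //; first by rewrite mxE mulVf.
  by rewrite scalerA divff // scale1r.
have e1' : eq_stat psi z om v'.
  move: e1; rewrite /eq_stat vE stat_scale => /eqP.
  by rewrite scaler_eq0 (negbTE s0) /= => /eqP.
have scaled (a' : 'rV[R]_n) (b' t : R) : t != 0 -> a = (t * s ^+ 2) *: a' -> b = t * b' ->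
    eq_base psi z om a' b' v' /\ eq_fibre psi z om a' b' v'.
  move=> t0 aE bE; move: e3 e4; rewrite /eq_base /eq_fibre vE aE bE base_scale fibre_scale.
  move=> /eqP; rewrite scaler_eq0 mulf_eq0 expf_eq0 /= (negbTE t0) (negbTE s0) /= => /eqP ->.
  by move=> /eqP; rewrite scaler_eq0 mulf_eq0 expf_eq0 /= (negbTE t0) (negbTE s0) /= => /eqP ->.
have s2 : s ^+ 2 != 0 by rewrite expf_neq0.
have b0 : b = 0.
  apply: contrapT => /eqP b0.
  have [] := scaled ((b * s ^+ 2)^-1 *: a) 1 b b0; rewrite ?mulr1 //.
    by rewrite scalerA divff ?scale1r // mulf_neq0.
  by move=> e3' e4'; apply: ((HC i).2 psi z om v' _ (Mpsi (inr i) I) v'i e0 e1' e3' e4').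
split=> //; apply: contrapT => /eqP a0.
have [ij' ai'] : exists i', a 0 i' != 0.
  apply: contrapT => H; move/eqP: a0; apply; apply/rowP => j; rewrite mxE.
  by apply/eqP; apply: contrapT => /negP ne; apply: H; exists j.
have [al [a' [al0 a'i aE0]]] : exists al a', [/\ al != 0, a' 0 ij' = 1 & a = al *: a'].
  exists (a 0 ij'), ((a 0 ij')^-1 *: a); split=> //; first by rewrite mxE mulVf.
  by rewrite scalerA divff // scale1r.
have aE : a = (al / s ^+ 2 * s ^+ 2) *: a' by rewrite mulfVK.
have t0 : al / s ^+ 2 != 0 by rewrite mulf_neq0 // invr_neq0.
have [|e3' e4'] := scaled a' 0 (al / s ^+ 2) t0 aE; first by rewrite mulr0.
have [aE'|] := pselect (a' = a' 0 i *: v'); last first.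
  move=> nav; exact: ((HB (i, ij')).2 psi z om v' a' (Mpsi (inl (inr (i, ij'))) I) v'i a'i nav e0 e1' e3' e4').
have c0 : a' 0 i != 0.
  by apply: contra_eq_neq a'i => c0; rewrite aE' c0 scale0r mxE eq_sym oner_neq0.
have [||e3'' _] := scaled v' 0 (a' 0 i * al / s ^+ 2) (mulf_neq0 (mulf_neq0 c0 al0) (invr_neq0 s2)).
- by rewrite mulfVK // [a' 0 i * _]mulrC -scalerA -aE'.
- by rewrite mulr0.
exact: ((HA i).2 psi z om v' (Mpsi (inl (inl i)) I) v'i e0 e1' e3'').
Qed.

End DegeneracySystems.

(** * The Legendre transform *)

Section MatrixCk.
Context {R : realType} {m : nat}.

Lemma Ck_det k n (A : 'rV[R]_m -> 'M[R]_n) : (forall i j, Ck k (fun x => A x i j)) ->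
  Ck k (fun x => \det (A x)).
Proof.
move=> H; apply: Ck_sumf => s _.
have HP := @Ck_prodf R m k _ _ xpredT (fun i x => A x i (perm.fun_of_perm s i)) (fun i _ => H _ _).
have HM := CkM (Ck_cst ((-1) ^+ perm.odd_perm s)) (HP (index_enum _)).
by apply: eq_ind HM _ _; apply/funext.
Qed.

(** By Cramer's formula, the entries of the inverse need only determinants and one reciprocal. *)
Lemma Ck_invmx k n (A : 'rV[R]_m -> 'M[R]_n) : (forall x, A x \in unitmx) ->
  (forall i j, Ck k (fun x => A x i j)) -> forall i j, Ck k (fun x => invmx (A x) i j).
Proof.
move=> Au H i j.
have -> : (fun x => invmx (A x) i j) =
    (fun x => (\det (A x))^-1) * ((-1) ^+ (j + i) *: (fun x => \det (row' j (col' i (A x))))).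
  by apply/funext => x; rewrite /invmx Au !mxE.
apply: CkM.
  apply: Ck_inv; first by move=> x; have := Au x; rewrite unitmxE unitfE.
  exact: Ck_det.
apply: CkZ; apply: Ck_det => a b.
have := H (lift j a) (lift i b); congr Ck; apply/funext => x; by rewrite !mxE.
Qed.

End MatrixCk.

Section ChainRule.
Context {R : realType} {p q : nat}.

Lemma derive_lincomb (f : 'rV[R]_p -> R) x v : Ck 1 f ->
  derivable f x v /\ 'D_v f x = \sum_i v 0 i * 'D_(delta_mx 0 i) f x.
Proof.
move=> Hf; have [df E] := Ck_diff x Hf.
by split; [exact: diff_derivable|rewrite deriveE // E].
Qed.

Lemma derive_comp_rV (f : 'rV[R]_p -> R) (g : 'rV[R]_q -> 'rV[R]_p) x v :
  Ck 1 f -> (forall j, Ck 1 (fun x => g x 0 j)) ->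
  'D_v (f \o g) x = \sum_j 'D_v (fun x => g x 0 j) x * 'D_(delta_mx 0 j) f (g x).
Proof.
move=> Hf Hg; have [df E] := Ck_diff (g x) Hf.
have [|dg Eg] := @diff_rV _ _ _ g x; first by move=> j; have [] := Ck_diff x (Hg j).
rewrite deriveE; last exact: differentiable_comp.
rewrite diff_comp //= Eg E; apply: eq_bigr => j _; rewrite mxE.
by rewrite -deriveE //; have [] := Ck_diff x (Hg j).
Qed.

Lemma diff_coord (g : 'rV[R]_q -> 'rV[R]_p) x j : differentiable g x ->
  differentiable (fun y => g y 0 j) x /\ forall v, 'd (fun y => g y 0 j) x v = 'd g x v 0 j.
Proof.
move=> dg; have [dc Ec] := Ck_diff (g x) (@Ck_coord R p 1 j).
have dh : differentiable ((fun y : 'rV[R]_p => y 0 j) \o g) x by exact: differentiable_comp.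
split=> // v.
have -> : (fun y => g y 0 j) = (fun y : 'rV[R]_p => y 0 j) \o g by [].
rewrite diff_comp //= Ec /lincomb (bigD1 j) //= big1 => [|i ij].
  by have [_ ->] := derive_coord j j (g x); rewrite eqxx mulr1 addr0.
by have [_ ->] := derive_coord i j (g x); rewrite (negbTE ij) mulr0.
Qed.

End ChainRule.

Section DotNegation.
Context {R : realType} {n : nat}.
Implicit Types u v : 'rV[R]_n.

Lemma dotvNl u v : dotv (- u) v = - dotv u v.
Proof. by rewrite -scaleN1r dotvZl mulN1r. Qed.

Lemma dotvNr u v : dotv u (- v) = - dotv u v.
Proof. by rewrite dotvC dotvNl dotvC. Qed.

End DotNegation.

Section DerivativeRules.
Context {R : realType} {m : nat}.
Implicit Types (f g : 'rV[R]_m -> R) (x v : 'rV[R]_m).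

Lemma Ck_is_derive f x v : Ck 1 f -> is_derive x v f ('D_v f x).
Proof. by move=> /(derive_lincomb x v)[d _]; apply: DeriveDef. Qed.

Lemma is_derive_eqf f g x v (d e : R) : is_derive x v f d -> f =1 g -> d = e -> is_derive x v g e.
Proof. by move=> H /funext <- <-. Qed.

Lemma is_derive_addf f g x v (df dg : R) : is_derive x v f df -> is_derive x v g dg ->
  is_derive x v (fun y => f y + g y) (df + dg).
Proof. by move=> Hf Hg; have := is_deriveD Hf Hg. Qed.

Lemma is_derive_mulf f g x v (df dg : R) : is_derive x v f df -> is_derive x v g dg ->
  is_derive x v (fun y => f y * g y) (df * g x + f x * dg).
Proof.
move=> Hf Hg; have := is_deriveM Hf Hg.
by rewrite addrC [g x *: df]mulrC.
Qed.

Lemma is_derive_scalef f x v (c df : R) : is_derive x v f df ->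
  is_derive x v (fun y => c * f y) (c * df).
Proof. by move=> Hf; have := is_deriveZ c Hf. Qed.

Lemma is_derive_sumf k (F : 'I_k -> 'rV[R]_m -> R) x v (d : 'I_k -> R) :
  (forall i, is_derive x v (F i) (d i)) ->
  is_derive x v (fun y => \sum_i F i y) (\sum_i d i).
Proof.
move=> H; have := is_derive_sum H.
by rewrite (_ : \sum_(i < k) F i = fun y => \sum_i F i y) //; apply/funext => y; rewrite fct_sumE.
Qed.

Lemma is_derive_coordf x v i : is_derive x v (fun y => y 0 i) (v 0 i).
Proof.
apply: is_derive_eqf (Ck_is_derive x v (@Ck_coord R m 1 i)) _ _ => //.
have [_ ->] := derive_lincomb x v (@Ck_coord R m 1 i).
rewrite (bigD1 i) //= big1 => [|j ji].
  by have [_ ->] := derive_coord i i x; rewrite eqxx mulr1 addr0.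
by have [_ ->] := derive_coord j i x; rewrite (negbTE ji) mulr0.
Qed.

End DerivativeRules.

Section VectorDerivatives.
Context {R : realType} {m : nat}.
Implicit Types (x v : 'rV[R]_m).

(** Kept coordinatewise, so that the rules for real functions apply directly and derivatives are
    identified by uniqueness. *)
Definition is_vderive n x v (F : 'rV[R]_m -> 'rV[R]_n) (d : 'rV[R]_n) :=
  forall j, is_derive x v (fun y => F y 0 j) (d 0 j).

Lemma is_derive_dotv n x v (F G : 'rV[R]_m -> 'rV[R]_n) d e :
  is_vderive x v F d -> is_vderive x v G e ->
  is_derive x v (fun y => dotv (F y) (G y)) (dotv d (G x) + dotv (F x) e).
Proof.
move=> HF HG.
apply: is_derive_eqf (is_derive_sumf (fun j => is_derive_mulf (HF j) (HG j))) _ _ => //.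
by rewrite big_split.
Qed.

Lemma is_vderive_cst n x v (c : 'rV[R]_n) : is_vderive x v (fun=> c) 0.
Proof. by move=> j; rewrite mxE; exact: is_derive_cst. Qed.

Lemma is_vderive_add n x v (F G : 'rV[R]_m -> 'rV[R]_n) d e :
  is_vderive x v F d -> is_vderive x v G e -> is_vderive x v (fun y => F y + G y) (d + e).
Proof.
by move=> HF HG j; apply: is_derive_eqf (is_derive_addf (HF j) (HG j)) _ _ => [y|]; rewrite mxE.
Qed.

Lemma is_vderive_scale n x v (c : R) (F : 'rV[R]_m -> 'rV[R]_n) d :
  is_vderive x v F d -> is_vderive x v (fun y => c *: F y) (c *: d).
Proof.
by move=> HF j; apply: is_derive_eqf (is_derive_scalef c (HF j)) _ _ => [y|]; rewrite mxE.
Qed.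

Lemma is_vderive_Ck n x v (F : 'rV[R]_m -> 'rV[R]_n) : (forall j, Ck 1 (fun y => F y 0 j)) ->
  is_vderive x v F (\row_j 'D_v (fun y => F y 0 j) x).
Proof. by move=> HF j; apply: is_derive_eqf (Ck_is_derive x v (HF j)) _ _ => //; rewrite mxE. Qed.

Lemma is_derive_comp n (f : 'rV[R]_n -> R) (F : 'rV[R]_m -> 'rV[R]_n) x v d :
  Ck 1 f -> (forall j, Ck 1 (fun y => F y 0 j)) -> is_vderive x v F d ->
  is_derive x v (fun y => f (F y)) (\sum_j d 0 j * 'D_(delta_mx 0 j) f (F x)).
Proof.
move=> Hf HF Hd.
apply: is_derive_eqf (Ck_is_derive x v (Ck_comp Hf HF)) _ _ => //.
rewrite derive_comp_rV //; apply: eq_bigr => j _; congr (_ * _).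
by have [_ ->] := Hd j.
Qed.

End VectorDerivatives.

Section Legendre.
Context {R : realType} {n : nat}.
Notation e_ i := (delta_mx 0 i : 'rV[R]_n).
Variable L : 'rV[R]_n -> R.
Hypotheses (LC : smooth L) (L_convex : uniformly_convex L).
Implicit Types (w h p : 'rV[R]_n).

Lemma grad_Ck k j : Ck k (fun x => grad L x 0 j).
Proof.
have -> : (fun x => grad L x 0 j) = pderiv [:: j] L by apply/funext => x; rewrite mxE.
apply: Ck_pderiv; exact: (@LC (k + 1)%N).
Qed.

Lemma diff_grad w : differentiable (grad L) w /\ forall v, 'd (grad L) w v = v *m hessian L w.
Proof.
have [d E] := diff_jac (@grad_Ck 1%N) w; split=> // v; rewrite E; congr (_ *m _).
apply/matrixP => i j; rewrite !mxE /=.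
by have -> : (fun x => grad L x 0 j) = 'D_(e_ j) L by apply/funext => x; rewrite mxE.
Qed.

Lemma derive_L w h : derivable L w h /\ 'D_h L w = dotv (grad L w) h.
Proof.
have [d ->] := derive_lincomb w h (@LC 1%N); split=> //.
by apply: eq_bigr => i _; rewrite mxE mulrC.
Qed.

Lemma is_vderive_grad w h : is_vderive w h (grad L) (h *m hessian L w).
Proof.
move=> j; apply: is_derive_eqf (Ck_is_derive w h (@grad_Ck 1%N j)) _ _ => //.
have [_ ->] := derive_lincomb w h (@grad_Ck 1%N j); rewrite mxE; apply: eq_bigr => i _.
rewrite mxE /=; congr (_ * _).
by have -> : (fun x => grad L x 0 j) = 'D_(e_ j) L by apply/funext => y; rewrite mxE.
Qed.

(** Mean value theorem for x |-> DL(x) . h between w and w + h; its derivative along h is D^2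
    L(x)(h, h). *)
Lemma grad_monotone : exists2 d : R, 0 < d &
  forall w h, d * dotv h h <= dotv (grad L (w + h) - grad L w) h.
Proof.
have [d d0 Hd] := L_convex; exists d => // w h.
have D x := is_derive_dotv (is_vderive_grad x h) (is_vderive_cst x h h).
have [x|t _] := @MVT_line R 'rV[R]_n (fun x => dotv (grad L x) h) w h; first by have [] := D x.
rewrite dotvDl dotvNl => ->; set x := w + t *: h.
have [_ ->] := D x.
have := Hd x h; rewrite mulmxBr mul_mx_scalar dotvDl -scaleNr dotvZl.
by rewrite mulNr subr_ge0 dotv0r addr0.
Qed.

(** Strong convexity yields a quadratic lower bound, so that the minimum over a large closed ball is
    global. *)
Lemma affine_minimizer p : exists w, forall w', L w + dotv p w <= L w' + dotv p w'.
Proof.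
have [d d0 Hd] := grad_monotone.
pose f w := L w + dotv p w.
have df x h : is_derive x h f (dotv (grad L x + p) h).
  have [dL EL] := derive_L x h.
  have I : is_vderive x h id h by move=> i; exact: is_derive_coordf.
  apply: is_derive_eqf (is_derive_addf (DeriveDef dL EL)
    (is_derive_dotv (is_vderive_cst x h p) I)) _ _ => //.
  by rewrite dotv0l add0r dotvDl.
pose g := grad L 0 + p.
have low w : f 0 + dotv g w + d / 4 * dotv w w <= f w.
  have step (s : R) : 0 <= s -> dotv g w + s * d * dotv w w <= dotv (grad L (s *: w) + p) w.
    rewrite le_eqVlt => /orP[/eqP <-|s0]; first by rewrite scale0r !mul0r addr0.
    have := Hd 0 (s *: w); rewrite add0r dotvZl !dotvZr.
    rewrite dotvDl dotvNl /g !dotvDl => H.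
    have : s * (d * s * dotv w w) <= s * (dotv (grad L (s *: w)) w - dotv (grad L 0) w).
      by move: H; lra.
    by rewrite ler_pM2l //; lra.
  (* Cutting the segment at its midpoint replaces an integral: on the first half the slope is at
     least g . w, on the second at least g . w + (d / 2) w . w, which produces the coefficient d /
     4. *)
  have [t1 /andP[t10 t11]] := @MVT_line R 'rV[R]_n f 0 (2^-1 *: w) (fun y => @ex_derive _ _ _ _ _ _ _ (df y _)).
  have [t2 /andP[t20 t21]] := @MVT_line R 'rV[R]_n f (2^-1 *: w) (2^-1 *: w) (fun y => @ex_derive _ _ _ _ _ _ _ (df y _)).
  rewrite !(@derive_val _ _ _ _ _ _ _ (df _ _)) !dotvZr -scalerDl !add0r !scalerA -scalerDl.
  have -> : 2^-1 + 2^-1 = 1 :> R by lra.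
  rewrite scale1r => E2 E1.
  have ww : 0 <= dotv w w by apply: sumr_ge0 => i _; rewrite -expr2 sqr_ge0.
  have := step (t1 / 2); have := step (2^-1 + t2 / 2).
  have -> : 0 <= 2^-1 + t2 / 2 by lra.
  have -> : 0 <= t1 / 2 by lra.
  move=> /(_ isT) S2 /(_ isT) S1.
  have : 0 <= t1 / 2 * d * dotv w w by rewrite !mulr_ge0 ?(ltW t10) ?(ltW d0).
  have : 2^-1 * d * dotv w w <= (2^-1 + t2 / 2) * d * dotv w w.
    by rewrite !ler_wpM2r ?(ltW d0) // lerDl divr_ge0 // ltW.
  by move: E1 E2 S1 S2; lra.
(* Beyond r the quadratic term outweighs the linear one, which is at most n |g| |w|. *)
pose r := 4 * n%:R * `|g| / d.
have r0 : 0 <= r by rewrite !mulr_ge0 // invr_ge0 ltW.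
have cf : continuous f.
  move=> x; apply: continuousD; first exact: (Ck_cont (@LC 0%N)).
  apply: (@Ck_cont R n 0); apply: Ck_sumf => i _; apply: (@CkZ _ _ 0 (p 0 i)); exact: Ck_coord.
have [||w Dw Hw] := @EVT_min_rV R n f [set x | `|x - 0| <= r] _ (@compact_closed_ball _ _ 0 r).
- by exists 0; rewrite /= subrr normr0.
- exact: continuous_subspaceT.
exists w => w'; have [w'r|w'r] := leP `|w' - 0| r; first by apply: Hw; rewrite inE.
have f0 : f w <= f 0 by apply: Hw; rewrite inE /= subrr normr0.
apply: le_trans f0 _; apply: le_trans (low w').
rewrite -addrA lerDl; rewrite subr0 in w'r.
have := dotv_ge w'; have := dotv_le (- g) w'.
rewrite -scaleN1r dotvZl mulN1r scaleN1r normrN => H1 H2.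
have H3 : d / 4 * `|w'| ^+ 2 <= d / 4 * dotv w' w' by rewrite ler_wpM2l // divr_ge0 // ltW.
have H4 : n%:R * (`|g| * `|w'|) <= d / 4 * `|w'| ^+ 2.
  have -> : n%:R * (`|g| * `|w'|) = d / 4 * r * `|w'| by rewrite /r; field; rewrite gt_eqF.
  by rewrite expr2 [leRHS]mulrA ler_wpM2r // ler_wpM2l ?(ltW w'r) // divr_ge0 // ltW.
by move: H1 H3 H4; lra.
Qed.

(** A chosen minimiser in the definition of H(p); [grad_Hamiltonian] identifies it with DH(p). *)
Definition legendre p : 'rV[R]_n := projT1 (cid (affine_minimizer (p))).

Lemma legendre_min p w : L (legendre p) + dotv p (legendre p) <= L w + dotv p w.
Proof. by rewrite /legendre; case: cid. Qed.

Lemma HamiltonianE p : Hamiltonian L p = L (legendre p) + dotv p (legendre p).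
Proof.
rewrite /Hamiltonian; set A := [set _ | _ in _]; set a := RHS.
have Aa : (A `&` lbound A) a.
  split; first by exists (legendre p).
  by move=> _ [w _ <-]; exact: legendre_min.
case: xgetP => [b _ [Ab lb]|/(_ a)//].
by apply/eqP; rewrite eq_le lb ?Aa.2 //; case: Aa.
Qed.

Lemma grad_legendre p : grad L (legendre p) = - p.
Proof.
set w := legendre p.
apply/eqP; rewrite -subr_eq0 opprK; apply/eqP/dotv_eq0; set h := _ + p.
pose f x := L x + dotv p x.
have df x : is_derive x h f (dotv (grad L x + p) h).
  have [dL EL] := derive_L x h.
  have I : is_vderive x h id h by move=> i; exact: is_derive_coordf.
  apply: is_derive_eqf (is_derive_addf (DeriveDef dL EL)
    (is_derive_dotv (is_vderive_cst x h p) I)) _ _ => //.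
  by rewrite dotv0l add0r dotvDl.
have D (t : R) : is_derive t 1 (fun s : R => f (w + s *: h)) (dotv (grad L (w + t *: h) + p) h).
  have [dl El] := df (w + t *: h); rewrite -El; exact: derive_lineE.
have [||||_ E] := @derive1_at_min R (fun s : R => f (w + s *: h)) (-1) 1 0.
- exact: le_trans (lerN10 _) ler01.
- by move=> t _; have [] := D t.
- by rewrite in_itv /= ltrN10 ltr01.
- by move=> t _; rewrite scale0r addr0; exact: legendre_min.
by have [_] := D 0; rewrite E scale0r addr0.
Qed.

(** Strong monotonicity applied to DL(w(q)) - DL(w(p)) = p - q; taking n + 1 for n keeps the
    constant positive. *)
Lemma legendre_lipschitz : exists2 c : R, 0 < c &
  forall p q, `|legendre q - legendre p| <= c * `|q - p|.
Proof.
have [d d0 Hd] := grad_monotone; exists (n.+1%:R / d); first by rewrite divr_gt0.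
move=> p q; have := Hd (legendre p) (legendre q - legendre p).
rewrite [legendre p + _]addrC subrK !grad_legendre; set h := legendre q - _.
have -> : - q - - p = p - q by rewrite opprK addrC.
move=> H.
have [->|h0] := eqVneq h 0; first by rewrite normr0 mulr_ge0 // divr_ge0 // ltW.
have hp : 0 < `|h| by rewrite normr_gt0.
have H1 := dotv_le (p - q) h; rewrite distrC in H1.
have H2 : d * `|h| ^+ 2 <= d * dotv h h by rewrite ler_pM2l // dotv_ge.
have H3 : d * `|h| * `|h| <= n%:R * `|q - p| * `|h|.
  by rewrite -mulrA -expr2 -[leRHS]mulrA; apply: le_trans H2 (le_trans H H1).
rewrite ler_pM2r // in H3.
rewrite -mulrA mulrCA ler_pdivlMl //; apply: le_trans H3 _.
by rewrite ler_wpM2r // ler_nat.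
Qed.

(** Envelope argument: using the minimiser of one parameter as competitor for the other confines H(p
    + h) - H(p) - h . w(p) between h . (w(p + h) - w(p)) and 0, and the Lipschitz bound makes this
    quadratic in h. *)
Lemma grad_Hamiltonian p : grad (Hamiltonian L) p = legendre p.
Proof.
have [c c0 Hc] := legendre_lipschitz.
have [|e e0|dH E] := @diff_epsP R 'rV[R]_n R (Hamiltonian L) (lincomb (fun i => legendre p 0 i)) p.
- exact: rV_linear_continuous.
- have m0 : 0 < n.+1%:R * c by rewrite mulr_gt0.
  exists (e / (n.+1%:R * c)) => [|h hd]; first by rewrite divr_gt0.
  change (lincomb _ h) with (dotv h (legendre p)).
  have H1 := legendre_min (p + h) (legendre p); have H2 := legendre_min p (legendre (p + h)).
  rewrite -HamiltonianE !dotvDl in H1; rewrite -HamiltonianE in H2.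
  have E1 := HamiltonianE (p + h); have E2 := HamiltonianE p; rewrite dotvDl in E1.
  have H3 : `|Hamiltonian L (p + h) - Hamiltonian L p - dotv h (legendre p)|
      <= dotv h (legendre p - legendre (p + h)).
    rewrite dotvDr dotvNr ler_norml; move: H1 H2 E1 E2.
    set a := Hamiltonian L _; set b := Hamiltonian L _; set x := dotv _ _; set y := dotv _ _.
    lra.
  apply: le_trans H3 (le_trans (dotv_le _ _) _).
  have := Hc (p + h) p; rewrite opprD addNKr normrN => H4.
  apply: (@le_trans _ _ (n.+1%:R * (`|h| * (c * `|h|)))).
    by apply: ler_pM => //; [rewrite ler_nat|rewrite ler_wpM2l].
  have -> : n.+1%:R * (`|h| * (c * `|h|)) = (n.+1%:R * c * `|h|) * `|h| by ring.
  by rewrite ler_wpM2r // mulrC -ler_pdivlMr // ltW.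
apply/rowP => i; rewrite mxE /= deriveE // E.
by change (dotv (e_ i) (legendre p) = legendre p 0 i); rewrite dotvC dotv_delta.
Qed.

Let hess_unit w : hessian L w \in unitmx.
Proof. exact: hessian_unit. Qed.

(** Implicit differentiation of DL(w(p)) = - p; the Lipschitz bound turns an error small relative to
    w(p + h) - w(p) into one small relative to h. *)
Lemma diff_legendre p : differentiable legendre p /\
  forall u, 'd legendre p u = - (u *m invmx (hessian L (legendre p))).
Proof.
have [c c0 Hc] := legendre_lipschitz; set w := legendre p; set A := invmx (hessian L w).
have [K K0 HK] := mulmx_bound A.
have [|e e0|d E] := @diff_epsP R 'rV[R]_n 'rV[R]_n legendre (mulmxr (- A)) p.
- exact: rV_linear_continuous.
- have e'0 : 0 < e / (K * c) by rewrite divr_gt0 // mulr_gt0.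
  have [d d0 Hd] := diff_eps (diff_grad w).1 e'0.
  exists (d / c) => [|h hd]; first by rewrite divr_gt0.
  set eta := legendre (p + h) - w.
  have etale : `|eta| <= c * `|h| by have := Hc p (p + h); rewrite addrAC subrr add0r.
  have etad : `|eta| < d by apply: le_lt_trans etale _; rewrite mulrC -ltr_pdivlMr.
  have := Hd eta etad; rewrite (diff_grad w).2 /eta addrCA subrr addr0 -/eta !grad_legendre => H.
  have -> : eta - mulmxr (- A) h = - ((- (p + h) - - p - eta *m hessian L w) *m A).
    rewrite /= mulmxN mulmxBl mulmxK // opprK.
    have -> : - (p + h) - - p = - h by rewrite opprD opprK addrAC addNr add0r.
    by rewrite mulNmx opprD !opprK addrC.
  rewrite normrN; apply: le_trans (HK _) _.
  have H5 : `|- (p + h) - - p - eta *m hessian L w| <= e / (K * c) * (c * `|h|).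
    by apply: le_trans H _; rewrite ler_wpM2l // ltW.
  apply: (@le_trans _ _ (K * (e / (K * c) * (c * `|h|)))); first by rewrite ler_wpM2l // ltW.
  rewrite le_eqVlt; apply/orP; left; apply/eqP; field.
  by rewrite !gt_eqF.
by split=> // u; rewrite E /= mulmxN.
Qed.

(** Bootstrap: the derivative is minus the inverse Hessian of L evaluated at the map itself, so each
    order of regularity yields the next. *)
Lemma Ck_legendre k j : Ck k (fun p => legendre p 0 j).
Proof.
elim: k j => [|k IH] j.
  apply/Ck0P => p; apply: (@cont_rV_coord R 'rV[R]_n n legendre p j).
  by apply: differentiable_continuous; have [] := diff_legendre p.
have E i : 'D_(e_ i) (fun p => legendre p 0 j) =
    (fun p => - invmx (hessian L (legendre p)) i j).
  apply/funext => p; have [d Ed] := diff_legendre p; have [dj Edj] := diff_coord j d.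
  by rewrite deriveE // Edj Ed mxE -rowE mxE.
apply/CkSP; split=> [p|i p|i].
- have [d _] := diff_legendre p; have [dj _] := diff_coord j d.
  exact: differentiable_continuous.
- have [d _] := diff_legendre p; have [dj _] := diff_coord j d.
  exact: diff_derivable.
rewrite E; apply: (@CkN R n k (fun p => invmx (hessian L (legendre p)) i j)).
apply: (@Ck_invmx R n k n (fun p => hessian L (legendre p))) => [p|a b]; first exact: hess_unit.
have -> : (fun p => hessian L (legendre p) a b) = pderiv [:: a; b] L \o legendre.
  by apply/funext => p; rewrite mxE.
apply: Ck_comp; last exact: IH.
by apply: Ck_pderiv; exact: (@LC (k + 2)%N).
Qed.

End Legendre.

(** * The equations of the exceptional set *)

Section JetSymmetry.
Context {R : realType} {n : nat}.
Variables (f : 'rV[R]_n -> R) (z : 'rV[R]_n).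
Hypothesis f4 : Ck 4 f.
Implicit Types (u v w : 'rV[R]_n).
Notation J := (jet f z).

Lemma jet_perm s t : perm_eq s t -> J s = J t.
Proof.
move=> st; rewrite /jet (perm_size st); case: leqP => // t4.
by rewrite (pderiv_perm f4 _ st) // (perm_size st).
Qed.

Lemma D1_grad : D1 J = grad f z.
Proof. by apply/rowP => i; rewrite !mxE. Qed.

Lemma dotv_D2 u v : dotv u (D2 J v) = dotv v (D2 J u).
Proof.
transitivity (\sum_i \sum_j u 0 i * v 0 j * J [:: j; i]).
  by apply: eq_bigr => i _; rewrite mxE mulr_sumr; apply: eq_bigr => j _; rewrite mulrA.
rewrite exchange_big; apply: eq_bigr => i _; rewrite mxE mulr_sumr; apply: eq_bigr => j _.
by rewrite (@jet_perm [:: i; j] [:: j; i]) 1?mulrA 1?[v 0 i * _]mulrC //; rewrite (perm_catC [:: i] [:: j]).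
Qed.

Lemma D3C u v : D3 J u v = D3 J v u.
Proof.
apply/rowP => l; rewrite !mxE.
transitivity (\sum_i \sum_j u 0 i * v 0 j * J [:: i; j; l]).
  by apply: eq_bigr => i _; rewrite mulr_sumr; apply: eq_bigr => j _; rewrite mulrA.
rewrite exchange_big; apply: eq_bigr => i _; rewrite mulr_sumr; apply: eq_bigr => j _.
rewrite (@jet_perm [:: j; i; l] [:: i; j; l]) ?mulrA ?[v 0 i * _]mulrC //.
by rewrite -[[:: j; i; l]]/([:: j; i] ++ [:: l]) -[[:: i; j; l]]/([:: i; j] ++ [:: l]) perm_cat2r (perm_catC [:: j] [:: i]).
Qed.

Lemma dotv_D3 u v w : dotv u (D3 J v w) = dotv v (D3 J u w).
Proof.
have E a b : dotv a (D3 J b w) = \sum_i \sum_j a 0 i * b 0 j * \sum_h w 0 h * J [:: j; h; i].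
  by apply: eq_bigr => i _; rewrite mxE mulr_sumr; apply: eq_bigr => j _; rewrite mulrA.
rewrite (E u v) (E v u) [RHS]exchange_big /=.
apply: eq_bigr => i _.
apply: eq_bigr => j _.
rewrite (mulrC (v 0 j) (u 0 i)).
apply: (congr1 ( *%R _)); apply: eq_bigr => h _; apply: (congr1 ( *%R _)).
apply: jet_perm; apply/permP => P /=.
by rewrite !addn0 addnCA [(P j + _)%N]addnC addnCA.
Qed.

Lemma dotv_D4 u v w x : dotv u (D4 J v w x) = dotv v (D4 J u w x).
Proof.
have E a b : dotv a (D4 J b w x) =
    \sum_i \sum_j a 0 i * b 0 j * \sum_h w 0 h * \sum_g x 0 g * J [:: j; h; g; i].
  by apply: eq_bigr => i _; rewrite mxE mulr_sumr; apply: eq_bigr => j _; rewrite mulrA.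
rewrite (E u v) (E v u) [RHS]exchange_big /=.
apply: eq_bigr => i _.
apply: eq_bigr => j _.
rewrite (mulrC (v 0 j) (u 0 i)).
apply: (congr1 ( *%R _)); apply: eq_bigr => h _; apply: (congr1 ( *%R _)).
apply: eq_bigr => g _; apply: (congr1 ( *%R _)).
apply: jet_perm; apply/permP => P /=.
by rewrite !addn0 addnCA [(P j + (_ + _))%N]addnCA [(P j + _)%N]addnC [(P g + (_ + P j))%N]addnCA addnCA.
Qed.

End JetSymmetry.

Section ContractionSums.
Context {R : realType} {n : nat}.
Implicit Types (J : seq 'I_n -> R) (u v w : 'rV[R]_n).

Lemma D2E J u l : D2 J u 0 l = \sum_i u 0 i * J [:: i; l].
Proof. by rewrite mxE. Qed.

Lemma D3E J u v l : D3 J u v 0 l = \sum_i u 0 i * \sum_j v 0 j * J [:: i; j; l].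
Proof. by rewrite mxE. Qed.

Lemma D2_0 J : D2 J 0 = 0.
Proof. by apply/rowP => l; rewrite !mxE big1 // => i _; rewrite mxE mul0r. Qed.

Lemma D3_0l J v : D3 J 0 v = 0.
Proof. by apply/rowP => l; rewrite !mxE big1 // => i _; rewrite mxE mul0r. Qed.

Lemma D4_0l J v w : D4 J 0 v w = 0.
Proof. by apply/rowP => l; rewrite !mxE big1 // => i _; rewrite mxE mul0r. Qed.

Lemma D3_exchange J u v l : D3 J u v 0 l = \sum_i v 0 i * \sum_j u 0 j * J [:: j; i; l].
Proof.
rewrite mxE; under eq_bigr do rewrite mulr_sumr.
rewrite exchange_big /=; apply: eq_bigr => i _; rewrite mulr_sumr.
by apply: eq_bigr => j _; exact: mulrCA.
Qed.

Lemma D4_exchange J u v w l :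
  D4 J u v w 0 l = \sum_i v 0 i * \sum_j w 0 j * \sum_h u 0 h * J [:: h; i; j; l].
Proof.
have E a b c (F : 'I_n -> 'I_n -> 'I_n -> R) :
    \sum_i a i * \sum_j b j * \sum_h c h * F i j h = \sum_i \sum_j \sum_h a i * b j * c h * F i j h.
  apply: eq_bigr => i _; rewrite mulr_sumr; apply: eq_bigr => j _.
  by rewrite !mulr_sumr; apply: eq_bigr => g _; rewrite !mulrA.
rewrite mxE (E _ _ _ (fun i j g => J [:: g; i; j; l])) (E _ _ _ (fun i j g => J [:: i; j; g; l])).
rewrite exchange_big /=; apply: eq_bigr => i _; rewrite exchange_big /=; apply: eq_bigr => j _.
apply: eq_bigr => g _; apply: (congr1 ( *%R^~ _)).
by rewrite [RHS]mulrC mulrA.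
Qed.

(** Reassembles the coordinatewise Leibniz sum for the second derivative at a moving point applied
    to a moving vector: u is the velocity of the point, w that of the vector v. *)
Lemma D2_product J u v w l :
  \sum_i (w 0 i * J [:: i; l] + v 0 i * \sum_j u 0 j * J [:: j; i; l]) = (D3 J u v + D2 J w) 0 l.
Proof. by rewrite big_split [RHS]mxE D3_exchange D2E [RHS]addrC. Qed.

Lemma D3_product J u v w v' w' l :
  \sum_i (v' 0 i * \sum_j w 0 j * J [:: i; j; l] +
          v 0 i * \sum_j (w' 0 j * J [:: i; j; l] + w 0 j * \sum_h u 0 h * J [:: h; i; j; l])) =
  (D4 J u v w + (D3 J v' w + D3 J v w')) 0 l.
Proof.
have E2 : \sum_i v 0 i * \sum_j (w' 0 j * J [:: i; j; l] + w 0 j * \sum_h u 0 h * J [:: h; i; j; l]) =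
    D3 J v w' 0 l + D4 J u v w 0 l.
  by under eq_bigr do rewrite big_split mulrDr; rewrite big_split D4_exchange D3E.
rewrite big_split E2 [RHS]mxE [(D3 J v' w + _) 0 l]mxE (D3E J v' w).
by rewrite /= [LHS]addrA [RHS]addrC.
Qed.

End ContractionSums.

Section JetDerivatives.
Context {R : realType} {n m : nat}.
Variables (f : 'rV[R]_n -> R) (Y U V : 'rV[R]_m -> 'rV[R]_n) (x h : 'rV[R]_m).
Variables (dY dU dV : 'rV[R]_n).
Hypotheses (f4 : Ck 4 f) (Y1 : forall j, Ck 1 (fun y => Y y 0 j)).
Hypotheses (YE : is_vderive x h Y dY) (UE : is_vderive x h U dU) (VE : is_vderive x h V dV).
Notation J := (jet f (Y x)).

Lemma is_derive_jet s : (size s <= 3)%N ->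
  is_derive x h (fun y => jet f (Y y) s) (\sum_j dY 0 j * J (j :: s)).
Proof.
move=> s3; have s4 := leqW s3.
have f1 : Ck 1 (pderiv s f) by apply: Ck_pderiv; apply: Ck_le f4.
apply: is_derive_eqf (is_derive_comp f1 Y1 YE) _ _ => [y|]; first by rewrite /jet s4.
apply: eq_bigr => j _; apply: (congr1 ( *%R _)).
by have s3' : (size (j :: s) <= 4)%N by []; rewrite /jet s3'.
Qed.

Lemma is_vderive_D1 : is_vderive x h (fun y => D1 (jet f (Y y))) (D2 J dY).
Proof.
by move=> l; apply: is_derive_eqf (@is_derive_jet [:: l] isT) _ _ => [y|]; rewrite mxE.
Qed.

Lemma is_vderive_D2 : is_vderive x h (fun y => D2 (jet f (Y y)) (U y)) (D3 J dY (U x) + D2 J dU).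
Proof.
move=> l; apply: is_derive_eqf (is_derive_sumf (fun i => is_derive_mulf (UE i) (@is_derive_jet [:: i; l] isT))) _ _.
  by move=> y; rewrite D2E.
exact: D2_product.
Qed.

Lemma is_vderive_D3 : is_vderive x h (fun y => D3 (jet f (Y y)) (U y) (V y))
  (D4 J dY (U x) (V x) + (D3 J dU (V x) + D3 J (U x) dV)).
Proof.
move=> l; apply: is_derive_eqf (is_derive_sumf (fun i => is_derive_mulf (UE i)
  (is_derive_sumf (fun j => is_derive_mulf (VE j) (@is_derive_jet [:: i; j; l] isT))))) _ _.
  by move=> y; rewrite D3E.
exact: D3_product.
Qed.

End JetDerivatives.

Section VectorDerivativeFacts.
Context {R : realType} {m : nat}.
Implicit Types (x v : 'rV[R]_m).

Lemma is_vderive_unique n x v (F : 'rV[R]_m -> 'rV[R]_n) d e :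
  is_vderive x v F d -> is_vderive x v F e -> d = e.
Proof. by move=> Hd He; apply/rowP => j; have [_ <-] := Hd j; have [_ <-] := He j. Qed.

Lemma is_vderive_id x v : is_vderive x v id v.
Proof. by move=> j; exact: is_derive_coordf. Qed.

Lemma is_vderive_eqf n x v (F G : 'rV[R]_m -> 'rV[R]_n) d e :
  is_vderive x v F d -> F =1 G -> d = e -> is_vderive x v G e.
Proof. by move=> H /funext <- <-. Qed.

Lemma is_vderive_D2_cst n x v (f : 'rV[R]_n -> R) (Y : 'rV[R]_m -> 'rV[R]_n) dY u :
  Ck 4 f -> (forall j, Ck 1 (fun y => Y y 0 j)) -> is_vderive x v Y dY ->
  is_vderive x v (fun y => D2 (jet f (Y y)) u) (D3 (jet f (Y x)) dY u).
Proof.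
move=> f4 Y1 YE; apply: is_vderive_eqf (is_vderive_D2 f4 Y1 YE (is_vderive_cst x v u)) _ _ => //.
by rewrite D2_0 addr0.
Qed.

Lemma coord_subZ n (a b : 'rV[R]_n) c j : (a - c *: b) 0 j = a 0 j - c * b 0 j.
Proof. by rewrite !mxE. Qed.

Lemma coord_addZl n (a b : 'rV[R]_n) c j : (c *: a + b) 0 j = c * a 0 j + b 0 j.
Proof. by rewrite !mxE. Qed.

Lemma coord_addZr n (a b : 'rV[R]_n) c j : (a + c *: b) 0 j = a 0 j + c * b 0 j.
Proof. by rewrite !mxE. Qed.

Lemma D2_subZ n (f : 'rV[R]_n -> R) z u w c :
  D2 (jet f z) (u - c *: w) = D2 (jet f z) u - c *: D2 (jet f z) w.
Proof. by rewrite !D2_hessian mulmxBl scalemxAl. Qed.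

End VectorDerivativeFacts.

Section CkJets.
Context {R : realType} {n m : nat}.

Lemma Ck_mulf k (f g : 'rV[R]_m -> R) : Ck k f -> Ck k g -> Ck k (fun y => f y * g y).
Proof. exact: CkM. Qed.

Lemma Ck_jet (f : 'rV[R]_n -> R) (Y : 'rV[R]_m -> 'rV[R]_n) s : (size s <= 3)%N -> Ck 4 f ->
  (forall j, Ck 1 (fun y => Y y 0 j)) -> Ck 1 (fun y => jet f (Y y) s).
Proof.
move=> s3 f4 Y1; have f1 : Ck 1 (pderiv s f) by apply: Ck_pderiv; apply: Ck_le f4.
have := Ck_comp f1 Y1; congr (Ck 1); apply/funext => y.
by rewrite /jet (leqW s3).
Qed.

Lemma Ck_D2 (f : 'rV[R]_n -> R) (Y U : 'rV[R]_m -> 'rV[R]_n) l : Ck 4 f ->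
  (forall j, Ck 1 (fun y => Y y 0 j)) -> (forall j, Ck 1 (fun y => U y 0 j)) ->
  Ck 1 (fun y => D2 (jet f (Y y)) (U y) 0 l).
Proof.
move=> f4 Y1 U1.
have -> : (fun y => D2 (jet f (Y y)) (U y) 0 l) = (fun y => \sum_i U y 0 i * jet f (Y y) [:: i; l]).
  by apply/funext => y; rewrite D2E.
by apply: Ck_sumf => i _; apply: Ck_mulf => //; exact: Ck_jet.
Qed.

Lemma Ck_D3 (f : 'rV[R]_n -> R) (Y U V : 'rV[R]_m -> 'rV[R]_n) l : Ck 4 f ->
  (forall j, Ck 1 (fun y => Y y 0 j)) -> (forall j, Ck 1 (fun y => U y 0 j)) ->
  (forall j, Ck 1 (fun y => V y 0 j)) ->
  Ck 1 (fun y => D3 (jet f (Y y)) (U y) (V y) 0 l).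
Proof.
move=> f4 Y1 U1 V1.
have -> : (fun y => D3 (jet f (Y y)) (U y) (V y) 0 l) =
    (fun y => \sum_i U y 0 i * \sum_j V y 0 j * jet f (Y y) [:: i; j; l]).
  by apply/funext => y; rewrite D3E.
apply: Ck_sumf => i _; apply: Ck_mulf => //; apply: Ck_sumf => j _; apply: Ck_mulf => //.
exact: Ck_jet.
Qed.

End CkJets.

Section Extremals.
Context {R : realType} {n : nat}.
Notation e_ i := (delta_mx 0 i : 'rV[R]_n).
Variables (L psi : 'rV[R]_n -> R) (T : R).
Hypotheses (LC : smooth L) (L_convex : uniformly_convex L) (T_gt0 : 0 < T) (psi4 : Ck 4 psi).
Implicit Types (z u v : 'rV[R]_n).

Definition velocity z : 'rV[R]_n := legendre LC L_convex (grad psi z).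
Notation om := velocity.

Lemma Ck_velocity k j : (k <= 3)%N -> Ck k (fun z => om z 0 j).
Proof.
move=> k3; apply: Ck_le k3 _.
apply: (@Ck_comp R n n 3 (fun p => legendre LC L_convex p 0 j) (grad psi)).
  exact: (@Ck_legendre R n L LC L_convex 3 j).
move=> i; have -> : (fun z => grad psi z 0 i) = pderiv [:: i] psi by apply/funext => z; rewrite mxE.
exact: (@Ck_pderiv R n 3 [:: i] psi).
Qed.

Definition dvelocity z u : 'rV[R]_n := \row_j 'D_u (fun y => om y 0 j) z.
Notation W := dvelocity.

Lemma is_vderive_velocity z u : is_vderive z u om (W z u).
Proof. by apply: is_vderive_Ck => j; exact: Ck_velocity. Qed.

Lemma Ck_dvelocity u j : Ck 2 (fun z => W z u 0 j).
Proof.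
have -> : (fun z => W z u 0 j) = (fun z => \sum_i u 0 i * 'D_(e_ i) (fun y => om y 0 j) z).
  apply/funext => z; rewrite mxE.
  by have [_ ->] := derive_lincomb z u (@Ck_velocity 1 j isT).
apply: Ck_sumf => i _; apply: (@CkZ R n 2 (u 0 i) ('D_(e_ i) (fun y => om y 0 j))).
exact: (@Ck_pderiv R n 2 [:: i] (fun y => om y 0 j) (@Ck_velocity 3 j isT)).
Qed.

Definition ddvelocity z u : 'rV[R]_n := \row_j 'D_u (fun y => W y u 0 j) z.

Lemma is_vderive_dvelocity z u : is_vderive z u (W ^~ u) (ddvelocity z u).
Proof. by apply: is_vderive_Ck => j; apply: Ck_le (Ck_dvelocity u j). Qed.

Let L4 : Ck 4 L. Proof. exact: (@LC 4%N). Qed.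
Let om1 j : Ck 1 (fun z => om z 0 j). Proof. exact: Ck_velocity. Qed.
Let id1 j : Ck 1 (fun z : 'rV[R]_n => id z 0 j). Proof. exact: Ck_coord. Qed.

Lemma costate z : D1 (jet psi z) + D1 (jet L (om z)) = 0.
Proof. by rewrite !D1_grad grad_legendre addrN. Qed.

Lemma costate_derivative z u : D2 (jet psi z) u + D2 (jet L (om z)) (W z u) = 0.
Proof.
have H := is_vderive_add (is_vderive_D1 psi4 id1 (is_vderive_id z u))
  (is_vderive_D1 L4 om1 (is_vderive_velocity z u)).
apply: is_vderive_unique H _.
apply: is_vderive_eqf (is_vderive_cst z u 0) _ erefl => y.
by rewrite costate.
Qed.

Lemma costate_derivative2 z u :
  D3 (jet psi z) u u +
  (D3 (jet L (om z)) (W z u) (W z u) + D2 (jet L (om z)) (ddvelocity z u)) = 0.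
Proof.
have H := is_vderive_add (is_vderive_D2_cst u psi4 id1 (is_vderive_id z u))
  (is_vderive_D2 L4 om1 (is_vderive_velocity z u) (is_vderive_dvelocity z u)).
apply: is_vderive_unique H _.
apply: is_vderive_eqf (is_vderive_cst z u 0) _ erefl => y.
by rewrite costate_derivative.
Qed.

Lemma initial_pointE : initial_point L T psi = (fun z => z - T *: om z).
Proof. by apply/funext => z; rewrite /initial_point grad_Hamiltonian. Qed.

Lemma diff_is_vderive (F : 'rV[R]_n -> 'rV[R]_n) z u d :
  (forall j, Ck 1 (fun y => F y 0 j)) -> is_vderive z u F d -> 'd F z u = d.
Proof.
move=> F1 H; have [|_ E] := @diff_rV R 'rV[R]_n n F z; first by move=> j; have [] := Ck_diff z (F1 j).
rewrite E; apply/rowP => j; rewrite mxE.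
have [df _] := Ck_diff z (F1 j); rewrite -(deriveE u df).
by have [_ ->] := H j.
Qed.

Lemma diff_initial_point z u : 'd (initial_point L T psi) z u = u - T *: W z u.
Proof.
rewrite initial_pointE; apply: diff_is_vderive.
  move=> j; have := CkB (@Ck_coord R n 1 j) (CkZ T (om1 j)).
  by congr (Ck 1); apply/funext => y; rewrite coord_subZ.
have := is_vderive_add (is_vderive_id z u) (is_vderive_scale (- T) (is_vderive_velocity z u)).
rewrite scaleNr => H; apply: is_vderive_eqf H _ erefl => y.
by rewrite scaleNr.
Qed.

Lemma second_diff_initial_point z v :
  second_diff (initial_point L T psi) z v v = - (T *: ddvelocity z v).
Proof.
rewrite /second_diff.
have -> : (fun y => 'd (initial_point L T psi) y v) = (fun y => v - T *: W y v).
  by apply/funext => y; exact: diff_initial_point.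
apply: diff_is_vderive.
  move=> j; have W1 := Ck_le (isT : (1 <= 2)%N) (Ck_dvelocity v j).
  have := CkB (Ck_cst (v 0 j)) (CkZ T W1).
  by congr (Ck 1); apply/funext => y; rewrite coord_subZ.
have := is_vderive_add (is_vderive_cst z v v) (is_vderive_scale (- T) (is_vderive_dvelocity z v)).
rewrite scaleNr add0r => H; apply: is_vderive_eqf H _ erefl => y.
by rewrite scaleNr.
Qed.

Definition stationarity z v : 'rV[R]_n := T *: D2 (jet psi z) v + D2 (jet L (om z)) v.

Definition degeneracy z v : R :=
  dotv v (D3 (jet psi z) v v + T^-2 *: D3 (jet L (om z)) v v).

(** Applying the invertible D^2 L to v - T w_z v, where D^2 L w_z v = - D^2 psi v, gives
    stationarity. Under it w_z v = v / T and T D^2 psi v = - D^2 L v; the symmetric D^2 L is moved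
    onto w_zz(v, v), where the twice differentiated costate identity replaces it by third
    derivatives. *)
Lemma OmegaE z v : Omega L T psi (z, v) <->
  [/\ dotv v v = 1, stationarity z v = 0 & degeneracy z v = 0].
Proof.
have E1 : v *m 'J (initial_point L T psi) z = v - T *: W z v.
  by rewrite mul_rV_lin1 /= diff_initial_point.
have JL := @D2_hessian R n L (om z).
have E2 : (v *m 'J (initial_point L T psi) z = 0) <-> stationarity z v = 0.
  rewrite E1; have E : D2 (jet L (om z)) (v - T *: W z v) = stationarity z v.
    rewrite (D2_subZ L (om z) v (W z v) T) /stationarity.
    move/eqP: (costate_derivative z v); rewrite addr_eq0 => /eqP ->.
    by rewrite scalerN addrC.
  rewrite -E JL; split=> [->|]; first by rewrite mul0mx.
  by move=> H; rewrite -[LHS](mulmxK (hessian_unit (om z) L_convex)) H mul0mx.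
rewrite /Omega /sphere1 /=.
have E3 : stationarity z v = 0 ->
    dotv (v *m hessian psi z) (second_diff (initial_point L T psi) z v v) = - degeneracy z v.
  move=> S0; have WE : W z v = T^-1 *: v.
    have /E2 := S0; rewrite E1 => /eqP; rewrite subr_eq0 => /eqP H.
    by rewrite [in RHS]H scalerA mulVf ?scale1r // gt_eqF.
  rewrite second_diff_initial_point -D2_hessian dotvNr dotvZr -dotvZl.
  have -> : T *: D2 (jet psi z) v = - D2 (jet L (om z)) v by apply/eqP; rewrite -addr_eq0; apply/eqP.
  rewrite dotvNl opprK dotvC dotv_D2 //.
  have D3E : D3 (jet L (om z)) (W z v) (W z v) = T^-2 *: D3 (jet L (om z)) v v.
    by rewrite WE (D3Zl (jet L (om z)) T^-1) (D3Zr (jet L (om z)) T^-1) scalerA -expr2 exprVn.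
  have := costate_derivative2 z v; rewrite D3E addrA => /eqP; rewrite addrC addr_eq0 => /eqP ->.
  by rewrite dotvNr.
split=> [[v1 /E2 S0 H]|[v1 S0 H]]; split=> //.
- by move: H; rewrite E3 // => /eqP; rewrite oppr_eq0 => /eqP.
- exact/E2.
- by rewrite E3 // H oppr0.
Qed.

Local Notation zof y := (lsubmx (y : 'rV[R]_(n + n))).
Local Notation vof y := (rsubmx (y : 'rV[R]_(n + n))).
Implicit Types (y h : 'rV[R]_(n + n)).

(** The sphere equation comes last, so that in the charts the last coordinate alone cuts out R^n x
    S^(n-1). *)
Definition constraint (k : 'I_(n + 2)) y : R := match fintype.split k with
  | inl i => stationarity (zof y) (vof y) 0 i
  | inr j => if j == ord0 then degeneracy (zof y) (vof y) else dotv (vof y) (vof y) - 1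
  end.

Lemma constraint_zeros y : dotv (vof y) (vof y) = 1 ->
  Omega L T psi (zof y, vof y) <-> forall k, constraint k y = 0.
Proof.
move=> v1; split=> [/OmegaE[_ S0 D0] k|H].
  by rewrite /constraint; case: (fintype.split k) => [i|j]; [rewrite S0 mxE|rewrite D0 v1 subrr if_same].
apply/OmegaE; split=> //.
  by apply/rowP => i; rewrite [RHS]mxE -(H (lshift 2 i)) /constraint (unsplitK (inl i)).
by have := H (rshift n ord0); rewrite /constraint (unsplitK (inr ord0)).
Qed.

Lemma constraint_sphere y : constraint (rshift n ord_max) y = dotv (vof y) (vof y) - 1.
Proof. by rewrite /constraint (unsplitK (inr ord_max)). Qed.

Lemma is_vderive_zof y h : is_vderive y h (fun y => zof y) (zof h).
Proof.
move=> j; apply: is_derive_eqf (is_derive_coordf y h (lshift n j)) _ _ => [x|]; by rewrite mxE.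
Qed.

Lemma is_vderive_vof y h : is_vderive y h (fun y => vof y) (vof h).
Proof.
move=> j; apply: is_derive_eqf (is_derive_coordf y h (rshift n j)) _ _ => [x|]; by rewrite mxE.
Qed.

Lemma Ck_zof j : Ck 1 (fun y => zof y 0 j).
Proof.
have := @Ck_coord R (n + n) 1 (lshift n j); congr (Ck 1).
by apply/funext => y; rewrite mxE.
Qed.

Lemma Ck_vof j : Ck 1 (fun y => vof y 0 j).
Proof.
have := @Ck_coord R (n + n) 1 (rshift n j); congr (Ck 1).
by apply/funext => y; rewrite mxE.
Qed.

Lemma Ck_velocity_zof j : Ck 1 (fun y => om (zof y) 0 j).
Proof. exact: Ck_comp (om1 j) Ck_zof. Qed.

Lemma is_vderive_velocity_zof y h : is_vderive y h (fun y => om (zof y)) (W (zof y) (zof h)).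
Proof.
move=> j; apply: is_derive_eqf (is_derive_comp (om1 j) Ck_zof (is_vderive_zof y h)) _ _ => //.
by rewrite mxE; have [_ ->] := derive_lincomb (zof y) (zof h) (om1 j).
Qed.

Definition dstationarity z v zeta nu : 'rV[R]_n :=
  T *: (D3 (jet psi z) zeta v + D2 (jet psi z) nu) +
  (D3 (jet L (om z)) (W z zeta) v + D2 (jet L (om z)) nu).

Definition ddegeneracy z v zeta nu : R :=
  dotv nu (D3 (jet psi z) v v + T^-2 *: D3 (jet L (om z)) v v) +
  dotv v (D4 (jet psi z) zeta v v + (D3 (jet psi z) nu v + D3 (jet psi z) v nu) +
    T^-2 *: (D4 (jet L (om z)) (W z zeta) v v +
             (D3 (jet L (om z)) nu v + D3 (jet L (om z)) v nu))).

Lemma is_vderive_stationarity y h :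
  is_vderive y h (fun y => stationarity (zof y) (vof y))
    (dstationarity (zof y) (vof y) (zof h) (vof h)).
Proof.
exact: (is_vderive_add
  (is_vderive_scale T (is_vderive_D2 psi4 Ck_zof (is_vderive_zof y h) (is_vderive_vof y h)))
  (is_vderive_D2 L4 Ck_velocity_zof (is_vderive_velocity_zof y h) (is_vderive_vof y h))).
Qed.

Lemma is_derive_degeneracy y h :
  is_derive y h (fun y => degeneracy (zof y) (vof y))
    (ddegeneracy (zof y) (vof y) (zof h) (vof h)).
Proof.
have V := is_vderive_vof y h.
exact: (is_derive_dotv V (is_vderive_add (is_vderive_D3 psi4 Ck_zof (is_vderive_zof y h) V V)
  (is_vderive_scale (T^-2) (is_vderive_D3 L4 Ck_velocity_zof (is_vderive_velocity_zof y h) V V)))).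
Qed.

Lemma is_derive_sphere y h :
  is_derive y h (fun y => dotv (vof y) (vof y) - 1) (2 * dotv (vof y) (vof h)).
Proof.
have V := is_vderive_vof y h.
apply: is_derive_eqf (is_derive_addf (is_derive_dotv V V) (is_derive_cst (- 1 : R) y h)) _ _ => //.
by rewrite addr0 (dotvC (vof h)) mulr2n mulrDl mul1r.
Qed.

Lemma Ck_constraint k : Ck 1 (constraint k).
Proof.
have Z := Ck_zof; have V := Ck_vof; have O := Ck_velocity_zof.
rewrite /constraint; case: (fintype.split k) => [i|j].
  have := CkD (CkZ T (Ck_D2 i psi4 Z V)) (Ck_D2 i L4 O V).
  by congr (Ck 1); apply/funext => y; rewrite /stationarity coord_addZl.
case: (j == ord0).
  apply: Ck_sumf => i _; apply: Ck_mulf; first exact: V.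
  have := CkD (Ck_D3 i psi4 Z V V) (CkZ (T^-2) (Ck_D3 i L4 O V V)).
  by congr (Ck 1); apply/funext => y; rewrite coord_addZr.
apply: (@CkD R (n + n) 1 _ (cst (- 1))); last exact: Ck_cst.
by apply: Ck_sumf => i _; apply: Ck_mulf; exact: V.
Qed.

End Extremals.

(** * Multipliers of dependent differentials *)

Section Annihilators.
Context {R : realType} {n : nat}.
Variables (P Q : seq 'I_n -> R) (W : 'rV[R]_n -> 'rV[R]_n) (T : R).
Hypotheses (P2 : forall u w, dotv u (D2 P w) = dotv w (D2 P u))
           (Q2 : forall u w, dotv u (D2 Q w) = dotv w (D2 Q u))
           (P3C : forall u w, D3 P u w = D3 P w u) (Q3C : forall u w, D3 Q u w = D3 Q w u)
           (P3 : forall u v w, dotv u (D3 P v w) = dotv v (D3 P u w))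
           (Q3 : forall u v w, dotv u (D3 Q v w) = dotv v (D3 Q u w))
           (P4 : forall u v w x, dotv u (D4 P v w x) = dotv v (D4 P u w x))
           (Q4 : forall u v w x, dotv u (D4 Q v w x) = dotv v (D4 Q u w x))
           (W0 : W 0 = 0) (PW : forall u, D2 P u + D2 Q (W u) = 0).

Lemma dotv_zero (u : 'rV[R]_n) : (forall w, dotv w u = 0) -> u = 0.
Proof. by move=> H; apply: dotv_eq0. Qed.

Variables (v a xi : 'rV[R]_n) (b rho : R).
Hypotheses (v1 : dotv v v = 1) (S0 : T *: D2 P v + D2 Q v = 0)
           (G0 : dotv v (D3 P v v + T^-2 *: D3 Q v v) = 0)
           (xiE : D2 Q xi = D3 Q a v + (b / T ^+ 2) *: D4 Q v v v)
  (H : forall zeta nu, dotv a (T *: (D3 P zeta v + D2 P nu) + (D3 Q (W zeta) v + D2 Q nu)) +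
     b * (dotv nu (D3 P v v + T^-2 *: D3 Q v v) +
          dotv v (D4 P zeta v v + (D3 P nu v + D3 P v nu) +
                  T^-2 *: (D4 Q (W zeta) v v + (D3 Q nu v + D3 Q v nu)))) +
     rho * (2 * dotv v nu) = 0).

(** The case zeta = 0. For nu = v, symmetry turns the terms in a into a paired with stationarity and
    those in b into 3 b times degeneracy; both vanish, which leaves 2 rho = 0. *)
Lemma annihilator_fibre : rho = 0 /\
  T *: D2 P a + D2 Q a + (3 * b) *: (D3 P v v + T^-2 *: D3 Q v v) = 0.
Proof.
have fibre nu : dotv nu (T *: D2 P a + D2 Q a +
    (3 * b) *: (D3 P v v + T^-2 *: D3 Q v v) + (2 * rho) *: v) = 0.
  have := H 0 nu; rewrite W0 !(D3_0l _ v) !D4_0l !add0r (P3C v nu) (Q3C v nu) => <-.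
  rewrite !(dotvDr, dotvZr) (P2 a nu) (Q2 a nu) (P3 v nu) (Q3 v nu) (dotvC nu v); ring.
have rho0 : rho = 0.
  have := fibre v; rewrite 3!dotvDr 3!dotvZr G0 v1 (P2 v a) (Q2 v a).
  by rewrite -dotvZr -dotvDr S0 dotv0r mulr0 !add0r; lra.
split=> //; apply: dotv_zero => w; have := fibre w.
by rewrite rho0 mulr0 scale0r addr0.
Qed.

(** The case nu = 0. The terms of L contain zeta only through W zeta and amount to W zeta . D^2 L
    xi; by symmetry of D^2 L and the differentiated costate equation this equals - zeta . D^2 psi
    xi. *)
Lemma annihilator_base : T *: D3 P a v + (b *: D4 P v v v + (-1) *: D2 P xi) = 0.
Proof.
apply: dotv_zero => zeta; have := H zeta 0.
rewrite !D2_0 dotv0l dotv0r !mulr0 (P3C v 0) (Q3C v 0) !(D3_0l _ v) !addr0 add0r => <-.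
have E5 : dotv (W zeta) (D2 Q xi) = - dotv zeta (D2 P xi).
  rewrite (Q2 _ xi) (P2 _ xi) -dotvNr; congr dotv; apply/eqP.
  by rewrite -addr_eq0 addrC PW.
move: E5; rewrite xiE !(dotvDr, dotvZr) => E5.
rewrite (P3 a zeta) (Q3 a) (P4 v zeta) (Q4 v).
have -> : dotv zeta (D2 P xi) =
    - (dotv (W zeta) (D3 Q a v) + b / T ^+ 2 * dotv (W zeta) (D4 Q v v v)) by rewrite E5 opprK.
by ring.
Qed.

End Annihilators.

Lemma sum_ord_add2 (R : realType) n (G : 'I_(n + 2) -> R) :
  \sum_k G k = \sum_i G (lshift 2 i) + G (rshift n ord0) + G (rshift n ord_max).
Proof.
rewrite big_split_ord big_ord_recr big_ord1 /= -addrA; congr (_ + (G _ + G _)).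
by congr rshift; exact: val_inj.
Qed.

Section RegularPoints.
Context {R : realType} {p : nat}.
Notation n := p.+1.
Variables (L psi : 'rV[R]_n -> R) (T : R).
Hypotheses (LC : smooth L) (L_convex : uniformly_convex L) (T_gt0 : 0 < T) (psi4 : Ck 4 psi).
Hypothesis nondegenerate : forall z om v a b, v != 0 -> eq_costate L psi z om ->
  eq_stat L T psi z om v -> eq_base L T psi z om a b v -> eq_fibre L T psi z om a b v ->
  a = 0 /\ b = 0.
Notation om := (velocity psi LC L_convex).
Notation W := (dvelocity psi LC L_convex).
Notation stat := (stationarity psi T LC L_convex).
Notation deg := (degeneracy psi T LC L_convex).

Let L4 : Ck 4 L. Proof. exact: (@LC 4%N). Qed.

Lemma dvelocity0 z : W z 0 = 0.
Proof.
apply/rowP => j; rewrite mxE [RHS]mxE.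
have [_ ->] := derive_lincomb z 0 (Ck_velocity LC L_convex psi4 j (isT : (1 <= 3)%N)).
by apply: big1 => i _; rewrite mxE mul0r.
Qed.

Lemma fibre_rearrange (u w x y : 'rV[R]_n) (b : R) :
  T *: u + (3 * b) *: x + (w + (3 * b / T ^+ 2) *: y) = T *: u + w + (3 * b) *: (x + T^-2 *: y).
Proof. by rewrite scalerDr scalerA addrACA addrA. Qed.

Lemma regular_point z v a b rho : Omega L T psi (z, v) ->
  (forall zeta nu, dotv a (dstationarity psi T LC L_convex z v zeta nu) +
     b * ddegeneracy psi T LC L_convex z v zeta nu + rho * (2 * dotv v nu) = 0) ->
  [/\ a = 0, b = 0 & rho = 0].
Proof.
move=> /(OmegaE LC L_convex T_gt0 psi4)[v1 S0 G0] H.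
have v0 : v != 0 by apply/eqP => E; move: v1; rewrite E dotv0l => /esym/eqP; rewrite oner_eq0.
pose xi := adj L T (om z) a b v.
have xiE : D2 (jet L (om z)) xi =
    D3 (jet L (om z)) a v + (b / T ^+ 2) *: D4 (jet L (om z)) v v v.
  by rewrite D2_hessian mulmxKV // hessian_unit.
have P3C := D3C z psi4; have Q3C := D3C (om z) L4.
have P2 := dotv_D2 z psi4; have Q2 := dotv_D2 (om z) L4.
have P3 := dotv_D3 z psi4; have Q3 := dotv_D3 (om z) L4.
have P4 := dotv_D4 z psi4; have Q4 := dotv_D4 (om z) L4.
have PW := costate_derivative LC L_convex psi4 z.
have [rho0 fib0] := annihilator_fibre P2 Q2 P3C Q3C P3 Q3 (dvelocity0 z) v1 S0 G0 H.
have base0 := annihilator_base P2 Q2 P3C Q3C P3 Q3 P4 Q4 PW xiE H.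
have [||||a0 b0] := @nondegenerate z (om z) v a b v0.
- exact: costate.
- exact: S0.
- exact: base0.
- by rewrite /eq_fibre /fibre_form -[RHS]fib0; apply: fibre_rearrange.
- by split.
Qed.

Notation cons := (constraint psi T LC L_convex).

Lemma derive_constraint k (y h : 'rV[R]_(n + n)) :
  'D_h (cons k) y = \sum_i h 0 i * 'D_(delta_mx 0 i) (cons k) y.
Proof. by have [_ ->] := derive_lincomb y h (Ck_constraint T LC L_convex psi4 k). Qed.

Definition constraint_jacobian (y : 'rV[R]_(n + n)) : 'M[R]_(n + n, n + 2) :=
  \matrix_(i, k) 'D_(delta_mx 0 i) (cons k) y.

(** The entries of c are read as the multipliers a of stationarity, b of degeneracy and rho of the
    sphere; pairing the relation with a direction h gives the hypothesis of [regular_point]. *)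
Lemma constraint_jacobian_free y : Omega L T psi (lsubmx y, rsubmx y) ->
  forall c : 'cV[R]_(n + 2), constraint_jacobian y *m c = 0 -> c = 0.
Proof.
move=> Oy c Jc0.
pose a : 'rV[R]_n := \row_i c (lshift 2 i) 0.
pose b := c (rshift n ord0) 0; pose rho := c (rshift n ord_max) 0.
have key h : \sum_k c k 0 * 'D_h (cons k) y = 0.
  have : (h *m (constraint_jacobian y *m c)) 0 0 = 0 by rewrite Jc0 mulmx0 mxE.
  rewrite mulmxA mxE => E; rewrite -[RHS]E; apply: eq_bigr => k _.
  rewrite derive_constraint mulrC [(_ *m _) 0 k]mxE; congr (_ * _).
  by apply: eq_bigr => i _; rewrite [constraint_jacobian y i k]mxE.
have F1 i : cons (lshift 2 i) = (fun y => stat (lsubmx y) (rsubmx y) 0 i).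
  by apply/funext => x; rewrite /constraint (unsplitK (inl i)).
have F2 : cons (rshift n ord0) = (fun y => deg (lsubmx y) (rsubmx y)).
  by apply/funext => x; rewrite /constraint (unsplitK (inr ord0)).
have F3 : cons (rshift n ord_max) =
    (fun y : 'rV[R]_(n + n) => dotv (rsubmx y) (rsubmx y) - 1).
  by apply/funext => x; rewrite constraint_sphere.
have [|a0 b0 r0] := @regular_point (lsubmx y) (rsubmx y) a b rho Oy.
  move=> zeta nu; pose h : 'rV[R]_(n + n) := row_mx zeta nu.
  have Eh1 : lsubmx h = zeta by rewrite row_mxKl.
  have Eh2 : rsubmx h = nu by rewrite row_mxKr.
  have D1 i : 'D_h (cons (lshift 2 i)) y =
      dstationarity psi T LC L_convex (lsubmx y) (rsubmx y) zeta nu 0 i.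
    rewrite F1; have := is_vderive_stationarity T LC L_convex psi4 y h i.
    by rewrite Eh1 Eh2 => -[_ ->].
  have D2 : 'D_h (cons (rshift n ord0)) y =
      ddegeneracy psi T LC L_convex (lsubmx y) (rsubmx y) zeta nu.
    rewrite F2; have := is_derive_degeneracy T LC L_convex psi4 y h.
    by rewrite Eh1 Eh2 => -[_ ->].
  have D3 : 'D_h (cons (rshift n ord_max)) y = 2 * dotv (rsubmx y) nu.
    rewrite F3; have := is_derive_sphere y h.
    by rewrite Eh2 => -[_ ->].
  rewrite -[RHS](key h) (sum_ord_add2 (fun k => c k 0 * 'D_h (cons k) y)) D2 D3.
  congr (_ + _ + _); apply: eq_bigr => i _; by rewrite D1 mxE.
apply/colP => k; rewrite [RHS]mxE; case: (split_ordP k) => [i ->|j ->].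
  by have /rowP/(_ i) := a0; rewrite !mxE.
have [->|->] // : j = ord0 \/ j = ord_max.
by case: j => -[|[|//]] j2; [left|right]; exact: val_inj.
Qed.

End RegularPoints.

(** * Charts *)

Section NearEquality.
Context {R : realType} {V W : normedModType R}.

Lemma cont_near_eq (f g : V -> W) x (d : R) : 0 < d ->
  (forall h, `|h| < d -> f (x + h) = g (x + h)) -> {for x, continuous g} -> {for x, continuous f}.
Proof.
move=> d0 E /cont_epsP cg; apply/cont_epsP => e /cg[d1 d10 Hd1].
exists (Num.min d d1); first by rewrite lt_min d0.
move=> h; rewrite lt_min => /andP[hd hd1]; rewrite E //.
have := E 0; rewrite normr0 addr0 => -> //; exact: Hd1.
Qed.

Lemma open_radius (U : set V) x : open U -> U x ->
  exists2 d : R, 0 < d & forall h, `|h| < d -> U (x + h).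
Proof.
move=> oU Ux; have /nbhs_normP[d /= d0 Hd] : nbhs x U by apply: open_nbhs_nbhs.
exists d => // k kd; apply: Hd.
by rewrite /ball_/= opprD addrA subrr sub0r normrN.
Qed.

End NearEquality.

Section LinearComposition.
Context {R : realType} {V W X : normedModType R}.

Lemma C1_on_comp_linear (l : {linear V -> W}) (f : W -> X) (U : set W) :
  continuous l -> open U -> C1_on U f -> C1_on (l @^-1` U) (f \o l).
Proof.
move=> cl oU fC x Ux.
have dl y : differentiable l y by exact: linear_differentiable.
have E y v : U (l y) -> 'd (f \o l) y v = 'd f (l y) (l v).
  move=> Uy; have [df _] := fC _ Uy.
  by rewrite (diff_comp (dl y) df) /= (diff_lin y cl).
have [df cf] := fC _ Ux; split=> [|v]; first exact: differentiable_comp.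
have [d d0 Hd] : exists2 d : R, 0 < d & forall h, `|h| < d -> (l @^-1` U) (x + h).
  by apply: open_radius => //; apply: open_comp => // y _; exact: cl.
apply: (@cont_near_eq R V X _ (fun y => 'd f (l y) (l v)) x d d0) => [h hd|].
  by apply: E; exact: Hd.
exact: (@continuous_comp V W X l (fun y => 'd f y (l v)) x (cl x) (cf (l v))).
Qed.

Lemma C1_on_linear_comp (l : {linear W -> X}) (f : V -> W) (U : set V) :
  continuous l -> open U -> C1_on U f -> C1_on U (l \o f).
Proof.
move=> cl oU fC x Ux.
have dl y : differentiable l y by exact: linear_differentiable.
have E y v : U y -> 'd (l \o f) y v = l ('d f y v).
  move=> Uy; have [df _] := fC _ Uy.
  by rewrite (diff_comp df (dl (f y))) /= (diff_lin (f y) cl).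
have [df cf] := fC _ Ux; split=> [|v]; first exact: differentiable_comp.
have [d d0 Hd] := open_radius oU Ux.
apply: (@cont_near_eq R V X _ (fun y => l ('d f y v)) x d d0) => [h hd|].
  by apply: E; exact: Hd.
exact: (@continuous_comp V W X (fun y => 'd f y v) l x (cf v) (cl ('d f x v))).
Qed.

End LinearComposition.

Section SquareCompletion.
Context {R : realType}.

(* The rows of [K^T] span the left kernel of [J], hence are orthogonal to its columns. *)
Lemma row_free_complete N q m (e : N = (q + m)%N) (J : 'M[R]_(N, m)) :
  (forall c : 'cV[R]_m, J *m c = 0 -> c = 0) ->
  exists K : 'M[R]_(N, q), row_free (row_mx K J).
Proof.
move=> Jfree.
have rJ : \rank J = m.
  rewrite -mxrank_tr; apply/eqP; rewrite -[_ == m]/(row_free J^T) -kermx_eq0.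
  apply/rowV0P => u /sub_kermxP E; apply: trmx_inj; rewrite trmx0.
  by apply: Jfree; apply: trmx_inj; rewrite trmx_mul trmxK E trmx0.
have rK : \rank (kermx J) = q by rewrite mxrank_ker rJ e addnK.
have [K HK] : exists K : 'M[R]_(q, N), (K :=: kermx J)%MS.
  by move: (row_base (kermx J)) (eq_row_base (kermx J)); rewrite rK => K HK; exists K.
exists K^T; rewrite -kermx_eq0; apply/rowV0P => u /sub_kermxP.
rewrite mul_mx_row -[RHS]row_mx0 => /eq_row_mx[uK uJ].
have /submxP[w E] : (u <= K)%MS by rewrite HK; apply/sub_kermxP.
apply: dotv_eq0; rewrite dotvE {2}E trmx_mul mulmxA uK mul0mx mxE //.
Qed.

Lemma rank_le_of_free N m (J : 'M[R]_(N, m)) :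
  (forall c : 'cV[R]_m, J *m c = 0 -> c = 0) -> (m <= N)%N.
Proof.
move=> Jfree.
have rJ : row_free J^T.
  rewrite -kermx_eq0.
  apply/rowV0P => u /sub_kermxP E; apply: trmx_inj; rewrite trmx0.
  by apply: Jfree; apply: trmx_inj; rewrite trmx_mul trmxK E trmx0.
by rewrite -(eqP rJ) mxrank_tr rank_leq_row.
Qed.

(** Linear functions y K, with K completing the differential of F to an invertible matrix, provide
    the missing q coordinates; F occupies the last m places, as slices demand. *)
Lemma straightening N q m (e : N = (q + m)%N) (F : 'I_m -> 'rV[R]_N -> R) (y0 : 'rV[R]_N) :
  (forall k, Ck 1 (F k)) ->
  (forall c : 'cV[R]_m, (\matrix_(i, k) 'D_(delta_mx 0 i) (F k) y0) *m c = 0 -> c = 0) ->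
  exists Psi : 'rV[R]_N -> 'rV[R]_N, [/\ forall j, Ck 1 (fun y => Psi y 0 j),
    jac Psi y0 \in unitmx & forall y k, Psi y 0 (cast_ord (esym e) (rshift q k)) = F k y].
Proof.
move=> F1 /(row_free_complete e)[K]; set J := (\matrix_(i, k) _) => KJ.
pose Psi (y : 'rV[R]_N) := \row_j match fintype.split (cast_ord e j) with
  | inl i => (y *m K) 0 i | inr k => F k y end.
have PsiE j : (fun y => Psi y 0 j) = match fintype.split (cast_ord e j) with
  | inl i => fun y => (y *m K) 0 i | inr k => F k end.
  by apply/funext => y; rewrite mxE; case: (fintype.split _).
have K1 i : Ck 1 (fun y : 'rV[R]_N => (y *m K) 0 i).
  have -> : (fun y : 'rV[R]_N => (y *m K) 0 i) = (fun y => \sum_j y 0 j * K j i).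
    by apply/funext => y; rewrite mxE.
  by apply: Ck_sumf => j _; apply: Ck_mulf; [exact: Ck_coord|exact: Ck_cst].
have DK i k y : 'D_(delta_mx 0 k) (fun y : 'rV[R]_N => (y *m K) 0 i) y = K k i.
  have [df _] := Ck_diff y (K1 i).
  have -> : (fun y : 'rV[R]_N => (y *m K) 0 i) = (fun y => \sum_j y 0 j * K j i).
    by apply/funext => x; rewrite mxE.
  have H := is_derive_sumf (fun j => is_derive_mulf (is_derive_coordf y (delta_mx 0 k) j)
    (is_derive_cst (K j i) y (delta_mx 0 k))).
  have [_ ->] := H; rewrite (bigD1 k) //= big1 => [|j /negbTE jk].
    by rewrite mxE !eqxx mul1r mulr0 !addr0.
  by rewrite mxE jk andbF mul0r mulr0 addr0.
exists Psi; split.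
- by move=> j; rewrite PsiE; case: (fintype.split _).
- have E (u : 'rV[R]_N) j : (u *m jac Psi y0) 0 j = (u *m row_mx K J) 0 (cast_ord e j).
    rewrite !mxE; apply: eq_bigr => i _; rewrite mxE PsiE mxE.
    case: (fintype.split _) => k; first by rewrite DK.
    by rewrite mxE.
  rewrite -row_free_unit -kermx_eq0; apply/rowV0P => u /sub_kermxP H.
  have : u *m row_mx K J = 0.
    apply/rowP => k; have := E u (cast_ord (esym e) k).
    by rewrite cast_ordKV H !mxE => <-.
  by move/eqP; rewrite mulmx_free_eq0 // => /eqP.
- by move=> y k; rewrite mxE cast_ordKV (unsplitK (inr k)).
Qed.

End SquareCompletion.

Section SliceChart.
Context {R : realType} {E : normedModType R} {N q : nat}.
Variables (M S : set E) (jn : {linear E -> 'rV[R]_N}) (sp : {linear 'rV[R]_N -> E}).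
Hypotheses (cjn : continuous jn) (csp : continuous sp) (jnK : cancel jn sp) (spK : cancel sp jn).
Variables (Psi : 'rV[R]_N -> 'rV[R]_N) (last : 'I_N) (x0 : E).
Hypotheses (lastE : last = N.-1 :> nat) (Psi1 : forall j, Ck 1 (fun y => Psi y 0 j))
  (Junit : jac Psi (jn x0) \in unitmx)
  (ME : forall x, M x <-> Psi (jn x) 0 last = 0)
  (SE : forall x, M x -> S x <-> forall i : 'I_N, (q <= i)%N -> Psi (jn x) 0 i = 0).

(** Inclusion of R^(N-1) as the hyperplane where the last coordinate vanishes; its transpose drops
    that coordinate. *)
Let P : 'M[R]_(N.-1, N) := \matrix_(i, j) (i == j :> nat)%:R.

Let lt_last (j : 'I_N) : j != last -> (j < N.-1)%N.
Proof.
move=> jl; rewrite ltn_neqAle -lastE (inj_eq val_inj) jl lastE /=.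
by rewrite -ltnS (prednK (leq_ltn_trans (leq0n j) (ltn_ord j))).
Qed.

Let widen (i : 'I_N.-1) : 'I_N := widen_ord (leq_pred N) i.

Let widenP j : j != last -> exists i, j = widen i.
Proof. by move=> /lt_last jl; exists (Ordinal jl); exact: val_inj. Qed.

Let extE (w : 'rV[R]_(N.-1)) i : (w *m P) 0 (widen i) = w 0 i.
Proof.
rewrite mxE (bigD1 i) //= big1 => [|j ji]; first by rewrite mxE eqxx mulr1 addr0.
by rewrite mxE (negbTE ji : (j == i :> nat) = false) mulr0.
Qed.

Let ext_last (w : 'rV[R]_(N.-1)) : (w *m P) 0 last = 0.
Proof.
rewrite mxE big1 // => j _; rewrite mxE lastE.
by rewrite (ltn_eqF (ltn_ord j)) mulr0.
Qed.

Let resE (y : 'rV[R]_N) i : (y *m P^T) 0 i = y 0 (widen i).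
Proof.
rewrite mxE (bigD1 (widen i)) //= big1 => [|j ji]; first by rewrite !mxE eqxx mulr1 addr0.
rewrite !mxE; case: eqP => [E0|_]; last by rewrite mulr0.
by move: ji; rewrite -(inj_eq val_inj) /= E0 eqxx.
Qed.

Let ext_res (y : 'rV[R]_N) : y 0 last = 0 -> y *m P^T *m P = y.
Proof.
move=> yl; apply/rowP => j; have [->|/widenP[i ->]] := eqVneq j last.
  by rewrite ext_last yl.
by rewrite extE resE.
Qed.

Let res_ext (w : 'rV[R]_(N.-1)) : w *m P *m P^T = w.
Proof. by apply/rowP => i; rewrite resE extE. Qed.

(** Since M is the zero set of the last coordinate of Psi, dropping that coordinate leaves a chart
    of M. On M the equation of index [last] holds already, so S is still cut out by the indices from
    q on. *)
Theorem slice_chart :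
  exists (U : set E) (W : set 'rV[R]_(N.-1)) (phi : E -> 'rV[R]_(N.-1)) (g : 'rV[R]_(N.-1) -> E),
    [/\ open U /\ U x0, open W, C1_on U phi /\ C1_on W g,
        (forall x, U x -> M x -> W (phi x) /\ g (phi x) = x) /\
        (forall w, W w -> [/\ U (g w), M (g w) & phi (g w) = w]) &
        forall x, U x -> M x ->
          (S x <-> forall i : 'I_(N.-1), (q <= i)%N -> phi x 0 i = 0)].
Proof.
have [U0 [W0 [G [[oU Ux] oW HU HW GC]]]] := inverse_function Psi1 Junit.
have PsiC : C1_on U0 Psi.
  move=> y _; have [dP _] := diff_jac Psi1 y; split=> // v.
  have -> : (fun y => 'd Psi y v) = (fun y => v *m jac Psi y *m 1%:M).
    by apply/funext => x; rewrite mulmx1; have [_ ->] := diff_jac Psi1 x.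
  exact: cont_jac_mul.
have cext : continuous (mulmxr P : 'rV[R]_(N.-1) -> 'rV[R]_N).
  exact: (@rV_linear_continuous R N.-1 'rV[R]_N (mulmxr P)).
have cres : continuous (mulmxr P^T : 'rV[R]_N -> 'rV[R]_(N.-1)).
  exact: (@rV_linear_continuous R N 'rV[R]_(N.-1) (mulmxr P^T)).
exists (jn @^-1` U0), (mulmxr P @^-1` W0), (mulmxr P^T \o (Psi \o jn)), (sp \o (G \o mulmxr P)).
have oU' : open (jn @^-1` U0) by apply: open_comp => // x _; exact: cjn.
have oW' : open (mulmxr P @^-1` W0) by apply: open_comp => // x _; exact: cext.
split=> //.
- split.
    apply: C1_on_linear_comp => //; exact: C1_on_comp_linear.
  apply: C1_on_linear_comp => //; exact: C1_on_comp_linear.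
- split=> [x Ux' /ME Mx|w Ww].
    by rewrite /= ext_res //; have [? ->] := HU _ Ux'; rewrite jnK.
  have [UG PG] := HW _ Ww; rewrite /= spK; split=> //; last by rewrite PG /= res_ext.
  by apply/ME; rewrite spK PG /= ext_last.
- move=> x Ux' Mx; rewrite SE //; split=> H i qi; first by rewrite /= resE; exact: H.
  have [->|/widenP[k E0]] := eqVneq i last; first exact/ME.
  by have := H k; rewrite /= resE E0; apply; move: qi; rewrite E0.
Qed.

End SliceChart.

Section PairRow.
Context {R : realType} {n : nat}.

Definition pair_row (x : 'rV[R]_n * 'rV[R]_n) : 'rV[R]_(n + n) := row_mx x.1 x.2.

Lemma pair_row_is_linear : linear pair_row.
Proof. by move=> a x y; rewrite /pair_row scale_row_mx add_row_mx. Qed.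
HB.instance Definition _ := GRing.isLinear.Build R ('rV[R]_n * 'rV[R]_n)%type 'rV[R]_(n + n) _
  pair_row pair_row_is_linear.

Definition row_pair (y : 'rV[R]_(n + n)) : 'rV[R]_n * 'rV[R]_n := (lsubmx y, rsubmx y).

Lemma row_pair_is_linear : linear row_pair.
Proof. by move=> a x y; rewrite /row_pair !linearP. Qed.
HB.instance Definition _ := GRing.isLinear.Build R 'rV[R]_(n + n) ('rV[R]_n * 'rV[R]_n)%type _
  row_pair row_pair_is_linear.

Lemma pair_rowK : cancel pair_row row_pair.
Proof. by move=> [z v]; rewrite /row_pair row_mxKl row_mxKr. Qed.

Lemma row_pairK : cancel row_pair pair_row.
Proof. by move=> y; rewrite /pair_row hsubmxK. Qed.

Lemma pair_row_continuous : continuous pair_row.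
Proof.
move=> x; apply/cont_epsP => e e0; exists e => // h he.
rewrite -linearB addrAC subrr add0r; apply: norm_rV_le => [|j]; first exact: ltW.
have [h1 h2] : `|h.1| <= `|h| /\ `|h.2| <= `|h| by rewrite prod_normE !le_max !lexx orbT.
rewrite /pair_row; case: (split_ordP j) => i ->; rewrite ?row_mxEl ?row_mxEr.
  exact: le_trans (norm_coord _ _) (le_trans h1 (ltW he)).
exact: le_trans (norm_coord _ _) (le_trans h2 (ltW he)).
Qed.

Lemma row_pair_continuous : continuous row_pair.
Proof. exact: (@rV_linear_continuous R (n + n) ('rV[R]_n * 'rV[R]_n)%type row_pair). Qed.

End PairRow.

Theorem theorem3p1 (R : realType) (n : nat) (n_ge1 : (1 <= n)%N)
    (T : R) (T_gt0 : 0 < T) (L : 'rV[R]_n -> R)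
    (L_smooth : smooth L) (L_convex : uniformly_convex L) :
  exists2 M : set (Cb R n 4), Gdelta_dense M &
    forall psi : Cb R n 4, M psi ->
      embedded_C1_submanifold (n + n).-1
        ([set: 'rV[R]_n] `*` sphere1 : set ('rV[R]_n * 'rV[R]_n)%type)
        (n%:Z - 2%:Z) (Omega L T psi).
Proof.
case: n n_ge1 L L_smooth L_convex => [//|p] _ L L_smooth L_convex.
have [M MG HM] := generic_nondegeneracy (@L_smooth 5%N) L_convex T_gt0.
exists M => // psi Mpsi.
have psi4 : Ck 4 psi := (CbP psi).1.
pose F := constraint psi T L_smooth L_convex.
have F1 k : Ck 1 (F k) by exact: Ck_constraint.
have free (x : 'rV[R]_p.+1 * 'rV[R]_p.+1) : Omega L T psi x ->
    forall c : 'cV[R]_(p.+1 + 2),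
    constraint_jacobian psi T L_smooth L_convex (pair_row x) *m c = 0 -> c = 0.
  move=> Ox; apply: constraint_jacobian_free => //.
    by move=> z om v a b; apply: HM.
  by rewrite -[(_, _)]/(row_pair (pair_row x)) pair_rowK.
have zeros x : (sphere1 x.2) -> Omega L T psi x <-> forall k, F k (pair_row x) = 0.
  move=> x2; rewrite -{1}(pair_rowK x); apply: constraint_zeros => //.
  by rewrite row_mxKr.
have sphereE x : sphere1 x.2 <-> F (rshift p.+1 ord_max) (pair_row x) = 0.
  rewrite /F constraint_sphere row_mxKr /sphere1 /=.
  by split=> [->|/eqP]; [rewrite subrr|rewrite subr_eq0 => /eqP].
case: p => [|q] in L L_smooth L_convex M MG HM psi Mpsi psi4 F F1 free zeros sphereE *.
  (* For n = 1, a point of the set would give a matrix with two rows and three independent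
     columns. *)
  rewrite -[1%:Z - 2%:Z]/(Negz 0) /=; apply/seteqP; split=> // x /free/rank_le_of_free //.
have -> : q.+2%:Z - 2%:Z = Posz q by rewrite -[q.+2]addn2 PoszD addrK.
split=> [[z v] /(OmegaE L_smooth L_convex T_gt0 psi4)[v1 _ _]//|x0 Ox0].
(* Here 2 n = (n - 2) + (n + 2): the n + 2 constraints leave q = n - 2 free coordinates along the
   slice. *)
have e : (q.+2 + q.+2)%N = (q + (q.+2 + 2))%N by rewrite addnCA addn2 addnS addSn.
have [Psi [Psi1 PsiU PsiF]] := straightening e F1 (free x0 Ox0).
(* The place of the sphere constraint, which is the last index 2 n - 1. *)
pose last := cast_ord (esym e) (rshift q (rshift q.+2 ord_max)).
apply: (@slice_chart R _ (q.+2 + q.+2) q _ _ pair_row row_pair (@pair_row_continuous R q.+2)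
  (@row_pair_continuous R q.+2) pair_rowK row_pairK Psi last x0) => //.
- transitivity (q + (q.+2 + 1))%N; first by [].
  by rewrite [X in X.-1]e addn1 addn2 !addnS.
- by move=> [z v]; rewrite PsiF -sphereE; split=> [[]|].
- move=> x [_ x2]; rewrite zeros //; split=> [H i qi|H k].
    have [k ->] : exists k, i = cast_ord (esym e) (rshift q k).
      have ik : (i - q < q.+2 + 2)%N by rewrite ltn_subLR // -e.
      by exists (Ordinal ik); apply: val_inj; rewrite /= subnKC.
    by rewrite PsiF.
  by rewrite -PsiF; apply: H; rewrite /= leq_addr.
Qed.
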